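(* Let $\xi_1,\xi_2,\ldots$ be a Markov chain with state space $(\Omega,\mathcal{F},\pi)$ and associated Markov operator $P$. Then the following statements are equivalent: 1. $P$ has an $L^2(\pi)$-spectral gap. 2. The set $$\mathcal{M}:=\left\{\epsilon>0:\ k_n>\epsilon\ \text{ for all } n\in\mathbb{N}\text{ with } n\le\left[\frac{2\pi}{\arccos(1-\frac{\kappa}{16}\epsilon^2)}\right]+1\right\}$$ is non-empty (in this formula $\pi$ is the number $3.14\ldots$). If $\mathcal{M}\neq\emptyset$, then $$\sigma(P-P_1)\subset B_{r_0}(0),\qquad r_0:=\inf_{\epsilon\in\mathcal{M}}\Bigl(1-\frac{\kappa}{16}\epsilon^2\Bigr)^{1/\left(\left[\frac{2\pi}{\arccos(1-\frac{\kappa}{16}\epsilon^2)}\right]+1\right)},$$ where $B_r(0)$ is the (closed) ball of radius $r$ centred at $0$ in $\mathbb{C}$.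
   Context: Standing assumptions: $\xi_1,\xi_2,\ldots$ is a time-homogeneous, discrete-time, $\pi$-irreducible positive recurrent Markov chain on a state space $(\Omega,\mathcal{F})$ with $\mathcal{F}$ countably generated, transition kernel $p(\cdot,\cdot)$ ($n$-step kernel $p^n$) and unique invariant probability measure $\pi$. The Markov operator is $Pf(x)=\int_\Omega f(y)\,p(x,dy)$ on $L^2(\pi)$, $P_1f=\int_\Omega f\,d\pi$, and $\sigma(\cdot)$ denotes the spectrum (on complex $L^2(\pi)$). Put $L_0^2(\pi)=\{f\in L^2(\pi):\int f\,d\pi=0\}$. $P$ has an $L^2(\pi)$-spectral gap if $\rho:=\lim_{n\to\infty}\sup\{\|P^nf\|_2^{1/n}: f\in L_0^2(\pi),\|f\|_2=1\}<1$. For $A\in\mathcal{F}$ with $0<\pi(A)<1$ (infima over $A$ are over such sets, assumed to exist), put $$k_n(A)=\frac{1}{\pi(A)\pi(A^c)}\int_A p^n(x,A^c)\,\pi(dx),\qquad k_n=\inf_{A}k_n(A).$$ $[x]$ denotes the integer part of $x$. The constant $\kappa$ is $$\kappa=\inf_{\mathcal{D}}\sup_{c\in\mathbb{R}}\frac{\bigl(E|(X+c)^2-(Y+c)^2|\bigr)^2}{E((X+c)^2)},$$ where $\mathcal{D}$ is the set of all possible distributions of i.i.d. real random variables $(X,Y)$ with variance $1$. Lawler and Sokal showed that $\kappa\ge1$ and that $\Re(\sigma(\mathrm{Id}-P))\ge\frac{\kappa}{8}k_1^2$ for $P$ considered on $L_0^2(\pi)$. *)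

(* Defs.v *)
(* MathComp-Analysis, over an arbitrary [R : realType]; complex numbers are
   [R[i]] from mathcomp-real-closed. *)
From HB Require Import structures.
From mathcomp Require Import all_boot all_order all_algebra.
From mathcomp Require Import complex.
From mathcomp Require Import all_classical all_reals all_analysis.

Set Implicit Arguments.
Unset Strict Implicit.
Unset Printing Implicit Defensive.

Import Order.TTheory GRing.Theory Num.Theory.
Import numFieldNormedType.Exports.

Local Open Scope classical_set_scope.
Local Open Scope ring_scope.

Section chain.
Context {R : realType} {d : measure_display} {T : measurableType d}.

Definition countably_generated (d' : measure_display) (S : measurableType d') :=
  exists2 G : set (set S), countable G & @measurable d' S = <<s G >>.

(* [p^0] is the identity kernel and [p^(n+1)(x, A) = \int p^n(y, A) p(x, dy)].
   The type only records that this is a sub-probability kernel, the class for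
   which the library proves closure under composition. *)
Fixpoint nstep (p : R.-pker T ~> T) (n : nat) : R.-spker T ~> T :=
  if n is m.+1 then mkcomp_noparam p (nstep p m) else kdirac (@measurable_id _ T setT).

(* The time-homogeneous Markov property with respect to the natural
   filtration; the initial distribution is arbitrary. *)
Definition markov_chain (dW : measure_display) (W : measurableType dW)
    (Pr : probability W R) (xi : nat -> {RV Pr >-> T}) (p : R.-pker T ~> T) :=
  forall (n : nat) (E : set W) (B : set T),
    <<s \bigcup_(i in `I_n.+1) preimage_set_system setT (xi i) measurable >> E ->
    measurable B ->
    Pr (E `&` xi n.+1 @^-1` B) = (\int[Pr]_(w in E) p (xi n w) B)%E.

Variables (p : R.-pker T ~> T) (mu : probability T R).

Definition invariant_probability :=
  forall A, measurable A -> (\int[mu]_x p x A)%E = mu A.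

Definition irreducible_chain := forall (x : T) (A : set T), measurable A ->
  (0 < mu A)%E -> exists n : nat, (0 < nstep p n.+1 x A)%E.

(* The expected number of visits to any [mu]-positive set is infinite. Here
   [mu] serves as maximal irreducibility measure, as it is invariant. *)
Definition recurrent_chain := forall (x : T) (A : set T), measurable A ->
  (0 < mu A)%E -> (\sum_(0 <= n <oo) nstep p n.+1 x A)%E = +oo%E.

Definition proper_set (A : set T) :=
  [/\ measurable A, (0 < mu A)%E & (mu A < 1)%E].

Definition kset (n : nat) (A : set T) : R :=
  (fine (mu A) * fine (mu (~` A)))^-1 *
  fine (\int[mu]_(x in A) nstep p n x (~` A)).

Definition kconst (n : nat) : R := inf [set kset n A | A in proper_set].

End chain.

Arguments countably_generated {d'} S.

(* The law of an i.i.d. pair [(X, Y)] is [m \x m], with [m] the law of [X]. *)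
Definition kappa (R : realType) : R :=
  let law := probability (measurableTypeR R) R in
  inf [set sup [set
         (fine 'E_(m \x m)%E[(fun z : R * R =>
            `|(z.1 + c) ^+ 2 - (z.2 + c) ^+ 2|)]) ^+ 2 /
         fine 'E_m[(fun x : R => (x + c) ^+ 2)] | c in [set: R]]
      | m in [set m : law | 'V_m[(fun x : R => x)] = 1%E]].

Section L2.
Context {R : realType} {d : measure_display} {T : measurableType d}.
Implicit Types (f g : T -> R[i]) (A : (T -> R[i]) -> T -> R[i]).

Definition cintegral (m : {measure set T -> \bar R}) f : R[i] :=
  Complex (\int[m]_x complex.Re (f x)) (\int[m]_x complex.Im (f x)).

Variable mu : probability T R.

(* Complex [L^2(mu)] is handled through representatives: a vector is a
   function in [L2], equality of vectors is almost everywhere equality, and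
   linear identities are required almost everywhere. *)
Definition L2 : set (T -> R[i]) := [set f |
  (fun x => complex.Re (f x)) \in Lfun mu 2%:E /\
  (fun x => complex.Im (f x)) \in Lfun mu 2%:E].

Definition L2norm f : R :=
  fine (Lnorm mu 2%:E (fun x => (ComplexField.Normc.normc (f x))%:E)).

Definition L2zero : set (T -> R[i]) := [set f | L2 f /\ cintegral mu f = 0].

(* Compatibility with almost everywhere equality is a consequence of linearity
   and boundedness. *)
Definition bounded_operator A :=
  [/\ forall f, L2 f -> L2 (A f),
      forall (a : R[i]) f g, L2 f -> L2 g ->
        A (fun x => a * f x + g x) = (fun x => a * A f x + A g x) %[ae mu] &
      exists M : R, forall f, L2 f -> L2norm (A f) <= M * L2norm f].

Definition resolvent_set A : set R[i] := [set z |
  exists2 S, bounded_operator S & forall f, L2 f ->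
    S (fun x => z * f x - A f x) = f %[ae mu] /\
    (fun x => z * S f x - A (S f) x) = f %[ae mu]].

Definition spectrum A : set R[i] := ~` resolvent_set A.

Definition markov_op (p : R.-pker T ~> T) f : T -> R[i] :=
  fun x => cintegral (p x) f.

Definition mean_op f : T -> R[i] := fun=> cintegral mu f.

Definition spectral_radius0 (p : R.-pker T ~> T) : R :=
  limn (fun n => sup [set L2norm (iter n (markov_op p) f) `^ n%:R^-1
                     | f in [set f | L2zero f /\ L2norm f = 1]]).

Definition L2_spectral_gap (p : R.-pker T ~> T) := spectral_radius0 p < 1.

End L2.

Section threshold.
Context {R : realType} {d : measure_display} {T : measurableType d}.

Definition rate (e : R) : R := 1 - kappa R / 16 * e ^+ 2.

Definition horizon (e : R) : nat :=
  (Num.truncn (2 * pi / acos (rate e))).+1.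

Variables (p : R.-pker T ~> T) (mu : probability T R).

Definition Mset : set R := [set e | 0 < e /\
  forall n : nat, (1 <= n)%N -> (n <= horizon e)%N -> e < kconst p mu n].

Definition r0 : R := inf [set rate e `^ (horizon e)%:R^-1 | e in Mset].

End threshold.

(* Main.v *)
Require Import Defs.
From HB Require Import structures.
From mathcomp Require Import all_boot all_order all_algebra.
From mathcomp Require Import complex.
From mathcomp Require Import ring lra.
From mathcomp Require Import all_classical all_reals all_analysis.
From mathcomp Require Import measurable_realfun separable cyclic cyclotomic.
Set Implicit Arguments.
Unset Strict Implicit.
Unset Printing Implicit Defensive.
Import Order.TTheory GRing.Theory Num.Theory.
Import numFieldNormedType.Exports.
Local Open Scope classical_set_scope.
Local Open Scope ring_scope.

(* By the coarea formula, the Lawler-Sokal argument and AM-GM turn the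
   isoperimetric constant k_n into Re <P^n f, f> <= (1 - kappa k_n^2 / 8) |f|^2
   for mean-zero f. Let e be in M, N the horizon and q = 1 - kappa e^2 / 16 the
   rate. If |z| = r with r^N >= q, Dirichlet's approximation theorem gives
   n <= N with Re z^n >= q^2, which is out of reach of the form of P^n, so
   P^n - z^n and hence P - z is bounded below on mean-zero functions, uniformly
   on the circle |z| = r. Applying this lower bound to the sums
   \sum_(i < m) z^-i P^i f over the m-th roots of unity times r and averaging
   with Parseval's identity bounds \sum_i r^-2i |P^i f|^2 by a multiple of
   |f|^2. Datko's argument then makes |P^n| r^-n tend to 0 at an explicit rate,
   which is incompatible with r being close to the spectral radius s of P on
   mean-zero functions. So s < q^(1/N), and a Neumann series on |z| > s gives
   the inclusion of spectra. Conversely, if |P^n| decays on mean-zero functions,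
   an indicator of a set with small k_n would be nearly invariant under P^n, so
   the k_n are bounded away from 0. *)

(** The rate carries 16 where the bound on the form carries 8: [kappa * e ^+ 2 / 8] is
    [2 * (1 - q)], so the form of [P^n] stays below [2 * q - 1], while Dirichlet puts [Re z^n] above
    [q ^+ 2], one factor [q] coming from [r^n] and the other from the cosine of [arccos q]. The
    difference [(1 - q) ^+ 2] is positive and depends neither on [z] nor on [n <= N]. The obstacle
    is that [P] need not be normal: a lower bound for [P - z] then gives neither invertibility (an
    isometric shift is bounded below without being onto) nor a norm bound. It is therefore used only
    on circles of radius [r] slightly larger than [s], where [r^-m |P^m|] is already bounded, so
    that a truncated resolvent series is controlled by its two boundary terms. The lower bound has
    the same constant for all [r] in [(s, 2]]; hence [r] can be moved towards [s] after every
    constant has been fixed, and nothing has to be known about the points with [|z| = s]. *)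

Lemma aeqP (R : realType) (d : measure_display) (T : measurableType d) (U : Type)
  (m : {measure set T -> \bar R}) (f g : T -> U) :
  f = g %[ae m] <-> \forall x \ae m, f x = g x.
Proof. by split; apply: filterS => x // /(_ I). Qed.

(** * Real integrals and square-integrable functions *)

Section real_integrals.
Context {R : realType} {d : measure_display} {T : measurableType d}.
Variable m : {measure set T -> \bar R}.
Implicit Types u v : T -> R.

Definition rint u := m.-integrable setT (EFin \o u).

Lemma rint_meas u : rint u -> measurable_fun setT u.
Proof. by move=> /integrableP[/measurable_EFinP]. Qed.

Lemma rintD u v : rint u -> rint v -> rint (fun x => u x + v x).
Proof. by move=> hu hv; exact: (integrableD _ hu hv). Qed.

Lemma rintZ (a : R) u : rint u -> rint (fun x => a * u x).
Proof. by move=> hu; exact: (integrableZl measurableT a hu). Qed.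

Lemma rintB u v : rint u -> rint v -> rint (fun x => u x - v x).
Proof. by move=> hu hv; exact: (integrableB _ hu hv). Qed.

Lemma rint_le u v : measurable_fun setT u -> (forall x, `|u x| <= v x) ->
  rint v -> rint u.
Proof.
move=> mu uv iv; apply: (le_integrable measurableT _ _ iv).
  exact/measurable_EFinP.
by move=> x _; rewrite /= lee_fin (le_trans (uv x))// ler_norm.
Qed.

Lemma rint_norm u : rint u -> rint (fun x => `|u x|).
Proof. by move=> hu; exact: (integrable_abse hu). Qed.

Lemma Rint_EFin u : rint u -> (\int[m]_x (u x)%:E)%E = (\int[m]_x u x)%:E.
Proof. by move=> hu; rewrite /Rintegral fineK//; exact: integrable_fin_num. Qed.

Lemma RintD u v : rint u -> rint v ->
  \int[m]_x (u x + v x) = \int[m]_x u x + \int[m]_x v x.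
Proof. exact: RintegralD. Qed.

Lemma RintB u v : rint u -> rint v ->
  \int[m]_x (u x - v x) = \int[m]_x u x - \int[m]_x v x.
Proof. exact: RintegralB. Qed.

Lemma RintZ (a : R) u : rint u -> \int[m]_x (a * u x) = a * \int[m]_x u x.
Proof. exact: RintegralZl. Qed.

Lemma Rint_ge0 u : (forall x, 0 <= u x) -> 0 <= \int[m]_x u x.
Proof. by move=> u0; apply: Rintegral_ge0. Qed.

Lemma Rint_le u v : rint u -> rint v -> (forall x, u x <= v x) ->
  \int[m]_x u x <= \int[m]_x v x.
Proof. by move=> hu hv uv; apply: le_Rintegral. Qed.

Lemma ae_Rint u v : measurable_fun setT u -> measurable_fun setT v ->
  (\forall x \ae m, u x = v x) -> \int[m]_x u x = \int[m]_x v x.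
Proof.
move=> mu mv uv; congr fine; apply: ae_eq_integral => //.
- exact/measurable_EFinP.
- exact/measurable_EFinP.
- by move: uv; apply: filterS => x /= + _ => ->.
Qed.

Lemma ae_rint u v : measurable_fun setT v -> (\forall x \ae m, u x = v x) -> rint u -> rint v.
Proof.
move=> mv uv /integrableP[mu hu]; apply/integrableP; split.
  exact/measurable_EFinP.
rewrite (@ae_eq_integral _ _ _ m setT (fun x => `|(EFin \o u) x|%E)
  (fun x => `|(EFin \o v) x|%E))//.
- by apply: measurableT_comp => //; exact/measurable_EFinP.
- exact: measurableT_comp.
- by move: uv; apply: filterS => x /= + _ => ->.
Qed.

Lemma Rint_eq0 u : measurable_fun setT u -> (forall x, 0 <= u x) -> rint u ->
  \int[m]_x u x = 0 -> \forall x \ae m, u x = 0.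
Proof.
move=> mu u0 iu h.
have mu' : measurable_fun setT (EFin \o u) by exact/measurable_EFinP.
suff : (\int[m]_x `|(EFin \o u) x| = 0)%E.
  by move=> /(ae_eq_integral_abs m measurableT mu'); apply: filterS => x /(_ I) -[].
transitivity (\int[m]_x (u x)%:E)%E; last by rewrite Rint_EFin// h.
by apply: eq_integral => x _ /=; rewrite ger0_norm.
Qed.

(** Square integrability in terms of plain integrals, so that the real powers inside [Lnorm] are met
    only in [rL2P] and [L2normE]. *)
Definition rL2 u := measurable_fun setT u /\ rint (fun x => u x ^+ 2).

Lemma rL2_meas u : rL2 u -> measurable_fun setT u. Proof. by case. Qed.
Lemma rL2_sq u : rL2 u -> rint (fun x => u x ^+ 2). Proof. by case. Qed.

Lemma rL2P u : u \in Lfun m 2%:E <-> rL2 u.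
Proof.
split=> [h|[mu hu]].
  split; last exact: Lfun2_integrable_sqr h.
  by move: h => /sub_Lfun_mfun; rewrite inE.
apply/andP; split; first by rewrite inE.
rewrite inE /= /finite_norm unlock poweR_lty//.
rewrite (_ : (fun x => _) = (fun x => (u x ^+ 2)%:E)); last first.
  by apply/funext => x; rewrite /= powR_mulrn ?normr_ge0// real_normK ?num_real.
exact: integrable_lty.
Qed.

Lemma rL2M u v : rL2 u -> rL2 v -> rint (fun x => u x * v x).
Proof.
move=> hu hv; apply: (@rint_le _ (fun x => u x ^+ 2 + v x ^+ 2)).
- by apply: measurable_funM; [case: hu|case: hv].
- move=> x; rewrite ler_norml; apply/andP; split; nra.
- by apply: rintD; [case: hu|case: hv].
Qed.

Lemma rL2Z a u : rL2 u -> rL2 (fun x => a * u x).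
Proof.
move=> [mu hu]; split; first exact: measurable_funM.
rewrite (_ : (fun x => _) = (fun x => a ^+ 2 * u x ^+ 2)); first exact: rintZ.
by apply/funext => x; ring.
Qed.

Lemma rL2D u v : rL2 u -> rL2 v -> rL2 (fun x => u x + v x).
Proof.
move=> hu hv; split.
  by apply: measurable_funD; [case: hu|case: hv].
rewrite (_ : (fun x => _) = (fun x => u x ^+ 2 + v x ^+ 2 + 2 * (u x * v x))).
  by apply: rintD; [apply: rintD; [case: hu|case: hv]|exact/rintZ/rL2M].
by apply/funext => x; ring.
Qed.

Lemma rL2B u v : rL2 u -> rL2 v -> rL2 (fun x => u x - v x).
Proof.
move=> hu hv.
have := rL2D hu (rL2Z (-1) hv); congr rL2.
by apply/funext => x; rewrite mulN1r.
Qed.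

End real_integrals.

Section finite_real_integrals.
Context {R : realType} {d : measure_display} {T : measurableType d}.
Variable m : {finite_measure set T -> \bar R}.
Implicit Types u v : T -> R.

Lemma rint_cst (a : R) : rint m (fun=> a).
Proof. exact: finite_measure_integrable_cst. Qed.

Lemma rL2_cst (a : R) : rL2 m (fun=> a).
Proof. by split => //; exact: rint_cst. Qed.

Lemma rL2_int u : rL2 m u -> rint m u.
Proof.
move=> hu; apply: (@rint_le _ _ _ _ _ (fun x => 1 + u x ^+ 2)).
- by case: hu.
- by move=> x; rewrite ler_norml; apply/andP; split; nra.
- by apply: rintD; [exact: rint_cst|case: hu].
Qed.

End finite_real_integrals.

(** * Markov kernels with an invariant measure *)

Section coupling.
Context {R : realType} {d : measure_display} {T : measurableType d}.
Variables (mu : probability T R) (k : R.-spker T ~> T).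

Lemma measurable_coupling_map :
  measurable_fun setT (fun z : unit * T * T => (z.1.2, z.2)).
Proof.
apply/measurable_fun_pairP; split => /=; last exact: measurable_snd.
exact: (measurableT_comp (@measurable_snd _ _ unit T) (@measurable_fst _ _ (unit * T)%type T)).
Qed.

(** A measure viewed as a kernel from the one-point space, so that the joint law is a composition of
    kernels and the integration formula for compositions applies to it. *)
Definition coupling_initial : R.-pker unit ~> T :=
  kprobability (measurable_cst (mu : pprobability T R) : measurable_fun [set: unit] _).

Definition coupling_step : R.-sfker (unit * T)%type ~> (T * T)%type :=
  mkcomp (kernel.kernel_snd k : R.-spker (unit * T)%type ~> T)
    (kdirac measurable_coupling_map).

(* The joint law of two consecutive steps of the stationary chain. *)
Definition coupling : {measure set (T * T) -> \bar R} :=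
  mkcomp coupling_initial coupling_step tt.

Lemma ge0_integral_coupling (F : T * T -> \bar R) :
  (forall z, 0 <= F z)%E -> measurable_fun setT F ->
  (\int[coupling]_z F z = \int[mu]_x \int[k x]_y F (x, y))%E.
Proof.
move=> F0 mF; rewrite /coupling (integral_kcomp _ _ _ F0 mF).
apply: eq_integral => x _.
rewrite (integral_kcomp _ _ _ F0 mF).
apply: eq_integral => y _.
by rewrite /= /kdirac integral_dirac//= diracT mul1e.
Qed.

End coupling.

Section invariant_kernel.
Context {R : realType} {d : measure_display} {T : measurableType d}.
Variables (mu : probability T R) (k : R.-spker T ~> T).
Hypothesis k_prob : forall x, k x setT = 1%E.
Hypothesis k_inv : forall A, measurable A -> (\int[mu]_x k x A)%E = mu A.
Implicit Types u v : T -> R.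

(** Set up for any invariant kernel of total mass one: it serves both for [p] and for the n-step
    kernels, whose type records only a mass at most one. *)
Definition kop u (x : T) : R := \int[k x]_y u y.

Lemma integral_invariant (F : T -> \bar R) :
  (forall z, 0 <= F z)%E -> measurable_fun setT F ->
  (\int[mu]_x \int[k x]_y F y = \int[mu]_y F y)%E.
Proof.
move=> F0 mF.
(* The left-hand side is an integral against the law after one step from [mu], and [k_inv]
   identifies this law with [mu]. *)
have := integral_kcomp (coupling_initial mu)
  (kernel.kernel_snd k : R.-spker (unit * T)%type ~> T) tt F0 mF.
rewrite /= => <-; apply: eq_measure_integral => A mA _.
exact: k_inv.
Qed.

(** If [mu A = 0], invariance makes the nonnegative function [k x A] integrate to 0, hence vanish
    almost everywhere. This is what lets [kop] act on functions modulo null sets. *)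
Lemma ae_invariant (P : T -> Prop) : (\forall y \ae mu, P y) ->
  \forall x \ae mu, \forall y \ae k x, P y.
Proof.
case=> A [mA A0 PA].
have mk : measurable_fun setT (k ^~ A) by exact: measurable_kernel.
suff : (\int[mu]_x `|k x A| = 0)%E.
  move=> /(ae_eq_integral_abs mu measurableT mk).
  by apply: filterS => x /(_ I) kA; exists A; split.
rewrite -A0 -k_inv//.
by apply: eq_integral => x _; rewrite gee0_abs.
Qed.

Lemma measurable_kop u : measurable_fun setT u -> measurable_fun setT (kop u).
Proof.
move=> mu_; have mu' : measurable_fun setT (EFin \o u) by exact/measurable_EFinP.
apply: (measurableT_comp (@fine_measurable R _ measurableT)).
rewrite (_ : (fun x => _) = (fun x => \int[k x]_y (EFin \o u)^\+ y -
   \int[k x]_y (EFin \o u)^\- y)%E); last first.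
  by apply/funext => x; rewrite integralE.
apply: emeasurable_funB.
- apply: measurable_fun_integral_kernel => //.
  + by move=> U mU; exact: measurable_kernel.
  + exact: measurable_funepos.
- apply: measurable_fun_integral_kernel => //.
  + by move=> U mU; exact: measurable_kernel.
  + exact: measurable_funeneg.
Qed.

Lemma ae_rint_kernel u : rint mu u -> \forall x \ae mu, rint (k x) u.
Proof.
move=> hu; have mu_ := rint_meas hu.
have mabs : measurable_fun setT (fun y => `|(u y)%:E|%E).
  by apply: measurableT_comp => //; exact/measurable_EFinP.
have : mu.-integrable setT (fun x => \int[k x]_y `|(u y)%:E|)%E.
  apply/integrableP; split.
    apply: measurable_fun_integral_kernel => //.
    by move=> U mU; exact: measurable_kernel.
  under eq_integral => x _ do rewrite gee0_abs ?integral_ge0//.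
  by rewrite integral_invariant//; case/integrableP: hu.
move=> /(integrable_ae measurableT); apply: filterS => x /(_ I) fx.
apply/integrableP; split; first exact/measurable_EFinP.
by rewrite /= -ge0_fin_numE ?integral_ge0.
Qed.

Lemma kop_ge0 u : (forall x, 0 <= u x) -> forall x, 0 <= kop u x.
Proof. by move=> u0 x; exact: Rint_ge0. Qed.

Lemma kopD u v : rint mu u -> rint mu v ->
  \forall x \ae mu, kop (fun y => u y + v y) x = kop u x + kop v x.
Proof.
by move=> /ae_rint_kernel hu /ae_rint_kernel; apply: filterS2 hu => x; exact: RintD.
Qed.

Lemma kopB u v : rint mu u -> rint mu v ->
  \forall x \ae mu, kop (fun y => u y - v y) x = kop u x - kop v x.
Proof.
by move=> /ae_rint_kernel hu /ae_rint_kernel; apply: filterS2 hu => x; exact: RintB.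
Qed.

Lemma kopZ a u : rint mu u ->
  \forall x \ae mu, kop (fun y => a * u y) x = a * kop u x.
Proof. by move=> /ae_rint_kernel; apply: filterS => x; exact: RintZ. Qed.

Lemma rint_kernel_cst a x : rint (k x) (fun=> a).
Proof.
apply/integrableP; split; first exact/measurable_EFinP.
have := integral_cst (k x) measurableT `|a|%:E.
by rewrite k_prob mule1 /= => ->; rewrite ltry.
Qed.

Lemma kop_cst a x : kop (fun=> a) x = a.
Proof. by rewrite /kop Rintegral_cst// k_prob /= mulr1. Qed.

Lemma kop_ae u v : measurable_fun setT u -> measurable_fun setT v ->
  (\forall x \ae mu, u x = v x) -> \forall x \ae mu, kop u x = kop v x.
Proof.
move=> mu_ mv_ /ae_invariant; apply: filterS => x; exact: ae_Rint.
Qed.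

Lemma ge0_integral_kop u : (forall x, 0 <= u x) -> rint mu u ->
  (\int[mu]_x (kop u x)%:E = \int[mu]_x (u x)%:E)%E.
Proof.
move=> u0 hu; have mu_ := rint_meas hu.
rewrite -[RHS]integral_invariant; last 2 first.
- by move=> x; rewrite lee_fin.
- exact/measurable_EFinP.
apply: ae_eq_integral => //.
- exact/measurable_EFinP/measurable_kop.
- apply: measurable_fun_integral_kernel => //.
  + by move=> U mU; exact: measurable_kernel.
  + exact/measurable_EFinP.
- by have := ae_rint_kernel hu; apply: filterS => x hx _; rewrite Rint_EFin.
Qed.

Lemma ge0_rint_kop u : (forall x, 0 <= u x) -> rint mu u -> rint mu (kop u).
Proof.
move=> u0 hu; apply/integrableP; split.
  by apply/measurable_EFinP; exact: measurable_kop (rint_meas hu).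
under eq_integral => x _ do rewrite gee0_abs ?lee_fin ?kop_ge0//.
by rewrite ge0_integral_kop//; exact: integrable_lty.
Qed.

(** Tonelli-type identities hold first for nonnegative functions; this decomposition carries them
    over to signed ones. It holds only almost everywhere because [u] may fail to be [k x]-integrable
    for a null set of [x]. *)
Lemma kop_posneg u : rint mu u ->
  [/\ rint mu u^\+, rint mu u^\- &
   \forall x \ae mu, kop u x = kop u^\+ x - kop u^\- x].
Proof.
move=> hu; have mu_ := rint_meas hu.
have h0 : rint mu u^\+.
  apply: (rint_le _ _ (rint_norm hu)); first exact: measurable_funrpos.
  by move=> x; rewrite ger0_norm ?funrpos_ge0// /funrpos ge_max ler_norm normr_ge0.
have h1 : rint mu u^\-.
  apply: (rint_le _ _ (rint_norm hu)); first exact: measurable_funrneg.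
  move=> x; rewrite ger0_norm ?funrneg_ge0// /funrneg ge_max normr_ge0 andbT.
  by rewrite -normrN ler_norm.
split => //.
have := kopB h0 h1; apply: filterS => x <-.
by rewrite -[in LHS](funrposBneg u).
Qed.

Lemma rint_kop u : rint mu u -> rint mu (kop u).
Proof.
move=> hu; have [h0 h1 h] := kop_posneg hu.
have {}h : \forall x \ae mu, kop u^\+ x - kop u^\- x = kop u x.
  by move: h; apply: filterS.
apply: (ae_rint _ h); first exact: measurable_kop (rint_meas hu).
by apply: rintB; apply: ge0_rint_kop.
Qed.

Lemma Rint_kop u : rint mu u -> \int[mu]_x kop u x = \int[mu]_x u x.
Proof.
move=> hu; have [h0 h1 h] := kop_posneg hu.
rewrite (ae_Rint _ _ h); last 2 first.
- exact: measurable_kop (rint_meas hu).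
- by apply: measurable_funB; apply/measurable_kop; [exact: rint_meas h0|exact: rint_meas h1].
rewrite RintB; [|exact: ge0_rint_kop..].
rewrite {1 2}/Rintegral !ge0_integral_kop//.
by rewrite -/(Rintegral _ _ _) -/(Rintegral _ _ _) -RintB// -[in RHS](funrposBneg u).
Qed.

Lemma kop_sq u : rL2 mu u ->
  \forall x \ae mu, kop u x ^+ 2 <= kop (fun y => u y ^+ 2) x.
Proof.
move=> hu; have := ae_rint_kernel (rL2_sq hu); have := ae_rint_kernel (rL2_int hu).
apply: filterS2 => x h1 h2.
(* Jensen's inequality, as positivity of the variance of [u] under [k x]. *)
have : 0 <= \int[k x]_y (u y - kop u x) ^+ 2 by apply: Rint_ge0 => y; exact: sqr_ge0.
rewrite (_ : (fun y => _) = (fun y => u y ^+ 2 - 2 * kop u x * u y + kop u x ^+ 2)).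
  have j1 := rintZ (2 * kop u x) h1.
  have j2 : rint (k x) (fun=> kop u x ^+ 2) by exact: rint_kernel_cst.
  rewrite RintD//; last exact: rintB.
  rewrite RintB// RintZ//.
  rewrite Rintegral_cst// k_prob /= -/(kop u x) -/(kop (fun y => u y ^+ 2) x).
  by rewrite mulr1; lra.
by apply/funext => y; ring.
Qed.

Lemma rL2_kop u : rL2 mu u -> rL2 mu (kop u).
Proof.
move=> hu; have mk := measurable_kop (rL2_meas hu).
split=> //; have h := rint_kop (rL2_sq hu).
apply/integrableP; split; first exact/measurable_EFinP/measurable_funX.
apply: (le_lt_trans _ (integrable_lty measurableT h)).
apply: ae_ge0_le_integral => //.
- by apply: measurableT_comp => //; exact/measurable_EFinP/measurable_funX.
- by move=> x _; rewrite lee_fin kop_ge0// => y; exact: sqr_ge0.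
- by apply/measurable_EFinP; exact: rint_meas h.
- have := kop_sq hu; apply: filterS => x hx _.
  by rewrite /= lee_fin ger0_norm// sqr_ge0.
Qed.

Lemma le_Rint_ae u v : rint mu u -> rint mu v ->
  (\forall x \ae mu, u x <= v x) -> \int[mu]_x u x <= \int[mu]_x v x.
Proof.
move=> hu hv uv.
(* Replacing [v] by [max u v], which agrees with it almost everywhere, makes the inequality
   pointwise. *)
have h : rint mu (fun x => Num.max (u x) (v x)).
  apply: (rint_le _ _ (rintD (rint_norm hu) (rint_norm hv))).
    exact: measurable_maxr (rint_meas hu) (rint_meas hv).
  move=> x; case: (leP (u x) (v x)) => _; first by rewrite lerDr.
  by rewrite lerDl.
rewrite (_ : \int[mu]_x v x = \int[mu]_x Num.max (u x) (v x)).
  by apply: Rint_le => // x; rewrite le_max lexx.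
apply: ae_Rint; [exact: rint_meas hv|exact: rint_meas h|].
by move: uv; apply: filterS => x /max_idPr.
Qed.

Lemma kop_contraction u : rL2 mu u ->
  \int[mu]_x kop u x ^+ 2 <= \int[mu]_x u x ^+ 2.
Proof.
move=> hu; rewrite -(Rint_kop (rL2_sq hu)); apply: le_Rint_ae.
- exact: rL2_sq (rL2_kop hu).
- exact: rint_kop (rL2_sq hu).
- exact: kop_sq.
Qed.

(** For [s = -1] this is twice the Dirichlet form, for [s = 1] its companion with a plus sign;
    [gap_mean_law_le] balances the two against each other. *)
Lemma coupling_sq (s : R) u : rL2 mu u ->
  (\int[coupling mu k]_z ((u z.1 + s * u z.2) ^+ 2)%:E =
   ((1 + s ^+ 2) * \int[mu]_x u x ^+ 2 + 2 * s * \int[mu]_x (u x * kop u x))%:E)%E.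
Proof.
move=> hu; have mu_ := rL2_meas hu.
have mF : measurable_fun setT (fun z : T * T => (u z.1 + s * u z.2) ^+ 2).
  apply: measurable_funX; apply: measurable_funD.
    exact: measurableT_comp.
  by apply: measurable_funM => //; exact: measurableT_comp.
rewrite ge0_integral_coupling; last 2 first.
- by move=> z; rewrite lee_fin sqr_ge0.
- exact/measurable_EFinP.
(* [G x] is the inner integral over [y], computed wherever [u] and its square are
   [k x]-integrable. *)
pose G x := u x ^+ 2 + 2 * s * (u x * kop u x) + s ^+ 2 * kop (fun y => u y ^+ 2) x.
have i1 := rL2_sq hu.
have i2 := rintZ (2 * s) (rL2M hu (rL2_kop hu)).
have i3 := rintZ (s ^+ 2) (rint_kop (rL2_sq hu)).
have iG : rint mu G by apply: rintD => //; exact: rintD.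
transitivity (\int[mu]_x (G x)%:E)%E; last first.
  rewrite Rint_EFin// /G RintD//; last exact: rintD.
  rewrite RintD// !RintZ//; last 2 first.
  - exact: rint_kop (rL2_sq hu).
  - exact: rL2M (rL2_kop hu).
  by rewrite Rint_kop//; congr EFin; ring.
apply: ae_eq_integral => //.
- apply: (@measurable_fun_integral_sfinite_kernel _ _ _ _ _
    (fun z : T * T => ((u z.1 + s * u z.2) ^+ 2)%:E) k).
  + by move=> z; rewrite lee_fin sqr_ge0.
  + exact/measurable_EFinP.
- by apply/measurable_EFinP; exact: rint_meas iG.
have := ae_rint_kernel (rL2_sq hu); have := ae_rint_kernel (rL2_int hu).
apply: filterS2 => x h1 h2 _.
have j1 : rint (k x) (fun y => u x ^+ 2) by exact: rint_kernel_cst.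
have j2 := rintZ (2 * s * u x) h1.
have j3 := rintZ (s ^+ 2) h2.
transitivity (\int[k x]_y (u x ^+ 2 + 2 * s * u x * u y + s ^+ 2 * u y ^+ 2)%:E)%E.
  by apply: eq_integral => y _ /=; congr EFin; ring.
rewrite Rint_EFin; last by apply: rintD => //; exact: rintD.
rewrite RintD//; last exact: rintD.
rewrite RintD// (RintZ _ h1) (RintZ _ h2) Rintegral_cst// k_prob /= mulr1 /G /kop.
by congr EFin; ring.
Qed.

End invariant_kernel.

(** * The Lawler-Sokal inequality *)

Section coarea.
Context {R : realType} {d : measure_display} {S : measurableType d}.
Implicit Types (M : probability (S * S)%type R) (h : S -> R).

Definition lvl_separated h (t : R) : set (S * S) :=
  [set z | (t < h z.1) != (t < h z.2)].

Lemma lvl_separatedE h t : lvl_separated h t =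
  ([set x | t < h x] `*` ~` [set x | t < h x]) `|`
  (~` [set x | t < h x] `*` [set x | t < h x]).
Proof.
apply/seteqP; split => -[x y]; rewrite /lvl_separated /=.
  case: (t < h x); case: (t < h y) => //= _; [left|right]; split => //; exact/negP.
by case=> -[]; case: (t < h x); case: (t < h y).
Qed.

Lemma measurable_lvl_separated h : measurable_fun setT h ->
  measurable [set w : S * S * R | (w.2 < h w.1.1) != (w.2 < h w.1.2)].
Proof.
move=> mh.
have m1 : measurable_fun setT (fun w : S * S * R => w.2 < h w.1.1).
  apply: measurable_fun_ltr; first exact: measurable_snd.
  apply: (measurableT_comp mh); apply: (measurableT_comp measurable_fst).
  exact: measurable_fst.
have m2 : measurable_fun setT (fun w : S * S * R => w.2 < h w.1.2).
  apply: measurable_fun_ltr; first exact: measurable_snd.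
  apply: (measurableT_comp mh); apply: (measurableT_comp measurable_snd).
  exact: measurable_fst.
have M1 := m1 measurableT [set true] I; rewrite setTI in M1.
have M2 := m2 measurableT [set true] I; rewrite setTI in M2.
have := measurableU _ _ (measurableD M1 M2) (measurableD M2 M1).
congr measurable; apply/seteqP; split => w /=.
  by case=> -[]; case: (w.2 < h w.1.1); case: (w.2 < h w.1.2).
by case: (w.2 < h w.1.1); case: (w.2 < h w.1.2) => // _; [left|right]; split.
Qed.

Lemma measurable_fun_lvl_separated M h : measurable_fun setT h ->
  measurable_fun setT (fun t => M (lvl_separated h t)).
Proof.
move=> /measurable_lvl_separated mC.
have := measurable_fun_ysection M mC; congr measurable_fun.
by apply/funext => t; congr (M _); apply/seteqP; split => z; rewrite ysectionE.
Qed.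

(* [`|a - b|] is the length of the set of levels separating [a] from [b]. *)
Lemma coarea M h : measurable_fun setT h ->
  (\int[M]_z (`|h z.1 - h z.2|)%:E =
   \int[lebesgue_measure]_t M (lvl_separated h t))%E.
Proof.
move=> mh; have mC := measurable_lvl_separated mh.
have := @indic_fubini_tonelli _ _ _ _ _ M (@lebesgue_measure R) _ mC.
rewrite indic_fubini_tonelli_FE// indic_fubini_tonelli_GE//= => e.
transitivity (\int[M]_x (@lebesgue_measure R
  (xsection [set w : S * S * R | (w.2 < h w.1.1)%R != (w.2 < h w.1.2)%R] x)))%E.
  apply: eq_integral => z _; set X := xsection _ z.
  have XE t : X t <-> (t < h z.1) != (t < h z.2) by rewrite /X xsectionE.
  have [ab|ab] := leP (h z.1) (h z.2).
    have -> : X = `[h z.1, h z.2[%classic.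
      apply/seteqP; split => t; rewrite XE /= in_itv /=.
        by case: (ltP t (h z.1)) => h1; case: (ltP t (h z.2)) => h2 //= _; exfalso; move: ab h1 h2; clear; lra.
      by case/andP=> h1 h2; rewrite h2 ltNge h1.
    rewrite lebesgue_measure_itv /= lte_fin distrC ger0_norm ?subr_ge0// EFinB.
    case: ltP => // ba; rewrite (_ : h z.1 = h z.2) ?subee//.
    by apply/eqP; rewrite eq_le ab.
  have -> : X = `[h z.2, h z.1[%classic.
    apply/seteqP; split => t; rewrite XE /= in_itv /=.
      by case: (ltP t (h z.1)) => h1; case: (ltP t (h z.2)) => h2 //= _; exfalso; move: ab h1 h2; clear; lra.
    by case/andP=> h1 h2; rewrite h2 ltNge h1.
  by rewrite lebesgue_measure_itv /= lte_fin ab gtr0_norm ?subr_gt0// EFinB.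
rewrite e; apply: eq_integral => t _ /=; congr (M _).
by apply/seteqP; split => z; rewrite ysectionE.
Qed.

End coarea.

Section lawler_sokal.
Context {R : realType} {d : measure_display} {T : measurableType d}.
Variables (mu : probability T R) (k : R.-spker T ~> T).
Hypothesis k_prob : forall x, k x setT = 1%E.
Hypothesis k_inv : forall A, measurable A -> (\int[mu]_x k x A)%E = mu A.

Lemma coupling_setX (A B : set T) : measurable A -> measurable B ->
  (coupling mu k (A `*` B) = \int[mu]_(x in A) k x B)%E.
Proof.
move=> mA mB.
have mAB : measurable (A `*` B) by exact: measurableX.
have -> : coupling mu k (A `*` B) =
    (\int[coupling mu k]_z (\1_(A `*` B) z)%:E)%E.
  by rewrite integral_indic// setIT.
rewrite ge0_integral_coupling//; last exact/measurable_EFinP.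
rewrite [RHS]integral_mkcond; apply: eq_integral => x _.
rewrite patchE; have [xA|xA] := boolP (x \in A).
  rewrite -[in RHS](setIT B) -integral_indic//; apply: eq_integral => y _.
  by rewrite !indicE in_setX xA.
rewrite integral0_eq// => y _.
by rewrite indicE in_setX (negbTE xA).
Qed.

Lemma coupling_setT : coupling mu k setT = 1%E.
Proof.
rewrite -setXTT coupling_setX//.
rewrite (eq_integral (cst 1%E)); last by move=> x _; rewrite k_prob.
by rewrite integral_cst// mul1e; exact: probability_setT.
Qed.

(** Packaged as a probability so that [coarea] applies to a step of the chain as well as to a
    product law. *)
Definition coupling_probability : probability (T * T)%type R :=
  let M := coupling mu k in
  HB.pack_for (probability (T * T)%type R) (Measure.sort M)
    (Measure.class M) (Measure_isProbability.Build _ _ _ M coupling_setT).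

Variable kc : R.
Hypothesis kc_ge0 : 0 <= kc.
Hypothesis kc_le : forall A, measurable A ->
  kc * (fine (mu A) * fine (mu (~` A))) <= fine (\int[mu]_(x in A) k x (~` A)).

(** By [coarea] both sides are integrals over the levels [t]. At a fixed level the separated pairs
    form two rectangles, and the flow hypothesis, for the level set and for its complement, compares
    their masses under the chain with those under independent sampling. *)
Lemma isoperimetry_functional (u : T -> R) (g : R -> R) (m : probability (measurableTypeR R) R) :
  measurable_fun setT u -> (forall A, measurable A -> m A = mu (u @^-1` A)) ->
  measurable_fun setT g ->
  (kc%:E * \int[m \x m]_z (`|g z.1 - g z.2|)%:E <=
   \int[coupling mu k]_z (`|g (u z.1) - g (u z.2)|)%:E)%E.
Proof.
move=> mu_ mE mg.
have mgu : measurable_fun setT (g \o u) by exact: measurableT_comp.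
have -> : (\int[coupling mu k]_z (`|g (u z.1) - g (u z.2)|)%:E =
    \int[lebesgue_measure]_t coupling mu k (lvl_separated (g \o u) t))%E.
  exact: (coarea coupling_probability mgu).
have -> : (\int[m \x m]_z (`|g z.1 - g z.2|)%:E =
    \int[lebesgue_measure]_t (m \x m) (lvl_separated g t))%E.
  exact: (@coarea _ _ (measurableTypeR R) (m \x m)%E g mg).
have ms := measurable_fun_lvl_separated (m \x m)%E mg.
rewrite -ge0_integralZl//.
apply: ge0_le_integral => //.
- by move=> t _; rewrite mule_ge0 ?lee_fin.
- by apply: measurable_funeM.
- exact: (measurable_fun_lvl_separated coupling_probability mgu).
move=> t _.
pose A := [set x | t < g x]; pose B := u @^-1` A.
have mA : measurable A.
  have := measurable_fun_ltr (measurable_cst t : measurable_fun setT _) mg.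
  by move=> /(_ measurableT [set true] I); rewrite setTI.
have mB : measurable B by rewrite -[B]setTI; exact: mu_.
have mAC := measurableC mA; have mBC := measurableC mB.
have disj (U : Type) (C : set U) : (C `*` ~` C) `&` (~` C `*` C) = set0.
  by apply/seteqP; split => // -[x y] /= [[hx _] []].
have -> : (coupling mu k (lvl_separated (g \o u) t) =
    \int[mu]_(x in B) k x (~` B) + \int[mu]_(x in ~` B) k x B)%E.
  rewrite lvl_separatedE measureU; [|exact: measurableX|exact: measurableX|exact: disj].
  by congr (_ + _)%E; exact: coupling_setX.
have -> : ((m \x m) (lvl_separated g t) = m A * m (~` A) + m (~` A) * m A)%E.
  rewrite lvl_separatedE measureU; [|exact: measurableX|exact: measurableX|exact: disj].
  by congr (_ + _)%E; exact: product_measure1E.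
have fB : m A = (fine (mu B))%:E by rewrite mE// fineK//; exact: fin_num_measure.
have fBC : m (~` A) = (fine (mu (~` B)))%:E.
  by rewrite mE// preimage_setC fineK//; exact: fin_num_measure.
rewrite !fB !fBC.
have fI C : measurable C -> (\int[mu]_(x in C) k x (~` C) =
    (fine (\int[mu]_(x in C) k x (~` C)))%:E)%E.
  move=> mC; rewrite fineK// ge0_fin_numE ?integral_ge0//.
  rewrite -coupling_setX//; last exact: measurableC.
  have : (coupling mu k (C `*` ~` C) <= 1)%E.
    by rewrite -coupling_setT le_measure ?inE//; apply: measurableX => //; exact: measurableC.
  by move=> /le_lt_trans; apply; rewrite ltry.
have := kc_le mBC; rewrite setCK => h2; have h1 := kc_le mB.
rewrite (fI _ mB).
have := fI _ mBC; rewrite setCK => ->.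
rewrite -!(EFinM, EFinD) lee_fin mulrDr.
by apply: lerD; rewrite // [fine (mu (~` B)) * _]mulrC // mulrC.
Qed.

End lawler_sokal.

(** * Bounds on the ratio behind [kappa], for a single law *)

Section law_ratio.
Context {R : realType}.
Variable m : probability (measurableTypeR R) R.
Implicit Types (f : R -> R) (c : R).

Definition gap_mean c : R :=
  fine 'E_(m \x m)%E[(fun z : R * R => `|(z.1 + c) ^+ 2 - (z.2 + c) ^+ 2|)].
Definition second_moment c : R := fine 'E_m[(fun x : R => (x + c) ^+ 2)].
Definition gap_ratio c : R := gap_mean c ^+ 2 / second_moment c.

Lemma gap_meanE c :
  gap_mean c = \int[(m \x m)%E]_z `|(z.1 + c) ^+ 2 - (z.2 + c) ^+ 2|.
Proof. by rewrite /gap_mean unlock. Qed.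

Lemma second_momentE c : second_moment c = \int[m]_x (x + c) ^+ 2.
Proof. by rewrite /second_moment unlock. Qed.

Lemma integral_product_fst f : measurable_fun setT f -> (forall x, 0 <= f x) ->
  (\int[m \x m]_z (f z.1)%:E = \int[m]_x (f x)%:E)%E.
Proof.
move=> mf f0; rewrite fubini_tonelli1//; last 2 first.
- by apply/measurable_EFinP; exact: measurableT_comp.
- by move=> z; rewrite lee_fin.
apply: eq_integral => x _; rewrite /fubini_F /=.
have := integral_cst m measurableT (f x)%:E; rewrite /= => ->.
by rewrite [X in (_ * X)%E](_ : _ = 1%E) ?mule1//; exact: probability_setT.
Qed.

Lemma integral_product_snd f : measurable_fun setT f -> (forall x, 0 <= f x) ->
  (\int[m \x m]_z (f z.2)%:E = \int[m]_x (f x)%:E)%E.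
Proof.
move=> mf f0; rewrite fubini_tonelli1//; last 2 first.
- by apply/measurable_EFinP; exact: measurableT_comp.
- by move=> z; rewrite lee_fin.
rewrite /fubini_F /=.
have := integral_cst m measurableT (\int[m]_x (f x)%:E)%E; rewrite /= => ->.
by rewrite [X in (_ * X)%E](_ : _ = 1%E) ?mule1//; exact: probability_setT.
Qed.

Lemma rint_product_fst f : (forall x, 0 <= f x) -> rint m f ->
  rint (m \x m)%E (fun z : R * R => f z.1).
Proof.
move=> f0 hf; have mf := rint_meas hf; apply/integrableP; split.
  by apply/measurable_EFinP; exact: measurableT_comp.
under eq_integral => z _ do rewrite /= ger0_norm//.
by rewrite integral_product_fst//; exact: integrable_lty.
Qed.

Lemma rint_product_snd f : (forall x, 0 <= f x) -> rint m f ->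
  rint (m \x m)%E (fun z : R * R => f z.2).
Proof.
move=> f0 hf; have mf := rint_meas hf; apply/integrableP; split.
  by apply/measurable_EFinP; exact: measurableT_comp.
under eq_integral => z _ do rewrite /= ger0_norm//.
by rewrite integral_product_snd//; exact: integrable_lty.
Qed.

Hypothesis unit_variance : 'V_m[(fun x : R => x)] = 1%E.
Let a := fine 'E_m[(fun x : R => x)].

(** Obtained by unfolding the variance before integrability is known: [a] is the finite part of an
    expectation that might be infinite or meaningless. This integral is what puts [x - a], and then
    [x], in L2 and so makes [a] the true mean. *)
Lemma integral_centered_sq : (\int[m]_x ((x - a) ^+ 2)%:E = 1)%E.
Proof.
rewrite -unit_variance /variance covariance.unlock.
rewrite [X in _ = X](_ : _ = \int[m]_x (((x - a) * (x - a)) : R)%:E)%E; last first.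
  by rewrite /a expectation.unlock.
by apply: eq_integral => x _; rewrite expr2.
Qed.

Lemma rL2_centered : rL2 m (fun x => x - a).
Proof.
have mx : measurable_fun setT (fun x : measurableTypeR R => x - a).
  by apply: measurable_funB => //; exact: measurable_id.
split => //; apply/integrableP; split.
  by apply/measurable_EFinP; exact: measurable_funX.
rewrite (eq_integral (fun x : measurableTypeR R => (((x : R) - a) ^+ 2)%:E)).
  by rewrite integral_centered_sq ltry.
by move=> x _; rewrite /= ger0_norm ?sqr_ge0.
Qed.

Lemma Rint_centered_sq : \int[m]_x (x - a) ^+ 2 = 1.
Proof.
by rewrite /Rintegral integral_centered_sq.
Qed.

Lemma rL2_shift c : rL2 m (fun x => x + c).
Proof.
have := rL2D rL2_centered (rL2_cst m (c + a)); congr rL2.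
by apply/funext => x; ring.
Qed.

Lemma Rint_centered : \int[m]_x (x - a) = 0.
Proof.
have h : rint m (fun x => x).
  by have := rL2_int (rL2_shift 0); congr rint; apply/funext => x; rewrite addr0.
rewrite RintB//; last exact: rint_cst.
rewrite Rintegral_cst// [X in _ - a * fine X](_ : _ = 1%E) /=; last exact: probability_setT.
by rewrite mulr1 /a unlock subrr.
Qed.

Lemma second_moment_shift c : second_moment (c - a) = 1 + c ^+ 2.
Proof.
have h1 := rL2_sq rL2_centered.
have h2 := rintZ (2 * c) (rL2_int rL2_centered).
have h3 := rint_cst m (c ^+ 2).
rewrite second_momentE.
rewrite (_ : (fun x => _) = (fun x => (x - a) ^+ 2 + 2 * c * (x - a) + c ^+ 2)).
  rewrite RintD//; last exact: rintD.
  rewrite RintD// (RintZ _ (rL2_int rL2_centered)) Rint_centered Rint_centered_sq.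
  rewrite Rintegral_cst// [X in _ * fine X](_ : _ = 1%E) /=; last exact: probability_setT.
  by rewrite mulr0 addr0 mulr1.
by apply/funext => x; ring.
Qed.

Lemma second_moment_ge1 c : 1 <= second_moment c.
Proof.
rewrite (_ : c = c + a - a); last by ring.
by rewrite second_moment_shift lerDl sqr_ge0.
Qed.

Lemma measurable_gap c : measurable_fun setT
  (fun z : R * R => `|(z.1 + c) ^+ 2 - (z.2 + c) ^+ 2|).
Proof.
apply: measurableT_comp => //; apply: measurable_funB.
  by apply: measurable_funX; apply: measurable_funD => //; exact: measurable_fst.
by apply: measurable_funX; apply: measurable_funD => //; exact: measurable_snd.
Qed.

(** Weighted AM-GM for [|x - y| * |x + y + 2 c|], the first factor being controlled by the variance
    1 and the second by the second moment. *)
Lemma gap_bound c (s : R) : 0 < s ->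
  rint (m \x m)%E (fun z : R * R => `|(z.1 + c) ^+ 2 - (z.2 + c) ^+ 2|) /\
  gap_mean c <= 2 * s + 2 * second_moment c / s.
Proof.
move=> s0.
pose f x := s * (x - a) ^+ 2 + s^-1 * (x + c) ^+ 2.
have f0 x : 0 <= f x.
  by rewrite addr_ge0// mulr_ge0 ?sqr_ge0// ?invr_ge0 ltW.
have f1 := rintZ s (rL2_sq rL2_centered).
have f2 := rintZ s^-1 (rL2_sq (rL2_shift c)).
have hf : rint m f by exact: rintD.
have fE : \int[m]_x f x = s + second_moment c / s.
  rewrite RintD// (RintZ _ (rL2_sq rL2_centered)) (RintZ _ (rL2_sq (rL2_shift c))).
  by rewrite Rint_centered_sq second_momentE mulr1 [in RHS]mulrC.
have g1 := rint_product_fst f0 hf; have g2 := rint_product_snd f0 hf.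
have le z : `|(z.1 + c) ^+ 2 - (z.2 + c) ^+ 2| <= f z.1 + f z.2.
  case: z => x y /=; rewrite /f.
  have ss : s * s^-1 = 1 by rewrite divff// gt_eqF.
  set t := s^-1 in ss *.
  have t0 : 0 < t by rewrite invr_gt0.
  have key (e : R) : e ^+ 2 = 1 ->
     e * ((x + c) ^+ 2 - (y + c) ^+ 2) <=
     s * (x - a) ^+ 2 + t * (x + c) ^+ 2 + (s * (y - a) ^+ 2 + t * (y + c) ^+ 2).
    move=> ee.
    (* [h1] is the square behind AM-GM; [h2] and [h3] are the squares dropped from the parallelogram
       identities for [x - y] and [x + y + 2 * c]. *)
    have h1 : 0 <= s * (x - y - e * t * (x + y + 2 * c)) ^+ 2.
      by rewrite mulr_ge0 ?sqr_ge0// ltW.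
    have h2 : 0 <= s * (x + y - 2 * a) ^+ 2 by rewrite mulr_ge0 ?sqr_ge0// ltW.
    have h3 : 0 <= t * (x - y) ^+ 2 by rewrite mulr_ge0 ?sqr_ge0// ltW.
    have e1 : s * (x - y - e * t * (x + y + 2 * c)) ^+ 2 =
      s * (x - y) ^+ 2 - 2 * (s * t) * e * ((x + c) ^+ 2 - (y + c) ^+ 2) +
      (s * t) * e ^+ 2 * t * (x + y + 2 * c) ^+ 2 by ring.
    rewrite e1 ee ss in h1.
    lra.
  rewrite ler_norml; apply/andP; split.
    by rewrite lerNl; have := key (-1); rewrite sqrrN expr1n mulN1r; apply.
  by have := key 1; rewrite expr1n mul1r; apply.
have hg : rint (m \x m)%E (fun z : R * R => `|(z.1 + c) ^+ 2 - (z.2 + c) ^+ 2|).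
  apply: (rint_le _ _ (rintD g1 g2)); first exact: measurable_gap.
  by move=> z; rewrite normr_id.
split => //.
rewrite gap_meanE; apply: (le_trans (Rint_le hg (rintD g1 g2) le)).
rewrite RintD// /Rintegral integral_product_fst ?integral_product_snd//; last 2 first.
- exact: rint_meas hf.
- exact: rint_meas hf.
rewrite -/(Rintegral m setT f) fE; lra.
Qed.

Lemma rint_gap c :
  rint (m \x m)%E (fun z : R * R => `|(z.1 + c) ^+ 2 - (z.2 + c) ^+ 2|).
Proof. by have [] := gap_bound c ltr01. Qed.

Lemma gap_mean_ge0 c : 0 <= gap_mean c.
Proof. by rewrite gap_meanE; apply: Rint_ge0. Qed.

(** The balanced choice [s = sqrt Q] in [gap_bound] gives [gap_mean c <= 4 * sqrt Q]. Boundedness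
    matters because the supremum of an unbounded set of reals is 0 by convention. *)
Lemma gap_ratio_le c : gap_ratio c <= 16.
Proof.
have Q1 := second_moment_ge1 c; set Q := second_moment c in Q1 *.
have Q0 : 0 < Q by exact: lt_le_trans ltr01 Q1.
have sQ : 0 < Num.sqrt Q by rewrite sqrtr_gt0.
have [_] := gap_bound c sQ; rewrite -/Q.
rewrite -{2}(sqr_sqrtr (ltW Q0)) expr2 mulrA mulfK ?gt_eqF// => h.
rewrite /gap_ratio -/Q ler_pdivrMr// -[X in _ <= _ * X](sqr_sqrtr (ltW Q0)).
have := gap_mean_ge0 c; nra.
Qed.

(* Averaging over one of the two coordinates (Jensen). *)
Lemma gap_mean_ge c :
  \int[m]_x `|(x + c) ^+ 2 - second_moment c| <= gap_mean c.
Proof.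
have hg := rL2_sq (rL2_shift c).
have hd : rint m (fun x => `|(x + c) ^+ 2 - second_moment c|).
  by apply/rint_norm/rintB => //; exact: rint_cst.
rewrite -lee_fin -Rint_EFin// gap_meanE -Rint_EFin; last exact: rint_gap.
rewrite fubini_tonelli1//; last first.
  by apply/measurable_EFinP; exact: measurable_gap.
apply: ge0_le_integral => //.
- by apply/measurable_EFinP; exact: rint_meas hd.
- apply: measurable_fun_fubini_tonelli_F => //.
  by apply/measurable_EFinP; exact: measurable_gap.
move=> x _; rewrite /fubini_F /=.
have hx : rint m (fun y => (x + c) ^+ 2 - (y + c) ^+ 2).
  by apply: rintB => //; exact: rint_cst.
rewrite Rint_EFin; last exact: rint_norm.
rewrite lee_fin; apply: le_trans (le_normr_Rintegral measurableT hx).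
rewrite RintB//; last exact: rint_cst.
rewrite Rintegral_cst// [X in _ * fine X](_ : _ = 1%E) /=; last exact: probability_setT.
by rewrite mulr1 second_momentE.
Qed.

(* For centered [Y], a unit-variance law with [E|Y| <= 1/4] is handled by the
   shift 0 since [1 - |y| <= |y^2 - 1|], any other law by the shift 8, where the
   linear term of [(y + 8)^2] dominates. *)
Lemma gap_ratio_large : exists c, 4 / 65 <= gap_ratio c.
Proof.
pose b := \int[m]_x `|x - a|.
have hY := rint_norm (rL2_int rL2_centered).
have hYY := rL2_sq rL2_centered.
have h1 := rint_cst m 1.
have c1 : \int[m]_x (1 : R) = 1.
  rewrite Rintegral_cst// [X in _ * fine X](_ : _ = 1%E) /= ?mulr1//.
  exact: probability_setT.
have [b4|b4] := leP b 4^-1.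
  exists (0 - a); rewrite /gap_ratio.
  have Q1 := second_moment_shift 0; rewrite expr0n /= addr0 in Q1.
  have := gap_mean_ge (0 - a); rewrite Q1 divr1 => hE.
  (* The second moment is 1 here, so the ratio is at least [(3 / 4) ^+ 2], well above [4 / 65]. *)
  have : 1 - b <= gap_mean (0 - a).
    apply: le_trans hE; rewrite -[X in X - _]c1 -RintB//; apply: Rint_le.
    - exact: rintB.
    - apply/rint_norm/rintB => //.
      by have := rL2_sq (rL2_shift (0 - a)).
    - move=> x; rewrite sub0r; set y := x - a.
      have u1 := ler_norm (- (y ^+ 2 - 1)); rewrite normrN in u1.
      have u2 := normr_ge0 (y ^+ 2 - 1).
      case: (ger0P y) => y0; [have [?|?] := leP 1 y|have [?|?] := leP y (- 1)]; nra.
  nra.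
exists (8 - a); rewrite /gap_ratio.
have Q1 := second_moment_shift 8.
rewrite Q1; have := gap_mean_ge (8 - a); rewrite Q1 => hE.
(* The shift 8 gives the second moment [1 + 64], and [b > 1 / 4] gives [16 * b - 2 > 2]; hence
   [4 / 65]. *)
suff : 16 * b - 2 <= gap_mean (8 - a).
  move=> h; rewrite (_ : 1 + 8 ^+ 2 = 65); last by ring.
  rewrite ler_pM2r ?invr_gt0//; nra.
apply: le_trans hE.
(* [(y + 8)^2 - 65] is [16 y + (y^2 - 1)], of absolute value at least [16 |y| - (y^2 + 1)]. *)
rewrite (_ : 16 * b - 2 = \int[m]_x (16 * `|x - a| - ((x - a) ^+ 2 + 1))); last first.
  rewrite RintB//; [|exact: rintZ|exact: rintD].
  by rewrite RintZ// RintD// Rint_centered_sq c1; congr (_ - _).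
apply: Rint_le.
- by apply: rintB; [exact: rintZ|exact: rintD].
- by apply/rint_norm/rintB; [exact: rL2_sq (rL2_shift _)|exact: rint_cst].
move=> x; rewrite (_ : x + (8 - a) = (x - a) + 8); last by ring.
set y := x - a.
have := ler_norm ((y + 8) ^+ 2 - (1 + 8 ^+ 2)).
have := ler_norm (- ((y + 8) ^+ 2 - (1 + 8 ^+ 2))); rewrite normrN => u1 u2.
case: (ger0P y) => y0; nra.
Qed.

Lemma has_ubound_gap_ratio : has_ubound [set gap_ratio c | c in [set: R]].
Proof. by exists 16 => _ [c _ <-]; exact: gap_ratio_le. Qed.

Lemma le_sup_gap_ratio : 4 / 65 <= sup [set gap_ratio c | c in [set: R]].
Proof.
have [c hc] := gap_ratio_large; apply: (le_trans hc).
by apply: ub_le_sup; [exact: has_ubound_gap_ratio|exists c].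
Qed.

End law_ratio.

Section kappa.
Context {R : realType}.
Let law := probability (measurableTypeR R) R.

(** A unit-variance law must be at hand because the infimum of the empty set is 0 by convention. *)
Lemma kappa_ge (m : law) : 'V_m[(fun x : R => x)] = 1%E -> 4 / 65 <= kappa R.
Proof.
move=> hm; apply: lb_le_inf.
  by eexists; exists m.
move=> _ [m' hm' <-]; exact: le_sup_gap_ratio.
Qed.

Lemma kappa_le (m : law) (y : R) : 'V_m[(fun x : R => x)] = 1%E -> y < kappa R ->
  exists c, y < gap_ratio m c.
Proof.
move=> hm yk.
have : y < sup [set gap_ratio m c | c in [set: R]].
  apply: (lt_le_trans yk); apply: ge_inf; last by exists m.
  by exists (4 / 65) => _ [m' hm' <-]; exact: le_sup_gap_ratio.
case/sup_gt; first by exists (gap_ratio m 0), 0.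
by move=> _ [c _ <-] yc; exists c.
Qed.

End kappa.

(** The optimal [s] makes the two terms equal and gives [x <= 2 * sqrt (2 * Q * D)]. *)
Lemma sqr_le_of_amgm (R : rcfType) (x D Q : R) : 0 <= x -> 0 <= D -> 0 < Q ->
  (forall s, 0 < s -> x <= s * D + 2 * Q / s) -> x ^+ 2 <= 8 * Q * D.
Proof.
move=> x0; rewrite le_eqVlt => /predU1P[<-|D0] Q0 h.
  rewrite mulr0; suff : x <= 0 by move=> hx; rewrite (_ : x = 0) ?expr0n//; lra.
  rewrite leNgt; apply/negP => x1.
  (* When [D = 0] the bound tends to 0 as [s] grows; this value already yields [x <= x / 2]. *)
  have s0 : 0 < 4 * Q / x by rewrite divr_gt0// mulr_gt0.
  have := h _ s0; rewrite mulr0 add0r invf_div mulrA -mulrA.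
  have xn : x != 0 by rewrite gt_eqF.
  have Qn : Q != 0 by rewrite gt_eqF.
  have -> : 2 * Q * (x / (4 * Q)) = x / 2 by field.
  lra.
have s0 : 0 < Num.sqrt (2 * Q / D).
  by rewrite sqrtr_gt0 divr_gt0// mulr_gt0.
have := h _ s0; set s := Num.sqrt _ in s0 *.
have s2 : s ^+ 2 = 2 * Q / D by rewrite sqr_sqrtr// divr_ge0 ?mulr_ge0// ltW.
have sn : s != 0 by rewrite gt_eqF.
have Dn : D != 0 by rewrite gt_eqF.
have -> : 2 * Q / s = s * D.
  by apply: (mulIf sn); rewrite mulfVK// -mulrA [D * s]mulrC mulrA -expr2 s2 mulfVK.
move=> hx.
have : x ^+ 2 <= (s * D + s * D) ^+ 2 by rewrite ler_pXn2r ?nnegrE//; nra.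
have -> : (s * D + s * D) ^+ 2 = 4 * s ^+ 2 * D * D by ring.
by rewrite s2; have -> : 4 * (2 * Q / D) * D * D = 8 * Q * D by field.
Qed.

(** * From the isoperimetric constant to the Dirichlet form *)

Section lawler_sokal_inequality.
Context {R : realType} {d : measure_display} {T : measurableType d}.
Variables (mu : probability T R).

Lemma exists_law (v : T -> R) : measurable_fun setT v ->
  exists m : probability (measurableTypeR R) R,
    forall A, measurable A -> m A = mu (v @^-1` A).
Proof.
move=> mv.
pose X : {mfun T >-> measurableTypeR R} := @mfun_Sub _ _ T (measurableTypeR R) v (mem_set mv).
by exists (distribution mu X).
Qed.

Variables (v : T -> R) (m : probability (measurableTypeR R) R).
Hypothesis v_L2 : rL2 mu v.
Hypothesis v_mean : \int[mu]_x v x = 0.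
Hypothesis v_norm : \int[mu]_x v x ^+ 2 = 1.
Hypothesis m_law : forall A, measurable A -> m A = mu (v @^-1` A).

Lemma integral_law (f : R -> \bar R) : measurable_fun setT f ->
  mu.-integrable setT (f \o v) -> (\int[m]_x f x = \int[mu]_x f (v x))%E.
Proof.
move=> mf intf; have mv := rL2_meas v_L2.
have := @integral_pushforward _ _ T (measurableTypeR R) R v mv mu setT f mf.
rewrite preimage_setT => <- //.
by apply: eq_measure_integral => A mA _; exact: m_law.
Qed.

Lemma law_unit_variance : 'V_m[(fun x : R => x)] = 1%E.
Proof.
have mid : measurable_fun setT (fun x : measurableTypeR R => (x : R)).
  exact: measurable_id.
have a0 : fine 'E_m[(fun x : R => x)] = 0.
  rewrite expectation.unlock integral_law ?Rint_EFin ?v_mean//.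
  - exact: rL2_int.
  - exact: rL2_int.
rewrite /variance covariance.unlock a0 expectation.unlock.
transitivity (\int[m]_x ((x : R) ^+ 2)%:E)%E.
  apply: eq_integral => x _; rewrite -[LHS]/(((x : R) - 0) * ((x : R) - 0))%:E.
  by rewrite subr0 expr2.
rewrite integral_law.
- by rewrite Rint_EFin ?v_norm//; exact: rL2_sq.
- by apply/measurable_EFinP; exact: measurable_funX.
- exact: rL2_sq v_L2.
Qed.

Lemma second_moment_law c : second_moment m c = 1 + c ^+ 2.
Proof.
have h1 := rL2_sq v_L2; have h2 := rintZ (2 * c) (rL2_int v_L2).
have h3 := rint_cst mu (c ^+ 2).
have hv := rL2D v_L2 (rL2_cst mu c).
rewrite second_momentE /Rintegral integral_law.
- rewrite Rint_EFin /=; last exact: rL2_sq.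
  rewrite (_ : (fun x => _) = (fun x => v x ^+ 2 + 2 * c * v x + c ^+ 2)).
    rewrite RintD//; last exact: rintD.
    rewrite RintD// (RintZ _ (rL2_int v_L2)) v_mean v_norm mulr0 addr0.
    rewrite Rintegral_cst// [X in _ * fine X](_ : _ = 1%E) /= ?mulr1//.
    exact: probability_setT.
  by apply/funext => x; ring.
- apply/measurable_EFinP; apply: measurable_funX.
  by apply: measurable_funD => //; exact: measurable_id.
- exact: rL2_sq hv.
Qed.

Variable k : R.-spker T ~> T.
Hypothesis k_prob : forall x, k x setT = 1%E.
Hypothesis k_inv : forall A, measurable A -> (\int[mu]_x k x A)%E = mu A.
Variable kc : R.
Hypothesis kc_ge0 : 0 <= kc.
Hypothesis kc_le : forall A, measurable A ->
  kc * (fine (mu A) * fine (mu (~` A))) <= fine (\int[mu]_(x in A) k x (~` A)).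

Let D := \int[mu]_x v x ^+ 2 - \int[mu]_x (v x * kop k v x).

(** As [v] and [kop k v] have mean zero, a shift by [c] adds [c ^+ 2] to the form and to the squared
    norm alike, so [D] does not change. This freedom is what the supremum over [c] in [kappa]
    exploits. *)
Lemma shifted_form c :
  \int[mu]_x ((v x + c) * kop k (fun y => v y + c) x) =
  \int[mu]_x (v x * kop k v x) + c ^+ 2.
Proof.
have h1 := rL2M v_L2 (rL2_kop k_prob k_inv v_L2).
have h2 := rintZ c (rL2_int v_L2).
have h3 := rintZ c (rint_kop k_inv (rL2_int v_L2)).
have h4 := rint_cst mu (c ^+ 2).
rewrite (@ae_Rint _ _ _ mu _ (fun x => v x * kop k v x + c * v x + c * kop k v x + c ^+ 2)).
- rewrite RintD//; last by apply: rintD => //; exact: rintD.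
  rewrite RintD//; last exact: rintD.
  rewrite RintD// (RintZ _ (rL2_int v_L2)) (RintZ _ (rint_kop k_inv (rL2_int v_L2))).
  rewrite (Rint_kop k_inv (rL2_int v_L2)) v_mean mulr0 !addr0.
  rewrite Rintegral_cst// [X in _ * fine X](_ : _ = 1%E) /= ?mulr1//.
  exact: probability_setT.
- apply: measurable_funM.
    by apply: measurable_funD => //; exact: rL2_meas v_L2.
  by apply: measurable_kop; apply: measurable_funD => //; exact: rL2_meas v_L2.
- by apply: rint_meas; apply: rintD h4; apply: rintD h3; apply: rintD h2.
have := kopD k_inv (rL2_int v_L2) (rint_cst mu c).
apply: filterS => x ->; rewrite (kop_cst k_prob); ring.
Qed.

Lemma form_ge0 (u : T -> R) : rL2 mu u ->
  0 <= \int[mu]_x u x ^+ 2 - \int[mu]_x (u x * kop k u x).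
Proof.
move=> hu; have := coupling_sq k_prob k_inv (-1) hu.
have : (0 <= \int[coupling mu k]_z ((u z.1 + (-1) * u z.2) ^+ 2)%:E)%E.
  by apply: integral_ge0 => z _; rewrite lee_fin sqr_ge0.
move=> + e; rewrite e lee_fin => h.
have e2 : (1 + (-1) ^+ 2 : R) = 2 by ring.
by rewrite e2 in h; lra.
Qed.

(** [isoperimetry_functional] for the function [(x + c)^2] passes to the coupling, where
    [|a^2 - b^2|] is split by AM-GM into [s / 2 * (a - b)^2] and [(a + b)^2 / (2 s)]. By
    [coupling_sq] these integrate to [s * D] and [(2 * Q - D) / s]. *)
Lemma gap_mean_law_le c (s : R) : 0 < s ->
  kc * gap_mean m c <= s * D + 2 * second_moment m c / s.
Proof.
move=> s0.
have hv := rL2D v_L2 (rL2_cst mu c); set h := fun x => v x + c in hv.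
have mh := rL2_meas hv.
have hQ : second_moment m c = \int[mu]_x h x ^+ 2.
  rewrite second_momentE /Rintegral integral_law//; last exact: rL2_sq hv.
  apply/measurable_EFinP; apply: measurable_funX.
  by apply: measurable_funD => //; exact: measurable_id.
have Q1 := second_moment_law c.
have hD : D = second_moment m c - \int[mu]_x (h x * kop k h x).
  by rewrite /D shifted_form Q1 v_norm; ring.
have hpos := form_ge0 hv; rewrite -/h -hQ in hpos.
have mg : measurable_fun setT (fun x : measurableTypeR R => ((x : R) + c) ^+ 2).
  apply: measurable_funX.
  by apply: measurable_funD => //; exact: measurable_id.
have := isoperimetry_functional k_prob kc_ge0 kc_le (rL2_meas v_L2) m_law mg.
rewrite /= Rint_EFin; last exact: rint_gap law_unit_variance c.
rewrite -gap_meanE -EFinM => le1.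
have mc (e : R) : measurable_fun setT (fun z : T * T => ((h z.1 + e * h z.2) ^+ 2)%:E).
  apply/measurable_EFinP; apply: measurable_funX; apply: measurable_funD.
    exact: measurableT_comp.
  by apply: measurable_funM => //; exact: measurableT_comp.
have ie (e : R) : (\int[coupling mu k]_z ((h z.1 + e * h z.2) ^+ 2)%:E =
   ((1 + e ^+ 2) * second_moment m c + 2 * e * (second_moment m c - D))%:E)%E.
  rewrite (coupling_sq k_prob k_inv e hv) -hQ; congr (_%:E); congr (_ + _ * _).
  by rewrite hD; ring.
rewrite -lee_fin; apply: (le_trans le1).
apply: (@le_trans _ _ (\int[coupling mu k]_z
  ((s / 2)%:E * ((h z.1 + (-1) * h z.2) ^+ 2)%:E +
   ((2 * s)^-1)%:E * ((h z.1 + 1 * h z.2) ^+ 2)%:E))%E).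
  apply: ge0_le_integral => //.
  - apply/measurable_EFinP; apply: measurableT_comp => //; apply: measurable_funB;
     apply: measurable_funX; exact: (measurableT_comp mh).
  - by apply: emeasurable_funD; exact: measurable_funeM.
  move=> [x y] _; rewrite /= -!EFinM -EFinD lee_fin.
  set a := v x + c; set b := v y + c.
  have sn : s != 0 by rewrite gt_eqF.
  set t := (2 * s)^-1.
  have st : s * t = 2^-1 by rewrite /t; field.
  have t0 : 0 < t by rewrite invr_gt0 mulr_gt0.
  have key (e : R) : e ^+ 2 = 1 ->
    e * (a ^+ 2 - b ^+ 2) <= s / 2 * (a + -1 * b) ^+ 2 + t * (a + 1 * b) ^+ 2.
    move=> ee; have h0 : 0 <= s / 2 * ((a - b) - 2 * t * e * (a + b)) ^+ 2.
      by rewrite mulr_ge0 ?sqr_ge0// divr_ge0// ltW.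
    have e1 : s / 2 * ((a - b) - 2 * t * e * (a + b)) ^+ 2 = s / 2 * (a - b) ^+ 2
       - 2 * (s * t) * e * (a ^+ 2 - b ^+ 2) + 2 * (s * t) * t * e ^+ 2 * (a + b) ^+ 2.
      by field.
    rewrite e1 st ee in h0.
    have -> : a + -1 * b = a - b by ring.
    have -> : a + 1 * b = a + b by ring.
    lra.
  rewrite -[h x]/a -[h y]/b ler_norml; apply/andP; split.
    rewrite lerNl -(mulN1r (a ^+ 2 - b ^+ 2)); apply: key.
    by rewrite sqrrN expr1n.
  by rewrite -(mul1r (a ^+ 2 - b ^+ 2)); apply: key; rewrite expr1n.
rewrite ge0_integralD//; last 4 first.
- by move=> z _; rewrite mule_ge0 ?lee_fin ?sqr_ge0// divr_ge0// ltW.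
- exact: measurable_funeM.
- by move=> z _; rewrite mule_ge0 ?lee_fin ?sqr_ge0// invr_ge0 mulr_ge0// ltW.
- exact: measurable_funeM.
rewrite !ge0_integralZl//; last 4 first.
- by move=> z _; rewrite lee_fin sqr_ge0.
- by rewrite lee_fin invr_ge0 mulr_ge0// ltW.
- by move=> z _; rewrite lee_fin sqr_ge0.
- by rewrite lee_fin divr_ge0// ltW.
rewrite !ie -!EFinM -EFinD lee_fin.
have sn : s != 0 by rewrite gt_eqF.
set Q := second_moment m c in hpos hD *.
have Dge : 0 <= D by rewrite hD.
have -> : s / 2 * ((1 + (-1) ^+ 2) * Q + 2 * -1 * (Q - D)) +
   (2 * s)^-1 * ((1 + 1 ^+ 2) * Q + 2 * 1 * (Q - D)) =
   s * D + 2 * Q / s - D / s by field.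
by rewrite lerBlDr lerDl divr_ge0// ltW.
Qed.

(** Optimising over [s] gives [kc^2 * gap_ratio m c <= 8 * D] for every [c]. If the claim failed,
    [kappa_le] would supply a [c] violating this for the law of [v]. *)
Lemma lawler_sokal_normalized : kappa R * kc ^+ 2 <= 8 * D.
Proof.
have D0 : 0 <= D by exact: form_ge0.
have [->|kc0] := eqVneq kc 0; first by rewrite expr0n /= mulr0 mulr_ge0.
have kcp : 0 < kc ^+ 2 by rewrite exprn_gt0// lt0r kc0.
rewrite leNgt; apply/negP; rewrite -ltr_pdivrMr// => h.
have [c] := kappa_le law_unit_variance h.
have Q0 : 0 < second_moment m c.
  by apply: lt_le_trans ltr01 _; rewrite second_moment_law lerDl sqr_ge0.
have := sqr_le_of_amgm (mulr_ge0 kc_ge0 (gap_mean_ge0 m c)) D0 Q0 (@gap_mean_law_le c).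
move=> h1; rewrite /gap_ratio ltr_pdivlMr// mulrAC ltr_pdivrMr// => h2.
rewrite exprMn in h1; lra.
Qed.

End lawler_sokal_inequality.

Section lawler_sokal_general.
Context {R : realType} {d : measure_display} {T : measurableType d}.
Variables (mu : probability T R).

Lemma kopM_form (k : R.-spker T ~> T) (a : R) u :
  (forall x, k x setT = 1%E) ->
  (forall A, measurable A -> (\int[mu]_x k x A)%E = mu A) -> rL2 mu u ->
  \int[mu]_x (a * u x * kop k (fun y => a * u y) x) =
  a ^+ 2 * \int[mu]_x (u x * kop k u x).
Proof.
move=> k1 kinv hu; have hK := rL2_kop k1 kinv hu.
have hM := rL2M hu hK.
rewrite -RintZ//; apply: ae_Rint.
- apply: rint_meas (rL2M (rL2Z a hu) (rL2_kop k1 kinv (rL2Z a hu))).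
- exact: rint_meas (rintZ (a ^+ 2) hM).
have := kopZ kinv a (rL2_int hu); apply: filterS => x ->; ring.
Qed.

Lemma normalize_L2 u : rL2 mu u -> \int[mu]_x u x = 0 ->
  \int[mu]_x u x ^+ 2 != 0 ->
  exists2 a : R, a ^+ 2 * \int[mu]_x u x ^+ 2 = 1 &
    [/\ rL2 mu (fun x => a * u x), \int[mu]_x (a * u x) = 0 &
        \int[mu]_x (a * u x) ^+ 2 = 1].
Proof.
move=> hu u0 N0; set N := \int[mu]_x _ in N0.
have Np : 0 < N by rewrite lt0r N0; apply: Rint_ge0 => x; exact: sqr_ge0.
exists (Num.sqrt N)^-1.
  by rewrite exprVn sqr_sqrtr ?ltW// mulVf.
split; first exact: rL2Z.
  by rewrite (RintZ _ (rL2_int hu)) u0 mulr0.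
rewrite (_ : (fun x => _) = (fun x => (Num.sqrt N)^-1 ^+ 2 * u x ^+ 2)).
  by rewrite (RintZ _ (rL2_sq hu)) exprVn sqr_sqrtr ?ltW// mulVf.
by apply/funext => x; rewrite exprMn.
Qed.

(** [kappa] concerns laws of variance 1, hence the normalisation; when the norm vanishes, [form_ge0]
    suffices. *)
Theorem lawler_sokal (k : R.-spker T ~> T) (kc : R) u :
  (forall x, k x setT = 1%E) ->
  (forall A, measurable A -> (\int[mu]_x k x A)%E = mu A) ->
  0 <= kc ->
  (forall A, measurable A -> kc * (fine (mu A) * fine (mu (~` A))) <=
     fine (\int[mu]_(x in A) k x (~` A))) ->
  rL2 mu u -> \int[mu]_x u x = 0 ->
  kappa R * kc ^+ 2 * \int[mu]_x u x ^+ 2 <=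
  8 * (\int[mu]_x u x ^+ 2 - \int[mu]_x (u x * kop k u x)).
Proof.
move=> k1 kinv kc0 kcle hu u0.
have [N0|N0] := eqVneq (\int[mu]_x u x ^+ 2) 0.
  have := form_ge0 k1 kinv hu; rewrite N0 mulr0; lra.
have [a aN [hv v0 v1]] := normalize_L2 hu u0 N0.
have [m hm] := exists_law mu (rL2_meas hv).
have := lawler_sokal_normalized hv v0 v1 hm k1 kinv kc0 kcle.
rewrite kopM_form// v1 -[X in _ * (X - _)]aN -mulrBr => h.
set N := \int[mu]_x u x ^+ 2 in aN N0 h *.
have Np : 0 < N by rewrite lt0r N0; apply: Rint_ge0 => x; exact: sqr_ge0.
have a2 : a ^+ 2 = N^-1 by rewrite -[LHS](mulfK N0) aN mul1r.
by rewrite -ler_pdivlMr// -mulrA [_ / N]mulrC -a2.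
Qed.

(** The link from sets to functions: its squared norm is the denominator of [kset] and its Dirichlet
    form the numerator, see [integral_flow]. It also witnesses that nonzero mean-zero functions
    exist. *)
Definition centered_indicator (A : set T) : T -> R :=
  fun x => \1_A x - fine (mu A).

Lemma rL2_indic A : measurable A -> rL2 mu (\1_A : T -> R).
Proof.
move=> mA; split; first exact: measurable_indic.
apply: (rint_le _ _ (rint_cst mu 1)).
  by apply: measurable_funX; exact: measurable_indic.
by move=> x; rewrite indicE; case: (x \in A); rewrite ?expr1n ?expr0n ?normr1 ?normr0 ?ler01.
Qed.

Lemma Rint_indic A : measurable A -> \int[mu]_x (\1_A x : R) = fine (mu A).
Proof. by move=> mA; rewrite /Rintegral integral_indic// setIT. Qed.

Lemma rL2_centered_indicator A : measurable A -> rL2 mu (centered_indicator A).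
Proof. by move=> mA; apply: rL2B; [exact: rL2_indic|exact: rL2_cst]. Qed.

Lemma Rint_centered_indicator A : measurable A ->
  \int[mu]_x centered_indicator A x = 0.
Proof.
move=> mA; rewrite RintB; [|exact: rL2_int (rL2_indic mA)|exact: rint_cst].
rewrite Rint_indic// Rintegral_cst// [X in _ - _ * fine X](_ : _ = 1%E) /= ?mulr1 ?subrr//.
exact: probability_setT.
Qed.

Lemma fine_measureC A : measurable A -> fine (mu (~` A)) = 1 - fine (mu A).
Proof.
move=> mA; rewrite probability_setC// fineB//.
exact: fin_num_measure.
Qed.

Lemma Rint_centered_indicator_sq A : measurable A ->
  \int[mu]_x centered_indicator A x ^+ 2 = fine (mu A) * fine (mu (~` A)).
Proof.
move=> mA; set q := fine (mu A).
have h1 := rintZ (1 - 2 * q) (rL2_int (rL2_indic mA)).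
have h2 := rint_cst mu (q ^+ 2).
rewrite (_ : (fun x => _) = (fun x => (1 - 2 * q) * \1_A x + q ^+ 2)).
  rewrite RintD// (RintZ _ (rL2_int (rL2_indic mA))) Rint_indic//.
  rewrite Rintegral_cst// [X in _ + _ * fine X](_ : _ = 1%E) /=; last exact: probability_setT.
  by rewrite fine_measureC// -/q; ring.
apply/funext => x; rewrite /centered_indicator indicE -/q.
by case: (x \in A) => /=; ring.
Qed.

Lemma proper_set_gt0 A : proper_set mu A ->
  [/\ measurable A, 0 < fine (mu A) & 0 < fine (mu (~` A))].
Proof.
case=> mA A0 A1; split => //.
  by rewrite fine_gt0// A0 (lt_trans A1) ?ltry.
rewrite fine_measureC// subr_gt0 -lte_fin fineK//; exact: fin_num_measure.
Qed.

(** The normalised centred indicator of a proper set has a unit-variance law, as [kappa_ge]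
    requires. Positivity is what puts [rate e] below 1. *)
Lemma kappa_gt0 : (exists A, proper_set mu A) -> 0 < kappa R.
Proof.
case=> A /proper_set_gt0[mA A0 A1].
have N0 : \int[mu]_x centered_indicator A x ^+ 2 != 0.
  by rewrite Rint_centered_indicator_sq// mulf_neq0 ?gt_eqF.
have [a aN [hv v0 v1]] := normalize_L2 (rL2_centered_indicator mA)
  (Rint_centered_indicator mA) N0.
have [m hm] := exists_law mu (rL2_meas hv).
apply: lt_le_trans (kappa_ge (law_unit_variance hv v0 v1 hm)); lra.
Qed.

End lawler_sokal_general.

(** * Iterates of the Markov operator on complex L2 *)

Section nstep_operator.
Context {R : realType} {d : measure_display} {T : measurableType d}.
Variables (mu : probability T R).
Implicit Types p q : R.-spker T ~> T.

Definition kernel_comp p q : R.-spker T ~> T := mkcomp_noparam p q.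

Lemma kernel_comp_prob p q : (forall x, p x setT = 1%E) ->
  (forall x, q x setT = 1%E) -> forall x, kernel_comp p q x setT = 1%E.
Proof.
move=> p1 q1 x; rewrite /kernel_comp /= /mkcomp_noparam /= /kcomp_noparam.
rewrite (eq_integral (cst 1%E)); last by move=> y _; rewrite q1.
by rewrite integral_cst// mul1e p1.
Qed.

Lemma integral_kernel_comp p q (F : T -> \bar R) x :
  (forall z, 0 <= F z)%E -> measurable_fun setT F ->
  (\int[kernel_comp p q x]_z F z = \int[p x]_y \int[q y]_z F z)%E.
Proof.
move=> F0 mF.
exact: (@integral_kcomp _ _ _ _ _ _ _ p
  (kernel.kernel_snd q : R.-spker (T * T)%type ~> T) x F F0 mF).
Qed.

Lemma kernel_comp_inv p q :
  (forall A, measurable A -> (\int[mu]_x p x A)%E = mu A) ->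
  (forall A, measurable A -> (\int[mu]_x q x A)%E = mu A) ->
  forall A, measurable A -> (\int[mu]_x kernel_comp p q x A)%E = mu A.
Proof.
move=> pinv qinv A mA; rewrite -(qinv _ mA).
rewrite -(integral_invariant pinv (F := q ^~ A))//.
exact: measurable_kernel.
Qed.

(** For nonnegative functions the identity holds between extended integrals. Passing to the
    real-valued [kop] requires the inner integral to be finite [p x]-almost everywhere, which
    [ae_invariant] provides; the signed case follows from the two parts. *)
Lemma kop_kernel_comp p q u :
  (forall A, measurable A -> (\int[mu]_x p x A)%E = mu A) ->
  (forall A, measurable A -> (\int[mu]_x q x A)%E = mu A) -> rint mu u ->
  \forall x \ae mu, kop (kernel_comp p q) u x = kop p (kop q u) x.
Proof.
move=> pinv qinv hu.
have pqinv := kernel_comp_inv pinv qinv.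
have pos w : (forall x, 0 <= w x) -> rint mu w ->
    \forall x \ae mu, kop (kernel_comp p q) w x = kop p (kop q w) x.
  move=> w0 hw; have mw := rint_meas hw.
  have := ae_invariant pinv (ae_rint_kernel qinv hw); apply: filterS => x hx.
  rewrite /kop /Rintegral integral_kernel_comp; last 2 first.
  - by move=> z; rewrite lee_fin.
  - exact/measurable_EFinP.
  congr fine; apply: ae_eq_integral => //.
  - apply: measurable_fun_integral_kernel => //.
    + by move=> U mU; exact: measurable_kernel.
    + exact/measurable_EFinP.
  - by apply/measurable_EFinP; exact: measurable_kop.
  by move: hx; apply: filterS => y hy _; rewrite -/(Rintegral _ _ _) Rint_EFin.
have [h0 h1 e1] := kop_posneg pqinv hu.
have [_ _ e2] := kop_posneg qinv hu.
have mu_ := rint_meas hu.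
have k0 := rint_kop qinv h0; have k1 := rint_kop qinv h1.
have e3 := kop_ae pinv (measurable_kop q mu_) (rint_meas (rintB k0 k1)) e2.
have e4 := kopB pinv k0 k1.
have e5 := pos _ (funrpos_ge0 u) h0.
have e6 := pos _ (funrneg_ge0 u) h1.
near=> x.
rewrite (near e1 x)// (near e3 x)// (near e4 x)// (near e5 x)// (near e6 x)//.
Unshelve. all: by end_near. Qed.

End nstep_operator.

Section nstep_iterates.
Context {R : realType} {d : measure_display} {T : measurableType d}.
Variables (mu : probability T R) (p : R.-pker T ~> T).
Hypothesis p_inv : invariant_probability p mu.

Lemma pker_prob x : (p : R.-spker T ~> T) x setT = 1%E.
Proof. exact: prob_kernel. Qed.

Lemma nstep_prob n x : nstep p n x setT = 1%E.
Proof.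
elim: n x => [x|n IH x]; first by rewrite /= /kdirac diracT.
exact: (kernel_comp_prob pker_prob IH x).
Qed.

Lemma nstep_inv n A : measurable A -> (\int[mu]_x nstep p n x A)%E = mu A.
Proof.
elim: n A => [A mA|n IH A mA].
  by rewrite /= /kdirac /dirac /= integral_indic// setIT.
exact: (kernel_comp_inv p_inv IH mA).
Qed.

Lemma kop_nstep n u : rint mu u ->
  \forall x \ae mu, kop (nstep p n) u x = iter n (kop p) u x.
Proof.
elim: n u => [u hu|n IH u hu].
  apply: aeW => x; rewrite /= /kop /Rintegral /= integral_dirac//.
  - by rewrite diracT mul1e.
  - by apply/measurable_EFinP; exact: rint_meas hu.
have e1 := kop_kernel_comp p_inv (@nstep_inv n) hu.
have miter : measurable_fun setT (iter n (kop p) u).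
  elim: n {IH e1} => [|n IHn]; first exact: rint_meas hu.
  exact: measurable_kop.
have e2 := kop_ae p_inv (measurable_kop (nstep p n) (rint_meas hu)) miter (IH _ hu).
by move: e1 e2; apply: filterS2 => x /= + <-.
Qed.

End nstep_iterates.

(** * Complex-valued square-integrable functions *)

Section complex_squares.
Context {R : realType}.
Implicit Types z w : R[i].

Definition nsq z : R := complex.Re z ^+ 2 + complex.Im z ^+ 2.
(** The real part of [z] times the conjugate of [w]. Only the real part of the complex inner product
    enters the estimates, so [ip] is real-valued. *)
Definition dotc z w : R :=
  complex.Re z * complex.Re w + complex.Im z * complex.Im w.

Lemma creD z w : complex.Re (z + w) = complex.Re z + complex.Re w.
Proof. by case: z w => ? ? []. Qed.
Lemma cimD z w : complex.Im (z + w) = complex.Im z + complex.Im w.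
Proof. by case: z w => ? ? []. Qed.
Lemma creB z w : complex.Re (z - w) = complex.Re z - complex.Re w.
Proof. by case: z w => ? ? []. Qed.
Lemma cimB z w : complex.Im (z - w) = complex.Im z - complex.Im w.
Proof. by case: z w => ? ? []. Qed.
Lemma creM z w : complex.Re (z * w) =
  complex.Re z * complex.Re w - complex.Im z * complex.Im w.
Proof. by case: z w => ? ? []. Qed.
Lemma cimM z w : complex.Im (z * w) =
  complex.Re z * complex.Im w + complex.Im z * complex.Re w.
Proof. by case: z w => ? ? []. Qed.

Lemma nsq_ge0 z : 0 <= nsq z. Proof. by rewrite addr_ge0 ?sqr_ge0. Qed.

Lemma nsqM z w : nsq (z * w) = nsq z * nsq w.
Proof. by rewrite /nsq creM cimM; ring. Qed.

Lemma nsqD z w : nsq (z + w) = nsq z + 2 * dotc z w + nsq w.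
Proof. by rewrite /nsq /dotc creD cimD; ring. Qed.

Lemma dotcBl z z' w : dotc (z - z') w = dotc z w - dotc z' w.
Proof. by rewrite /dotc creB cimB; ring. Qed.

Lemma dotcMl a z : dotc (a * z) z = complex.Re a * nsq z.
Proof. by rewrite /dotc /nsq creM cimM; ring. Qed.

Lemma normc_nsq z : ComplexField.Normc.normc z = Num.sqrt (nsq z).
Proof. by case: z. Qed.

Lemma normc_sq z : ComplexField.Normc.normc z ^+ 2 = nsq z.
Proof. by rewrite normc_nsq sqr_sqrtr// nsq_ge0. Qed.

Lemma norm_complexE z : `|z| = Complex (ComplexField.Normc.normc z) 0.
Proof. by rewrite complex.normc_def normc_nsq. Qed.

Lemma nsq_norm z : (Complex (nsq z) 0) = `|z| ^+ 2.
Proof. by rewrite norm_complexE expr2 -normc_sq expr2; simpc. Qed.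

Lemma nsq_eq0 z : nsq z = 0 -> z = 0.
Proof.
move=> h; apply: ComplexField.Normc.eq0_normc.
by rewrite normc_nsq h sqrtr0.
Qed.

Lemma nsqX z n : nsq (z ^+ n) = nsq z ^+ n.
Proof.
elim: n => [|n IH]; last by rewrite !exprS nsqM IH.
by rewrite !expr0 /nsq /= expr1n expr0n addr0.
Qed.

Lemma nsqV z : nsq z^-1 = (nsq z)^-1.
Proof. by rewrite -!normc_sq ComplexField.Normc.normcV exprVn. Qed.

End complex_squares.

Section complex_L2.
Context {R : realType} {d : measure_display} {T : measurableType d}.
Variable mu : probability T R.
Implicit Types (f g : T -> R[i]) (a : R[i]).

Lemma L2P f : L2 mu f <->
  rL2 mu (fun x => complex.Re (f x)) /\ rL2 mu (fun x => complex.Im (f x)).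
Proof. by split=> -[/rL2P ? /rL2P ?]; split. Qed.

Definition sqn f : R := \int[mu]_x nsq (f x).
Definition ip f g : R := \int[mu]_x dotc (f x) (g x).

Lemma rint_nsq f : L2 mu f -> rint mu (fun x => nsq (f x)).
Proof. by move=> /L2P[h1 h2]; apply: rintD; exact: rL2_sq. Qed.

Lemma rint_dotc f g : L2 mu f -> L2 mu g -> rint mu (fun x => dotc (f x) (g x)).
Proof. by move=> /L2P[h1 h2] /L2P[h3 h4]; apply: rintD; exact: rL2M. Qed.

Lemma sqn_ge0 f : 0 <= sqn f.
Proof. by apply: Rint_ge0 => x; exact: nsq_ge0. Qed.

Lemma L2normE f : L2 mu f -> L2norm mu f = Num.sqrt (sqn f).
Proof.
move=> hf; rewrite /L2norm unlock.
rewrite (_ : (\int[mu]_x _)%E = (sqn f)%:E); last first.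
  rewrite -Rint_EFin; last exact: rint_nsq.
  apply: eq_integral => x _; rewrite /= ger0_norm; last by rewrite normc_nsq sqrtr_ge0.
  by rewrite powR_mulrn ?normc_sq// normc_nsq sqrtr_ge0.
by rewrite /= powR12_sqrt// sqn_ge0.
Qed.

Lemma L2norm_ge0 f : 0 <= L2norm mu f.
Proof. by rewrite /L2norm fine_ge0// Lnorm_ge0. Qed.

Lemma L2norm_sq f : L2 mu f -> L2norm mu f ^+ 2 = sqn f.
Proof. by move=> hf; rewrite L2normE// sqr_sqrtr// sqn_ge0. Qed.

Lemma L2D f g : L2 mu f -> L2 mu g -> L2 mu (fun x => f x + g x).
Proof.
move=> /L2P[h1 h2] /L2P[h3 h4]; apply/L2P; split.
  by have := rL2D h1 h3; congr rL2; apply/funext => x; rewrite creD.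
by have := rL2D h2 h4; congr rL2; apply/funext => x; rewrite cimD.
Qed.

Lemma L2Z a f : L2 mu f -> L2 mu (fun x => a * f x).
Proof.
move=> /L2P[h1 h2]; apply/L2P; split.
  have := rL2B (rL2Z (complex.Re a) h1) (rL2Z (complex.Im a) h2); congr rL2.
  by apply/funext => x; rewrite creM.
have := rL2D (rL2Z (complex.Re a) h2) (rL2Z (complex.Im a) h1); congr rL2.
by apply/funext => x; rewrite cimM.
Qed.

Lemma L2B f g : L2 mu f -> L2 mu g -> L2 mu (fun x => f x - g x).
Proof.
move=> /L2P[h1 h2] /L2P[h3 h4]; apply/L2P; split.
  by have := rL2B h1 h3; congr rL2; apply/funext => x; rewrite creB.
by have := rL2B h2 h4; congr rL2; apply/funext => x; rewrite cimB.
Qed.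

Lemma L2_cst a : L2 mu (fun=> a).
Proof. by apply/L2P; split; exact: rL2_cst. Qed.

Lemma sqnZ a f : L2 mu f -> sqn (fun x => a * f x) = nsq a * sqn f.
Proof.
move=> hf; rewrite /sqn -RintZ; last exact: rint_nsq.
by congr Rintegral; apply/funext => x; rewrite nsqM.
Qed.

Lemma L2normZ a f : L2 mu f ->
  L2norm mu (fun x => a * f x) = ComplexField.Normc.normc a * L2norm mu f.
Proof.
move=> hf; rewrite !L2normE//; last exact: L2Z.
by rewrite sqnZ// sqrtrM ?nsq_ge0// normc_nsq.
Qed.

Lemma sqnD f g : L2 mu f -> L2 mu g ->
  sqn (fun x => f x + g x) = sqn f + 2 * ip f g + sqn g.
Proof.
move=> hf hg.
have h1 := rint_nsq hf; have h2 := rintZ 2 (rint_dotc hf hg); have h3 := rint_nsq hg.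
rewrite /sqn (_ : (fun x => _) = (fun x => nsq (f x) + 2 * dotc (f x) (g x) + nsq (g x))).
  by rewrite RintD//; [rewrite RintD// (RintZ _ (rint_dotc hf hg))|exact: rintD].
by apply/funext => x; rewrite nsqD.
Qed.

Lemma cauchy_schwarz f g : L2 mu f -> L2 mu g ->
  ip f g <= L2norm mu f * L2norm mu g.
Proof.
move=> hf hg.
have key (s : R) : 0 <= s ^+ 2 * sqn f - 2 * s * ip f g + sqn g.
  have := sqn_ge0 (fun x => Complex (- s) 0 * f x + g x).
  rewrite sqnD//; last exact: L2Z.
  rewrite sqnZ// /ip.
  rewrite (_ : (fun x => _) = (fun x => - s * dotc (f x) (g x))).
    rewrite (RintZ _ (rint_dotc hf hg)) /nsq /= => h; apply: (le_trans h).
    by rewrite le_eqVlt; apply/orP; left; apply/eqP; ring.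
  by apply/funext => x; rewrite /dotc creM cimM /=; ring.
have [F0|F0] := eqVneq (sqn f) 0.
  have : ip f g <= 0.
    rewrite leNgt; apply/negP => h.
    (* With [sqn f = 0] the quadratic is affine in [s], and this [s] makes it equal to
       [- sqn g - 2]. *)
    have := key ((sqn g + 1) / ip f g); rewrite F0 mulr0 sub0r.
    rewrite -mulrA -mulrA mulVf ?gt_eqF// mulr1; have := sqn_ge0 g; lra.
  by move/le_trans; apply; rewrite mulr_ge0// L2norm_ge0.
have Fp : 0 < sqn f by rewrite lt0r F0 sqn_ge0.
have sq : ip f g ^+ 2 <= sqn f * sqn g.
  have := key (ip f g / sqn f).
  rewrite (_ : _ + _ = (sqn f * sqn g - ip f g ^+ 2) / sqn f); last by field.
  by rewrite pmulr_lge0 ?invr_gt0// subr_ge0.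
apply: (le_trans (ler_norm _)).
rewrite -sqrtr_sqr !L2normE// -sqrtrM ?sqn_ge0//.
by rewrite ler_wsqrtr.
Qed.

Lemma L2norm_triangle f g : L2 mu f -> L2 mu g ->
  L2norm mu (fun x => f x + g x) <= L2norm mu f + L2norm mu g.
Proof.
move=> hf hg; have h0 := L2norm_ge0 f; have h1 := L2norm_ge0 g.
rewrite -(@ler_pXn2r _ 2)// ?nnegrE ?L2norm_ge0 ?addr_ge0//.
rewrite L2norm_sq; last exact: L2D.
rewrite sqnD// -!L2norm_sq//; have := cauchy_schwarz hf hg; nra.
Qed.

Lemma L2norm_triangleB f g : L2 mu f -> L2 mu g ->
  L2norm mu (fun x => f x - g x) <= L2norm mu f + L2norm mu g.
Proof.
move=> hf hg; have := L2norm_triangle hf (L2Z (-1) hg).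
rewrite L2normZ// (_ : ComplexField.Normc.normc (-1) = 1).
  rewrite mul1r; congr (_ <= _); congr (L2norm mu _).
  by apply/funext => x; rewrite mulN1r.
by rewrite normc_nsq /nsq /= sqrrN expr1n oppr0 expr0n addr0 sqrtr1.
Qed.

Lemma ae_sqn f g : L2 mu f -> L2 mu g -> (\forall x \ae mu, f x = g x) ->
  sqn f = sqn g.
Proof.
move=> hf hg fg; apply: ae_Rint.
- exact: rint_meas (rint_nsq hf).
- exact: rint_meas (rint_nsq hg).
- by move: fg; apply: filterS => x ->.
Qed.

Lemma ae_L2norm f g : L2 mu f -> L2 mu g -> (\forall x \ae mu, f x = g x) ->
  L2norm mu f = L2norm mu g.
Proof. by move=> hf hg fg; rewrite !L2normE// (ae_sqn hf hg fg). Qed.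

Lemma L2norm_eq0 f : L2 mu f -> L2norm mu f = 0 -> \forall x \ae mu, f x = 0.
Proof.
move=> hf f0.
have h : sqn f = 0 by rewrite -L2norm_sq// f0 expr0n.
have := Rint_eq0 (rint_meas (rint_nsq hf)) (fun x => nsq_ge0 (f x)) (rint_nsq hf) h.
by apply: filterS => x /nsq_eq0.
Qed.

Lemma L2_sum (I : Type) (r : seq I) (F : I -> T -> R[i]) :
  (forall i, L2 mu (F i)) -> L2 mu (fun x => \sum_(i <- r) F i x).
Proof.
move=> hF; elim: r => [|i r IH].
  by under eq_fun => x do rewrite big_nil; exact: L2_cst.
by under eq_fun => x do rewrite big_cons; exact: L2D.
Qed.

Lemma L2zeroP f : L2zero mu f <-> [/\ L2 mu f,
  \int[mu]_x complex.Re (f x) = 0 & \int[mu]_x complex.Im (f x) = 0].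
Proof.
split; first by case=> hf; rewrite /cintegral => -[? ?].
by case=> hf h1 h2; split => //; rewrite /cintegral h1 h2.
Qed.

Lemma L2zeroD f g : L2zero mu f -> L2zero mu g -> L2zero mu (fun x => f x + g x).
Proof.
move=> /L2zeroP[hf f1 f2] /L2zeroP[hg g1 g2]; apply/L2zeroP; split.
- exact: L2D.
- under eq_Rintegral => x _ do rewrite creD.
  move/L2P: hf => [hf1 hf2]; move/L2P: hg => [hg1 hg2].
  by rewrite RintD ?f1 ?g1 ?addr0//; exact: rL2_int.
- under eq_Rintegral => x _ do rewrite cimD.
  move/L2P: hf => [hf1 hf2]; move/L2P: hg => [hg1 hg2].
  by rewrite RintD ?f2 ?g2 ?addr0//; exact: rL2_int.
Qed.

Lemma L2zeroZ a f : L2zero mu f -> L2zero mu (fun x => a * f x).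
Proof.
move=> /L2zeroP[hf f1 f2]; have /L2P[hf1 hf2] := hf.
apply/L2zeroP; split; first exact: L2Z.
- under eq_Rintegral => x _ do rewrite creM.
  rewrite RintB; [|exact/rintZ/rL2_int..].
  by rewrite !RintZ ?f1 ?f2 ?mulr0 ?subrr//; exact: rL2_int.
- under eq_Rintegral => x _ do rewrite cimM.
  rewrite RintD; [|exact/rintZ/rL2_int..].
  by rewrite !RintZ ?f1 ?f2 ?mulr0 ?addr0//; exact: rL2_int.
Qed.

Lemma L2zero_cst0 : L2zero mu (fun=> 0).
Proof.
apply/L2zeroP; split; first exact: L2_cst.
- by rewrite Rintegral_cst// mul0r.
- by rewrite Rintegral_cst// mul0r.
Qed.

Lemma L2zero_sum (I : Type) (r : seq I) (F : I -> T -> R[i]) :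
  (forall i, L2zero mu (F i)) -> L2zero mu (fun x => \sum_(i <- r) F i x).
Proof.
move=> hF; elim: r => [|i r IH].
  by under eq_fun => x do rewrite big_nil; exact: L2zero_cst0.
by under eq_fun => x do rewrite big_cons; exact: L2zeroD.
Qed.

Lemma L2zero_L2 f : L2zero mu f -> L2 mu f. Proof. by case. Qed.

End complex_L2.

(** * The flow out of a set as a Dirichlet form *)

Section set_flow.
Context {R : realType} {d : measure_display} {T : measurableType d}.
Variables (mu : probability T R) (k : R.-spker T ~> T).
Hypothesis k_prob : forall x, k x setT = 1%E.
Hypothesis k_inv : forall A, measurable A -> (\int[mu]_x k x A)%E = mu A.

Lemma kernel_setC A x : measurable A -> k x (~` A) = (1 - kop k \1_A x)%:E.
Proof.
move=> mA; rewrite /kop /Rintegral integral_indic// setIT.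
have fA : k x A \is a fin_num.
  rewrite ge0_fin_numE//; apply: (@le_lt_trans _ _ (k x setT)).
    by apply: le_measure; rewrite ?inE.
  by rewrite k_prob ltry.
have : (k x A + k x (~` A) = 1)%E.
  by rewrite -measureU ?setUv ?setICr//; [exact: k_prob|exact: measurableC].
by move=> h; rewrite EFinB fineK// -h addeAC subee// add0e.
Qed.

(** The kernel mass of the complement of [A] is [1 - kop k \1_A]. Centring the indicator changes the
    integrand only by a multiple of [\1_A - kop k \1_A], whose integral is 0 by invariance. *)
Lemma integral_flow A : measurable A ->
  fine (\int[mu]_(x in A) k x (~` A)) =
  \int[mu]_x centered_indicator mu A x ^+ 2 -
  \int[mu]_x (centered_indicator mu A x * kop k (centered_indicator mu A) x).
Proof.
move=> mA; set c := centered_indicator mu A; set q := fine (mu A).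
have hi := rL2_indic mu mA.
have hc := rL2_centered_indicator mu mA.
have h1 := rL2_int hi.
have hk := rL2_kop k_prob k_inv hi.
have h2 := rL2M hi hk.
rewrite -RintB; [|exact: rL2_sq|exact: rL2M hc (rL2_kop k_prob k_inv hc)].
pose F x : R := \1_A x - \1_A x * kop k \1_A x.
have hF : rint mu F by exact: rintB.
transitivity (\int[mu]_x F x).
  rewrite /Rintegral [in LHS]integral_mkcond; congr fine; apply: eq_integral => x _.
  rewrite patchE /F indicE; case: (x \in A) => /=; last by rewrite mul0r subr0.
  by rewrite kernel_setC// mul1r.
have hG : rint mu (fun x => F x - q * (\1_A x - kop k \1_A x)).
  apply: rintB => //; apply: rintZ; apply: rintB => //; exact: rL2_int.
transitivity (\int[mu]_x (F x - q * (\1_A x - kop k \1_A x))).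
  have hd := rintB h1 (rL2_int hk).
  rewrite [RHS](RintB hF (rintZ q hd)) (RintZ q hd) (RintB h1 (rL2_int hk)).
  by rewrite (Rint_kop k_inv h1) subrr mulr0 subr0.
apply: ae_Rint.
- exact: rint_meas hG.
- exact: rint_meas (rintB (rL2_sq hc) (rL2M hc (rL2_kop k_prob k_inv hc))).
have := kopB k_inv h1 (rint_cst mu q); apply: filterS => x.
rewrite -/(centered_indicator mu A) (kop_cst k_prob) => ->.
rewrite /F /c /centered_indicator -/q !indicE.
by case: (x \in A) => /=; ring.
Qed.

End set_flow.

Section markov_operator.
Context {R : realType} {d : measure_display} {T : measurableType d}.
Variables (mu : probability T R) (p : R.-pker T ~> T).
Hypothesis p_inv : invariant_probability p mu.
Implicit Types f g : T -> R[i].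

Local Notation P := (markov_op p).
Let p1 := @pker_prob R d T p.

Lemma Re_markov f x : complex.Re (P f x) = kop p (fun y => complex.Re (f y)) x.
Proof. by []. Qed.
Lemma Im_markov f x : complex.Im (P f x) = kop p (fun y => complex.Im (f y)) x.
Proof. by []. Qed.

Lemma markov_L2 f : L2 mu f -> L2 mu (P f).
Proof.
by move=> /L2P[h1 h2]; apply/L2P; split; [exact: (rL2_kop p1 p_inv h1)|exact: (rL2_kop p1 p_inv h2)].
Qed.

Lemma markov_L2zero f : L2zero mu f -> L2zero mu (P f).
Proof.
move=> /L2zeroP[hf f1 f2]; have /L2P[h1 h2] := hf.
apply/L2zeroP; split; first exact: markov_L2.
- by have := Rint_kop p_inv (rL2_int h1); rewrite f1.
- by have := Rint_kop p_inv (rL2_int h2); rewrite f2.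
Qed.

Lemma markov_contraction f : L2 mu f -> L2norm mu (P f) <= L2norm mu f.
Proof.
move=> hf; rewrite !L2normE//; last exact: markov_L2.
rewrite ler_wsqrtr// /sqn; have /L2P[h1 h2] := hf.
have k1 := rL2_kop p1 p_inv h1; have k2 := rL2_kop p1 p_inv h2.
rewrite (RintD (rL2_sq h1) (rL2_sq h2)) (RintD (rL2_sq k1) (rL2_sq k2)).
by apply: lerD; [exact: (kop_contraction p1 p_inv h1)|exact: (kop_contraction p1 p_inv h2)].
Qed.

Lemma complex_eq (z w : R[i]) : complex.Re z = complex.Re w ->
  complex.Im z = complex.Im w -> z = w.
Proof. by case: z w => ? ? [? ?] /= -> ->. Qed.

Lemma markov_linear (a : R[i]) f g : L2 mu f -> L2 mu g ->
  \forall x \ae mu, P (fun x => a * f x + g x) x = a * P f x + P g x.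
Proof.
move=> /L2P[f1 f2] /L2P[g1 g2].
have i1 := rL2_int f1; have i2 := rL2_int f2.
have i3 := rL2_int g1; have i4 := rL2_int g2.
set b := complex.Re a; set c := complex.Im a.
have e1 := kopZ p_inv b i1; have e2 := kopZ p_inv c i2.
have e3 := kopZ p_inv b i2; have e4 := kopZ p_inv c i1.
have e5 := kopB p_inv (rintZ b i1) (rintZ c i2).
have e6 := kopD p_inv (rintZ b i2) (rintZ c i1).
have e7 := kopD p_inv (rintB (rintZ b i1) (rintZ c i2)) i3.
have e8 := kopD p_inv (rintD (rintZ b i2) (rintZ c i1)) i4.
near=> x; apply: complex_eq.
  rewrite creD creM !Re_markov !Im_markov.
  rewrite (_ : (fun y => complex.Re _) = (fun y => b * complex.Re (f y) -
    c * complex.Im (f y) + complex.Re (g y))); last first.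
    by apply/funext => y; rewrite creD creM.
  by rewrite (near e7 x)// (near e5 x)// (near e1 x)// (near e2 x).
rewrite cimD cimM !Re_markov !Im_markov.
rewrite (_ : (fun y => complex.Im _) = (fun y => b * complex.Im (f y) +
  c * complex.Re (f y) + complex.Im (g y))); last first.
  by apply/funext => y; rewrite cimD cimM.
by rewrite (near e8 x)// (near e6 x)// (near e3 x)// (near e4 x).
Unshelve. all: by end_near. Qed.

Lemma markov_ae f g : L2 mu f -> L2 mu g -> (\forall x \ae mu, f x = g x) ->
  \forall x \ae mu, P f x = P g x.
Proof.
move=> /L2P[f1 f2] /L2P[g1 g2] fg.
have h1 : \forall x \ae mu, complex.Re (f x) = complex.Re (g x).
  by move: fg; apply: filterS => x ->.
have h2 : \forall x \ae mu, complex.Im (f x) = complex.Im (g x).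
  by move: fg; apply: filterS => x ->.
have e1 := kop_ae p_inv (rL2_meas f1) (rL2_meas g1) h1.
have e2 := kop_ae p_inv (rL2_meas f2) (rL2_meas g2) h2.
near=> x; apply: complex_eq; [exact: (near e1 x)|exact: (near e2 x)].
Unshelve. all: by end_near. Qed.

Lemma iter_L2 n f : L2 mu f -> L2 mu (iter n P f).
Proof. by move=> hf; elim: n => //= n; exact: markov_L2. Qed.

Lemma iter_L2zero n f : L2zero mu f -> L2zero mu (iter n P f).
Proof. by move=> hf; elim: n => //= n; exact: markov_L2zero. Qed.

Lemma iter_contraction n f : L2 mu f -> L2norm mu (iter n P f) <= L2norm mu f.
Proof.
move=> hf; elim: n => //= n; apply: le_trans.
by apply: markov_contraction; exact: iter_L2.
Qed.

Lemma iter_linear n (a : R[i]) f g : L2 mu f -> L2 mu g ->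
  \forall x \ae mu,
    iter n P (fun x => a * f x + g x) x = a * iter n P f x + iter n P g x.
Proof.
move=> hf hg; elim: n => [|n IH]; first exact: aeW.
have hfg := L2D (L2Z a hf) hg.
have e1 := markov_ae (iter_L2 n hfg) (L2D (L2Z a (iter_L2 n hf)) (iter_L2 n hg)) IH.
have e2 := markov_linear a (iter_L2 n hf) (iter_L2 n hg).
by move: e1 e2; apply: filterS2 => x /= -> ->.
Qed.

Lemma iter_ae n f g : L2 mu f -> L2 mu g -> (\forall x \ae mu, f x = g x) ->
  \forall x \ae mu, iter n P f x = iter n P g x.
Proof.
move=> hf hg fg; elim: n => [//|n IH].
exact: markov_ae (iter_L2 n hf) (iter_L2 n hg) IH.
Qed.

Lemma markov_sub f g : L2 mu f -> L2 mu g ->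
  \forall x \ae mu, P (fun x => f x - g x) x = P f x - P g x.
Proof.
move=> hf hg; have := markov_linear (-1) hg hf; apply: filterS => x h.
rewrite (_ : (fun x => _) = (fun x => -1 * g x + f x)).
  by rewrite h mulN1r addrC.
by apply/funext => y; rewrite mulN1r addrC.
Qed.

Lemma markov_scale (a : R[i]) f : L2 mu f ->
  \forall x \ae mu, P (fun x => a * f x) x = a * P f x.
Proof.
move=> hf; have h0 : L2 mu (fun=> 0) := L2_cst mu 0.
have := markov_linear a hf h0; apply: filterS => x h.
rewrite (_ : (fun x => _) = (fun x => a * f x + 0)).
  rewrite h /markov_op /cintegral /= !Rintegral_cst// !mul0r.
  by rewrite (_ : Complex 0 0 = 0)// addr0.
by apply/funext => y; rewrite addr0.
Qed.

Lemma markov_sum (m : nat) (F : nat -> T -> R[i]) : (forall i, L2 mu (F i)) ->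
  \forall x \ae mu, P (fun x => \sum_(i < m) F i x) x = \sum_(i < m) P (F i) x.
Proof.
move=> hF; elim: m => [|m IH].
  apply: aeW => x; under [in LHS]eq_fun => y do rewrite big_ord0.
  by rewrite big_ord0 /markov_op /cintegral /= !Rintegral_cst// !mul0r.
have hS : L2 mu (fun x => \sum_(i < m) F i x).
  by apply: (@L2_sum _ _ _ mu _ (index_enum 'I_m) (fun i => F i)) => i; exact: hF.
have := markov_linear 1 hS (hF m); move: IH; apply: filterS2 => x IH h.
rewrite (_ : (fun x => _) = (fun x => 1 * \sum_(i < m) F i x + F m x)).
  by rewrite h big_ord_recr /= -IH mul1r.
by apply/funext => y; rewrite big_ord_recr /= mul1r.
Qed.

Lemma Re_iter n f : (fun x => complex.Re (iter n P f x)) =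
  iter n (kop p) (fun y => complex.Re (f y)).
Proof. by elim: n => // n IH; apply/funext => x; rewrite !iterS Re_markov IH. Qed.

Lemma Im_iter n f : (fun x => complex.Im (iter n P f x)) =
  iter n (kop p) (fun y => complex.Im (f y)).
Proof. by elim: n => // n IH; apply/funext => x; rewrite !iterS Im_markov IH. Qed.

Lemma Rint_iter_nstep n u : rL2 mu u ->
  \int[mu]_x (u x * iter n (kop p) u x) = \int[mu]_x (u x * kop (nstep p n) u x).
Proof.
move=> hu; have hit : rL2 mu (iter n (kop p) u).
  by elim: n => //= n; exact: (rL2_kop p1 p_inv).
apply: ae_Rint.
- exact: rint_meas (rL2M hu hit).
- exact: rint_meas (rL2M hu (rL2_kop (nstep_prob p n) (nstep_inv p_inv n) hu)).
- by have := kop_nstep p_inv n (rL2_int hu); apply: filterS => x ->.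
Qed.

(** A real kernel acts separately on real and imaginary parts, and [ip] has no cross terms between
    them. The complex form is thus a sum of two real ones, to which [lawler_sokal] applies with the
    kernel [nstep p n]. *)
Lemma iter_form n f : L2 mu f ->
  sqn mu f - ip mu (iter n P f) f =
  (\int[mu]_x complex.Re (f x) ^+ 2 - \int[mu]_x (complex.Re (f x) *
     kop (nstep p n) (fun y => complex.Re (f y)) x)) +
  (\int[mu]_x complex.Im (f x) ^+ 2 - \int[mu]_x (complex.Im (f x) *
     kop (nstep p n) (fun y => complex.Im (f y)) x)).
Proof.
move=> hf; have /L2P[h1 h2] := hf.
have /L2P[i1 i2] := iter_L2 n hf.
rewrite /sqn (RintD (rL2_sq h1) (rL2_sq h2)).
rewrite /ip (RintD (rL2M i1 h1) (rL2M i2 h2)).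
rewrite -!Rint_iter_nstep// -Re_iter -Im_iter.
rewrite (_ : (fun x => complex.Re (iter n P f x) * complex.Re (f x)) =
  (fun x => complex.Re (f x) * complex.Re (iter n P f x))); last first.
  by apply/funext => x; rewrite mulrC.
rewrite (_ : (fun x => complex.Im (iter n P f x) * complex.Im (f x)) =
  (fun x => complex.Im (f x) * complex.Im (iter n P f x))); last first.
  by apply/funext => x; rewrite mulrC.
by ring.
Qed.

Lemma kset_ge0 n A : measurable A -> 0 <= kset p mu n A.
Proof.
move=> mA; rewrite mulr_ge0 ?invr_ge0 ?mulr_ge0 ?fine_ge0//.
exact: integral_ge0.
Qed.

Lemma kconst_ge0 n : (exists A, proper_set mu A) -> 0 <= kconst p mu n.
Proof.
move=> [A hA]; apply: lb_le_inf; first by exists (kset p mu n A), A.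
by move=> _ [B [mB _ _] <-]; exact: kset_ge0.
Qed.

Lemma kconst_le n A : measurable A ->
  kconst p mu n * (fine (mu A) * fine (mu (~` A))) <=
  fine (\int[mu]_(x in A) nstep p n x (~` A)).
Proof.
move=> mA; have fI : 0 <= fine (\int[mu]_(x in A) nstep p n x (~` A)).
  by rewrite fine_ge0// integral_ge0.
(* Null and full sets are excluded from the infimum; for them the left-hand side vanishes. *)
have [A0|A0] := leP (mu A) 0%E.
  have -> : mu A = 0%E by apply/eqP; rewrite eq_le A0 measure_ge0.
  by rewrite mul0r mulr0.
have [A1|A1] := leP 1%E (mu A).
  have -> : fine (mu (~` A)) = 0.
    rewrite fine_measureC//; have -> : mu A = 1%E by apply/eqP; rewrite eq_le A1 probability_le1.
    by rewrite subrr.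
  by rewrite !mulr0.
have hA : proper_set mu A by split.
have [_ a0 a1] := proper_set_gt0 hA.
rewrite -ler_pdivlMr ?mulr_gt0//.
apply: ge_inf.
  by exists 0 => _ [B [mB _ _] <-]; exact: kset_ge0.
by exists A => //; rewrite /kset mulrC.
Qed.

Lemma numerical_range n f : (exists A, proper_set mu A) -> L2zero mu f ->
  kappa R * kconst p mu n ^+ 2 * sqn mu f <= 8 * (sqn mu f - ip mu (iter n P f) f).
Proof.
move=> hA /L2zeroP[hf f1 f2]; have /L2P[h1 h2] := hf.
have h u : rL2 mu u -> \int[mu]_x u x = 0 -> _ :=
  lawler_sokal (nstep_prob p n) (nstep_inv p_inv n) (kconst_ge0 n hA) (@kconst_le n).
have := h _ h1 f1; have := h _ h2 f2.
rewrite iter_form// {1}/sqn (RintD (rL2_sq h1) (rL2_sq h2)).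
set a := \int[mu]_x _; set b := \int[mu]_x _; lra.
Qed.

End markov_operator.

(** * Growth of the operator norms of iterates *)

Section nth_roots.
Context {R : realType}.
Implicit Types x y : R.

Lemma rootXn x n : 0 <= x -> (0 < n)%N -> (x `^ n%:R^-1) ^+ n = x.
Proof.
move=> x0 n0; rewrite -powR_mulrn ?powR_ge0// -powRrM mulVf ?powRr1//.
by rewrite pnatr_eq0 -lt0n.
Qed.

Lemma root_le x y n : 0 <= x -> 0 <= y -> (0 < n)%N ->
  (x `^ n%:R^-1 <= y) = (x <= y ^+ n).
Proof.
move=> x0 y0 n0; rewrite -[in RHS](rootXn x0 n0) ler_pXn2r// nnegrE//.
exact: powR_ge0.
Qed.

Lemma root_lt x y n : 0 <= x -> 0 <= y -> (0 < n)%N ->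
  (x `^ n%:R^-1 < y) = (x < y ^+ n).
Proof.
move=> x0 y0 n0; rewrite -[in RHS](rootXn x0 n0) ltr_pXn2r// nnegrE//.
exact: powR_ge0.
Qed.

Lemma geo_small (q e : R) : 0 <= q -> q < 1 -> 0 < e ->
  exists n0, forall n, (n0 <= n)%N -> q ^+ n <= e.
Proof.
move=> q0 q1 e0.
have /cvgrPdist_le /(_ _ e0) : q ^+ n @[n --> \oo] --> 0.
  by apply: cvg_expr; rewrite ger0_norm.
case=> n0 _ h; exists n0 => n /h /=.
by rewrite sub0r normrN; apply: le_trans; exact: ler_norm.
Qed.

End nth_roots.

Section submultiplicative.
Context {R : realType}.
Variable a : nat -> R.
Hypothesis a_ge0 : forall n, 0 <= a n.
Hypothesis a_le1 : forall n, a n <= 1.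
Hypothesis aM : forall m n, a (m + n)%N <= a m * a n.

(** An infimum rather than a limit, so that [growth_rate ^+ n <= a n] is immediate; [fekete] shows
    that the limit is the same number. *)
Definition growth_rate : R := inf [set a n `^ n%:R^-1 | n in [set n | (0 < n)%N]].

Lemma growth_rate_lbound : has_lbound [set a n `^ n%:R^-1 | n in [set n | (0 < n)%N]].
Proof. by exists 0 => _ [n _ <-]; exact: powR_ge0. Qed.

Lemma growth_rate_ge0 : 0 <= growth_rate.
Proof.
apply: lb_le_inf; first by exists (a 1 `^ 1%:R^-1), 1%N.
by move=> _ [n _ <-]; exact: powR_ge0.
Qed.

Lemma growth_rateX n : (0 < n)%N -> growth_rate ^+ n <= a n.
Proof.
move=> n0; have h : growth_rate <= a n `^ n%:R^-1.
  by apply: ge_inf; [exact: growth_rate_lbound|exists n].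
rewrite -[leRHS](rootXn (a_ge0 n) n0).
by rewrite ler_pXn2r ?nnegrE ?powR_ge0 ?growth_rate_ge0.
Qed.

Lemma growth_rate_le1 : growth_rate <= 1.
Proof.
have := growth_rateX (ltn0Sn 0); rewrite expr1 => h.
exact: le_trans h (a_le1 1).
Qed.

Lemma growth_rate_lt r : growth_rate < r -> exists2 m, (0 < m)%N & a m < r ^+ m.
Proof.
move=> sr; have r0 : 0 <= r by exact: le_trans growth_rate_ge0 (ltW sr).
have [|_ [m m0 <-] h] := @inf_lt _ _ r _ sr; first by exists (a 1 `^ 1%:R^-1), 1%N.
by exists m => //; rewrite -root_lt.
Qed.

Lemma submultX m q : a (q * m)%N <= a m ^+ q.
Proof.
elim: q => [|q IH]; first by rewrite expr0.
rewrite mulSn exprS; apply: (le_trans (aM _ _)).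
by rewrite ler_wpM2l.
Qed.

(** Divide [n] by [m]: every full block contributes at most [r ^+ m], the remainder at most 1. *)
Lemma submult_bound r m : 0 < r -> (0 < m)%N -> a m <= r ^+ m ->
  exists2 C, 0 < C & forall n, a n <= C * r ^+ n.
Proof.
move=> r0 m0 h; have ri : 0 < r^-1 by rewrite invr_gt0.
(* [C] dominates each [r^-1 ^+ j] with [j < m], so [C * r ^+ (n %% m)] is at least 1 whether [r]
   lies below or above 1. *)
pose C := \sum_(j < m) r^-1 ^+ j.
have Cj (j : 'I_m) : r^-1 ^+ j <= C.
  rewrite /C (bigD1 j)//= lerDl; apply: sumr_ge0 => i _.
  by rewrite exprn_ge0// ltW.
exists C; first by apply: lt_le_trans (Cj (Ordinal m0)); rewrite expr0.
move=> n; have tm : (n %% m < m)%N by rewrite ltn_mod.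
have rn : r ^+ n = r ^+ (n %/ m * m) * r ^+ (n %% m) by rewrite -exprD -divn_eq.
have : a n <= r ^+ (n %/ m * m).
  rewrite {1}(divn_eq n m); apply: (le_trans (aM _ _)).
  rewrite -[leRHS]mulr1; apply: ler_pM => //.
  apply: (le_trans (submultX _ _)).
  rewrite mulnC exprM; apply: lerXn2r => //; rewrite nnegrE//.
  by rewrite exprn_ge0// ltW.
move/le_trans; apply.
have h1 : 1 <= C * r ^+ (n %% m).
  by rewrite -ler_pdivrMr ?exprn_gt0// div1r -exprVn; exact: (Cj (Ordinal tm)).
rewrite rn mulrCA -[leLHS]mulr1 ler_wpM2l//.
by rewrite exprn_ge0// ltW.
Qed.

(** Any radius strictly between [growth_rate] and [r] gives a bound; the midpoint [r'] leaves the
    geometric factor [q = r' / r]. *)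
Lemma submult_decay r : growth_rate < r -> exists2 C, 0 < C &
  exists2 q, 0 <= q < 1 & forall n, a n <= C * (q * r) ^+ n.
Proof.
move=> sr; have s0 := growth_rate_ge0; have r0 : 0 < r by exact: le_lt_trans sr.
pose r' := (growth_rate + r) / 2.
have r'0 : 0 < r' by rewrite divr_gt0// ltr_wpDl.
have [m m0 am] : exists2 m, (0 < m)%N & a m < r' ^+ m.
  by apply: growth_rate_lt; rewrite /r'; lra.
have [C C0 h] := submult_bound r'0 m0 (ltW am).
exists C => //; exists (r' / r).
  by rewrite divr_ge0 ?ltW//= ltr_pdivrMr// /r'; lra.
by move=> n; rewrite divfK ?gt_eqF.
Qed.

Lemma submult_eventually r : growth_rate < r ->
  exists n0, forall n, (n0 <= n)%N -> a n <= r ^+ n.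
Proof.
move=> sr; have s0 := growth_rate_ge0; have r0 : 0 < r by exact: le_lt_trans sr.
have [C C0 [q /andP[q0 q1] h]] := submult_decay sr.
have Ci : 0 < C^-1 by rewrite invr_gt0.
have [n0 hn] := geo_small q0 q1 Ci; exists n0 => n /hn h2.
apply: (le_trans (h n)); rewrite exprMn mulrA -[leRHS]mul1r.
apply: ler_wpM2r; first by rewrite exprn_ge0// ltW.
by rewrite mulrC -ler_pdivlMr// div1r.
Qed.

Lemma fekete : a n `^ n%:R^-1 @[n --> \oo] --> growth_rate.
Proof.
apply/cvgrPdist_le => e e0.
have [|n0 h] := @submult_eventually (growth_rate + e); first by rewrite ltrDl.
exists n0.+1 => // n /= n1; have np : (0 < n)%N by exact: leq_trans n1.
have se : 0 <= growth_rate + e by rewrite addr_ge0 ?growth_rate_ge0// ltW.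
have u1 : a n `^ n%:R^-1 <= growth_rate + e.
  by rewrite root_le// h// ltnW.
have u2 : growth_rate <= a n `^ n%:R^-1.
  by apply: ge_inf; [exact: growth_rate_lbound|exists n].
by rewrite ler_norml; apply/andP; split; lra.
Qed.

End submultiplicative.

(** * Operator norms on mean-zero functions; a spectral gap makes [Mset] non-empty *)

Section operator_norm.
Context {R : realType} {d : measure_display} {T : measurableType d}.
Variables (mu : probability T R) (p : R.-pker T ~> T).
Hypothesis p_inv : invariant_probability p mu.
Hypothesis proper_ex : exists A, proper_set mu A.
Implicit Types f g : T -> R[i].

Local Notation P := (markov_op p).

Definition opnorm n : R :=
  sup [set L2norm mu (iter n P f) | f in [set f | L2zero mu f /\ L2norm mu f = 1]].

Definition complex_of (u : T -> R) : T -> R[i] := fun x => Complex (u x) 0.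

Lemma L2_complex_of u : rL2 mu u -> L2 mu (complex_of u).
Proof. by move=> hu; apply/L2P; split => //=; exact: rL2_cst. Qed.

Lemma sqn_complex_of u : sqn mu (complex_of u) = \int[mu]_x u x ^+ 2.
Proof.
by congr Rintegral; apply/funext => x; rewrite /nsq /= expr0n addr0.
Qed.

Lemma L2zero_complex_of u : rL2 mu u -> \int[mu]_x u x = 0 ->
  L2zero mu (complex_of u).
Proof.
move=> hu u0; apply/L2zeroP; split; [exact: L2_complex_of|exact: u0|].
by rewrite /= Rintegral_cst// mul0r.
Qed.

Lemma unit_ball_nonempty : [set f | L2zero mu f /\ L2norm mu f = 1] !=set0.
Proof.
have [A hA] := proper_ex; have [mA a0 a1] := proper_set_gt0 hA.
have N0 : \int[mu]_x centered_indicator mu A x ^+ 2 != 0.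
  by rewrite Rint_centered_indicator_sq// mulf_neq0 ?gt_eqF.
have [a aN [hv v0 v1]] := normalize_L2 (rL2_centered_indicator mu mA)
  (Rint_centered_indicator mu mA) N0.
exists (complex_of (fun x => a * centered_indicator mu A x)); split.
  exact: L2zero_complex_of.
by rewrite L2normE ?sqn_complex_of ?v1 ?sqrtr1//; exact: L2_complex_of.
Qed.

Lemma opnorm_ubound n : has_ubound
  [set L2norm mu (iter n P f) | f in [set f | L2zero mu f /\ L2norm mu f = 1]].
Proof.
by exists 1 => _ [f [[hf _] f1] <-]; rewrite -f1; exact: iter_contraction.
Qed.

Lemma opnorm_ge0 n : 0 <= opnorm n.
Proof.
have [f hf] := unit_ball_nonempty.
apply: le_trans (L2norm_ge0 mu (iter n P f)) _.
by apply: ub_le_sup; [exact: opnorm_ubound|exists f].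
Qed.

Lemma normc_real (a : R) : 0 <= a -> ComplexField.Normc.normc (Complex a 0) = a.
Proof. by move=> a0; rewrite normc_nsq /nsq /= expr0n addr0 sqrtr_sqr ger0_norm. Qed.

Lemma iter_scale n (a : R[i]) f : L2 mu f ->
  \forall x \ae mu, iter n P (fun x => a * f x) x = a * iter n P f x.
Proof.
move=> hf; elim: n => [|n IH]; first exact: aeW.
have e1 := markov_ae p_inv (iter_L2 p_inv n (L2Z a hf)) (L2Z a (iter_L2 p_inv n hf)) IH.
have e2 := markov_scale p_inv a (iter_L2 p_inv n hf).
by move: e1 e2; apply: filterS2 => x /= -> ->.
Qed.

Lemma opnorm_le n f : L2zero mu f ->
  L2norm mu (iter n P f) <= opnorm n * L2norm mu f.
Proof.
move=> hf; have h2 := L2zero_L2 hf.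
have [f0|f0] := eqVneq (L2norm mu f) 0.
  by rewrite f0 mulr0 -f0; exact: iter_contraction.
have fp : 0 < L2norm mu f by rewrite lt0r f0 L2norm_ge0.
have ip0 : 0 <= (L2norm mu f)^-1 by rewrite invr_ge0 ltW.
pose a : R[i] := Complex (L2norm mu f)^-1 0.
rewrite -ler_pdivrMr// mulrC -(normc_real ip0) -L2normZ; last exact: iter_L2.
rewrite -(ae_L2norm _ _ (iter_scale n a h2)).
- apply: ub_le_sup; first exact: opnorm_ubound.
  exists (fun x => a * f x) => //; split; first exact: L2zeroZ.
  by rewrite L2normZ// normc_real// mulVf.
- by apply: iter_L2 => //; exact: L2Z.
- by apply: L2Z; exact: iter_L2.
Qed.

Lemma opnorm_ge n c :
  (forall f, L2zero mu f -> L2norm mu (iter n P f) <= c * L2norm mu f) ->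
  opnorm n <= c.
Proof.
move=> h; apply: ge_sup.
  by have [f hf] := unit_ball_nonempty; exists (L2norm mu (iter n P f)), f.
by move=> _ [f [hf f1] <-]; have := h _ hf; rewrite f1 mulr1.
Qed.

Lemma opnorm_le1 n : opnorm n <= 1.
Proof.
by apply: opnorm_ge => f [hf _]; rewrite mul1r; exact: iter_contraction.
Qed.

Lemma opnormM m n : opnorm (m + n)%N <= opnorm m * opnorm n.
Proof.
apply: opnorm_ge => f hf; rewrite iterD -mulrA.
apply: (le_trans (opnorm_le m (iter_L2zero p_inv n hf))).
by rewrite ler_wpM2l ?opnorm_ge0//; exact: opnorm_le.
Qed.

(** Bridges the definition of the spectral radius, a supremum of roots, and the root of an operator
    norm. By monotonicity ([root_le]) each inequality is checked on elements, without continuity of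
    the root. *)
Lemma sup_root n : (0 < n)%N ->
  sup [set L2norm mu (iter n P f) `^ n%:R^-1
      | f in [set f | L2zero mu f /\ L2norm mu f = 1]] = opnorm n `^ n%:R^-1.
Proof.
move=> n0; have [f0 hf0] := unit_ball_nonempty.
have le1 f : L2zero mu f /\ L2norm mu f = 1 ->
    L2norm mu (iter n P f) `^ n%:R^-1 <= opnorm n `^ n%:R^-1.
  move=> hf; rewrite root_le ?L2norm_ge0 ?powR_ge0// rootXn ?opnorm_ge0//.
  by apply: ub_le_sup; [exact: opnorm_ubound|exists f].
have le2 f : L2zero mu f /\ L2norm mu f = 1 ->
    L2norm mu (iter n P f) `^ n%:R^-1 <=
    sup [set L2norm mu (iter n P f) `^ n%:R^-1
      | f in [set f | L2zero mu f /\ L2norm mu f = 1]].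
  move=> hf; apply: ub_le_sup; last by exists f.
  by exists (opnorm n `^ n%:R^-1) => _ [g hg <-]; exact: le1.
apply/eqP; rewrite eq_le; apply/andP; split.
  apply: ge_sup; first by exists (L2norm mu (iter n P f0) `^ n%:R^-1), f0.
  by move=> _ [g hg <-]; exact: le1.
rewrite root_le ?opnorm_ge0//; last exact: le_trans (powR_ge0 _ _) (le2 _ hf0).
apply: ge_sup; first by exists (L2norm mu (iter n P f0)), f0.
move=> _ [g hg <-]; rewrite -root_le ?L2norm_ge0//; first exact: le2.
exact: le_trans (powR_ge0 _ _) (le2 _ hf0).
Qed.

Lemma spectral_radius0E : spectral_radius0 mu p = growth_rate opnorm.
Proof.
apply/cvg_lim => //.
apply: cvg_trans (fekete opnorm_ge0 opnorm_le1 opnormM).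
(* The term [n = 0], with exponent [0^-1 = 0], is left aside: the limit only sees [n >= 1]. *)
by apply: near_eq_cvg; exists 1%N => // n /= n0; rewrite sup_root.
Qed.

Lemma iter_sub n f g : L2 mu f -> L2 mu g ->
  \forall x \ae mu, iter n P (fun x => f x - g x) x = iter n P f x - iter n P g x.
Proof.
move=> hf hg; have := iter_linear p_inv n (-1) hg hf; apply: filterS => x h.
rewrite (_ : (fun x => _) = (fun x => -1 * g x + f x)).
  by rewrite h mulN1r addrC.
by apply/funext => y; rewrite mulN1r addrC.
Qed.

Lemma L2norm0 : L2norm mu (fun=> 0) = 0.
Proof.
rewrite L2normE; last exact: L2_cst.
by rewrite /sqn Rintegral_cst// /nsq /= expr0n /= addr0 mul0r sqrtr0.
Qed.

(** Telescoping: [f - P^(j n) f] is the sum of the [P^(i n) (f - P^n f)] for [i < j], and [P^(i n)]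
    does not increase norms. *)
Lemma iter_drift n j f : L2 mu f ->
  L2norm mu (fun x => f x - iter (j * n) P f x) <=
  j%:R * L2norm mu (fun x => f x - iter n P f x).
Proof.
move=> hf; elim: j => [|j IH].
  rewrite mul0r mul0n /= (ae_L2norm (g := fun=> 0)).
  - by rewrite L2norm0.
  - exact: L2B.
  - exact: L2_cst.
  - by apply: aeW => x; rewrite subrr.
have h1 := iter_L2 p_inv (j * n) hf; have h2 := iter_L2 p_inv n hf.
have h3 := L2B hf h2; have h4 := L2B hf h1.
have h5 := iter_L2 p_inv (j * n) h3.
rewrite (ae_L2norm (g := fun x => (f x - iter (j * n) P f x) +
  iter (j * n) P (fun x => f x - iter n P f x) x)).
- apply: (le_trans (L2norm_triangle h4 h5)).
  rewrite -natr1 mulrDl mul1r; apply: lerD => //.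
  exact: iter_contraction.
- by apply: L2B => //; exact: iter_L2.
- exact: L2D.
have := iter_sub (j * n) hf h2; apply: filterS => x ->.
by rewrite -iterD mulSn addnC addrA addrNK.
Qed.

Lemma kset_form n A : proper_set mu A ->
  kset p mu n A * sqn mu (complex_of (centered_indicator mu A)) =
  sqn mu (complex_of (centered_indicator mu A)) -
  ip mu (iter n P (complex_of (centered_indicator mu A)))
        (complex_of (centered_indicator mu A)).
Proof.
move=> hA; have [mA a0 a1] := proper_set_gt0 hA.
have hc := rL2_centered_indicator mu mA.
rewrite iter_form//; last exact: L2_complex_of.
rewrite sqn_complex_of Rint_centered_indicator_sq//.
rewrite [kset _ _ _ _ * _]mulrC /kset mulVKf; last by rewrite mulf_neq0 ?gt_eqF.
rewrite (integral_flow (nstep_prob p n) (nstep_inv p_inv n) mA).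
rewrite -Rint_centered_indicator_sq// -[LHS]addr0; congr (_ + _).
rewrite /= expr0n /= Rintegral_cst// mul0r sub0r.
rewrite (_ : (fun x : T => _) = (fun=> 0)); last by apply/funext => x; rewrite mul0r.
by rewrite Rintegral_cst// mul0r oppr0.
Qed.

(* A set with small [kset] has an indicator that [P^n] hardly moves, hence that
   [P^(j n)] cannot contract. *)
Lemma kset_lower n j A : proper_set mu A -> (0 < j)%N ->
  opnorm (j * n) <= 2^-1 -> (8 * j%:R ^+ 2)^-1 <= kset p mu n A.
Proof.
move=> hA j0 hj; have [mA a0 a1] := proper_set_gt0 hA.
have hc := rL2_centered_indicator mu mA.
have kF := kset_form n hA.
set F := complex_of _ in kF.
have hF : L2zero mu F.
  by apply: L2zero_complex_of => //; exact: Rint_centered_indicator.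
have hF2 := L2zero_L2 hF; have hP := iter_L2 p_inv n hF2.
have N0 : 0 < sqn mu F by rewrite sqn_complex_of Rint_centered_indicator_sq// mulr_gt0.
have nF : 0 < L2norm mu F by rewrite L2normE// sqrtr_gt0.
(* Expanding the square and using that [P^n] is a contraction leaves twice the Dirichlet form, which
   [kset_form] evaluates. *)
have drift : sqn mu (fun x => F x - iter n P F x) <= 2 * (kset p mu n A * sqn mu F).
  have e1 : sqn mu (fun x => F x - iter n P F x) =
      sqn mu F - 2 * ip mu (iter n P F) F + sqn mu (iter n P F).
    rewrite (_ : (fun x => _) = (fun x => -1 * iter n P F x + F x)); last first.
      by apply/funext => x; rewrite mulN1r addrC.
    rewrite sqnD//; last exact: L2Z.
    rewrite sqnZ// /ip (_ : (fun x => _) = (fun x => -1 * dotc (iter n P F x) (F x))).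
      rewrite RintZ; last exact: rint_dotc.
      by rewrite (_ : nsq (-1) = 1); [ring|rewrite /nsq /=; ring].
    by apply/funext => x; rewrite /dotc creM cimM /=; ring.
  have e2 : sqn mu (iter n P F) <= sqn mu F.
    by rewrite -!L2norm_sq// ler_pXn2r ?nnegrE ?L2norm_ge0//; exact: iter_contraction.
  rewrite e1 kF; lra.
(* As [P^(j n)] at least halves the norm of [F], the drift over [j] blocks is at least half of that
   norm. Squared and combined with [drift], this gives [1 / 4 <= 2 * j^2 * kset], whence the 8. *)
have big : 2^-1 * L2norm mu F <= j%:R * L2norm mu (fun x => F x - iter n P F x).
  apply: le_trans (iter_drift n j hF2).
  have hjn := iter_L2 p_inv (j * n) hF2.
  have t : L2norm mu F <= L2norm mu (fun x => F x - iter (j * n) P F x) +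
      L2norm mu (iter (j * n) P F).
    apply: le_trans (L2norm_triangle (L2B hF2 hjn) hjn).
    by rewrite le_eqVlt; apply/orP; left; apply/eqP; congr L2norm; apply/funext => x; rewrite subrK.
  have u : L2norm mu (iter (j * n) P F) <= 2^-1 * L2norm mu F.
    by apply: (le_trans (opnorm_le (j * n) hF)); rewrite ler_wpM2r// L2norm_ge0.
  lra.
have : (2^-1 * L2norm mu F) ^+ 2 <=
    (j%:R * L2norm mu (fun x => F x - iter n P F x)) ^+ 2.
  by rewrite ler_pXn2r// nnegrE ?mulr_ge0 ?L2norm_ge0// invr_ge0.
rewrite !exprMn !L2norm_sq//; last exact: L2B.
have jp : 0 < j%:R ^+ 2 :> R by rewrite exprn_gt0// ltr0n.
move=> h; have h2 := ler_wpM2l (ltW jp) drift.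
have J8 : 0 < 8 * j%:R ^+ 2 :> R by apply: mulr_gt0.
rewrite -div1r ler_pdivrMr// -(ler_pM2r N0); lra.
Qed.

(** A single [j] makes [opnorm (j * n)] at most one half for all [n >= 1] at once, so [kset_lower]
    bounds every [k_n] from below by the same number, whatever horizon that number determines. *)
Lemma gap_Mset : L2_spectral_gap mu p -> Mset p mu !=set0.
Proof.
rewrite /L2_spectral_gap spectral_radius0E => gap.
have s0 := growth_rate_ge0 opnorm.
pose r := (growth_rate opnorm + 1) / 2.
have r0 : 0 <= r by rewrite /r; lra.
have r1 : r < 1 by rewrite /r; lra.
have [|n0 h0] := submult_eventually opnorm_ge0 opnorm_le1 opnormM (r := r); first by rewrite /r; lra.
have h2 : 0 < 2^-1 :> R by [].
have [n1 h1] := geo_small r0 r1 h2.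
pose j := (n0 + n1).+1.
have small n : (0 < n)%N -> opnorm (j * n) <= 2^-1.
  move=> np; have jn : (j <= j * n)%N by rewrite leq_pmulr.
  apply: (le_trans (h0 _ _)); first by apply: leq_trans jn; rewrite /j leqW// leq_addr.
  by apply: h1; apply: leq_trans jn; rewrite /j leqW// leq_addl.
have jp : 0 < j%:R :> R by rewrite ltr0n.
have e0 : 0 < (8 * j%:R ^+ 2)^-1 :> R by rewrite invr_gt0 mulr_gt0// exprn_gt0.
(* Halved because [Mset] asks for a strict inequality. *)
exists ((8 * j%:R ^+ 2)^-1 / 2); split; first by rewrite divr_gt0.
move=> n np _; apply: (@lt_le_trans _ _ (8 * j%:R ^+ 2)^-1); first by lra.
apply: lb_le_inf.
  by have [A hA] := proper_ex; exists (kset p mu n A), A.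
by move=> _ [A hA <-]; apply: kset_lower => //; exact: small.
Qed.

End operator_norm.

(** * Lower bounds for the resolvent on circles *)

Section circle.
Context {R : realType}.

Definition expi (t : R) : R[i] := Complex (cos t) (sin t).

Lemma expiX t n : expi t ^+ n = expi (t *+ n).
Proof.
elim: n => [|n IH]; first by rewrite expr0 mulr0n /expi cos0 sin0.
rewrite exprS IH mulrS /expi cosD sinD; apply: complex_eq; rewrite ?creM ?cimM //=.
by rewrite addrC.
Qed.

(** The angle is taken nonnegative because [dirichlet] works with [truncn]; in the lower half-plane
    this means adding a full turn. *)
Lemma expi_surj (z : R[i]) : nsq z = 1 -> exists2 t, 0 <= t & z = expi t.
Proof.
case: z => a b; rewrite /nsq /= => ab.
have a1 : -1 <= a <= 1 by apply/andP; split; nra.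
have aK : cos (acos a) = a by rewrite acosK// in_itv.
have sE : sin (acos a) ^+ 2 = b ^+ 2 by rewrite sin2cos2 aK -ab; ring.
have s0 : 0 <= sin (acos a) by apply: sin_ge0_pi; rewrite acos_ge0// acos_lepi.
have [b0|b0] := leP 0 b.
  exists (acos a); first exact: acos_ge0.
  rewrite /expi aK; congr Complex; apply/eqP.
  by rewrite -(eqrXn2 (n := 2))// sE.
exists (- acos a + pi *+ 2).
  have := acos_lepi a1; have := @pi_ge0 R; rewrite mulr2n; lra.
rewrite /expi cosD2pi sinD2pi cosN sinN aK; congr Complex.
apply/eqP; rewrite -eqr_oppLR; apply/eqP/esym; apply/eqP.
by rewrite -(eqrXn2 (n := 2))// ?oppr_ge0 ?ltW// sqrrN sE.
Qed.

(** Pigeonhole: the fractional parts of [x *+ i] for [i <= N] are [N + 1] numbers distributed over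
    [N] intervals of length [1 / N]; the difference of two indices that share an interval is the
    required [n]. *)
Lemma dirichlet (x : R) (N : nat) : 0 <= x -> (0 < N)%N ->
  exists n k : nat, (0 < n <= N)%N /\ `|x *+ n - k%:R| <= N%:R^-1.
Proof.
move=> x0 N0.
pose fr (i : nat) : R := x *+ i - (Num.truncn (x *+ i))%:R.
have xi i : 0 <= x *+ i by rewrite mulrn_wge0.
have fr01 i : 0 <= fr i < 1.
  have /andP[h1 h2] := truncn_itv (xi i); rewrite /fr subr_ge0 h1 ltrBlDl.
  by rewrite natr1.
have Np : 0 < N%:R :> R by rewrite ltr0n.
have bin_lt i : (Num.truncn (N%:R * fr i) < N)%N.
  have /andP[f0 f1] := fr01 i.
  have /andP[h1 _] := truncn_itv (mulr_ge0 (ltW Np) f0).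
  by rewrite -(ltr_nat R); apply: (le_lt_trans h1); rewrite gtr_pMr.
pose bin (i : 'I_N.+1) : 'I_N := Ordinal (bin_lt i).
have [i [j [ij eij]]] : exists i j : 'I_N.+1, (i < j)%N /\ bin i = bin j.
  have /injectivePn[i [j ij eij]] : ~~ injectiveb bin.
    by apply/negP => /injectiveP /leq_card; rewrite !card_ord ltnn.
  have [h|h|h] := ltngtP i j; [by exists i, j|by exists j, i|].
  by case/eqP: ij; apply: val_inj.
exists (j - i)%N, (Num.truncn (x *+ j) - Num.truncn (x *+ i))%N; split.
  by rewrite subn_gt0 ij/= (leq_trans (leq_subr _ _))// -ltnS.
have le_tr : (Num.truncn (x *+ i) <= Num.truncn (x *+ j))%N.
  by apply: le_truncn; rewrite -(mulr_natl x i) -(mulr_natl x j) ler_wpM2r// ler_nat ltnW.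
rewrite natrB// mulrnBr ?(ltnW ij)//.
have -> : x *+ j - x *+ i - ((Num.truncn (x *+ j))%:R - (Num.truncn (x *+ i))%:R) =
  fr j - fr i by rewrite /fr; ring.
have /andP[fi0 _] := fr01 i; have /andP[fj0 _] := fr01 j.
have /andP[i1 i2] := truncn_itv (mulr_ge0 (ltW Np) fi0).
have /andP[j1 j2] := truncn_itv (mulr_ge0 (ltW Np) fj0).
have tE : Num.truncn (N%:R * fr i) = Num.truncn (N%:R * fr j).
  by have := congr1 val eij.
rewrite tE -natr1 in i1 i2; rewrite -natr1 in j2.
rewrite -(ler_pM2l Np) mulfV ?gt_eqF// -[X in X * _](gtr0_norm Np) -normrM.
rewrite mulrBr ler_norml; apply/andP; split; lra.
Qed.

(** Dirichlet's theorem, for the angle of [z] measured in full turns, gives a power whose angle is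
    within [2 * pi / N <= a] of a multiple of [2 * pi]; the cosine decreases on [[0, pi]]. *)
Lemma dirichlet_arc (z : R[i]) (r a : R) (N : nat) : 0 < r -> nsq z = r ^+ 2 ->
  0 < a -> a <= pi -> (0 < N)%N -> 2 * pi <= N%:R * a ->
  exists2 n, (0 < n <= N)%N & r ^+ n * cos a <= complex.Re (z ^+ n).
Proof.
move=> r0 zr a0 api N0 hN.
have rn : r != 0 by rewrite gt_eqF.
have [|t t0 zE] := @expi_surj (Complex r^-1 0 * z).
  by rewrite nsqM zr /nsq /= expr0n addr0 -exprMn mulVf// expr1n.
have {}zE : z = Complex r 0 * expi t.
  have rr : Complex r 0 * Complex r^-1 0 = 1 :> R[i].
    by apply: complex_eq; rewrite ?creM ?cimM /= ?mulfV// ?mulr0 ?mul0r ?subr0 ?addr0.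
  by rewrite -zE mulrA rr mul1r.
have pi0 := @pi_gt0 R.
have p2 : 0 < 2 * pi :> R by rewrite mulr_gt0.
have [|n [k [nN hk]]] := @dirichlet (t / (2 * pi)) N _ N0.
  by rewrite divr_ge0// ltW.
exists n => //.
have -> : z ^+ n = Complex (r ^+ n) 0 * expi (t *+ n).
  rewrite zE exprMn expiX; congr (_ * _).
  elim: (n) => [|j IH]; first by rewrite !expr0.
  by apply: complex_eq; rewrite exprS IH exprS ?creM ?cimM /= ?mulr0 ?mul0r ?subr0 ?addr0.
rewrite creM /= mul0r subr0 ler_pM2l ?exprn_gt0//.
(* [b] is the angle of [z ^+ n] reduced modulo [2 * pi] into [[- a, a]]. *)
pose b := t *+ n - (pi *+ 2) *+ k.
have -> : cos (t *+ n) = cos b.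
  by rewrite -(periodicn (@cosD2pi R) k b) /b subrK.
have bE : b = (2 * pi) * (t / (2 * pi) *+ n - k%:R).
  rewrite /b mulrBr -mulrnAr mulrCA mulrnAr mulfV ?gt_eqF// mulr_natr -mulr_natl.
  by rewrite -mulr_natr -[in LHS](mulr_natr (pi *+ 2)) -(mulr_natl pi 2); ring.
have Np : 0 < N%:R :> R by rewrite ltr0n.
have ba : `|b| <= a.
  rewrite bE normrM gtr0_norm//; apply: (@le_trans _ _ (2 * pi * N%:R^-1)).
    by rewrite ler_pM2l.
  by rewrite ler_pdivrMr// [a * _]mulrC.
rewrite -(cos_norm b).
have [->//|ne] := eqVneq `|b| a.
apply: ltW; rewrite ltr_cos ?in_itv/= ?normr_ge0 ?(ltW a0) ?(le_trans ba)//.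
by rewrite lt_neqAle ne.
Qed.

End circle.

Section resolvent_lower_bound.
Context {R : realType} {d : measure_display} {T : measurableType d}.
Variables (mu : probability T R) (p : R.-pker T ~> T).
Hypothesis p_inv : invariant_probability p mu.
Hypothesis proper_ex : exists A, proper_set mu A.
Implicit Types f g : T -> R[i].

Local Notation P := (markov_op p).

Lemma ip_geN n f : L2 mu f -> - sqn mu f <= ip mu (iter n P f) f.
Proof.
move=> hf; have hP := iter_L2 p_inv n hf.
have := sqn_ge0 mu (fun x => iter n P f x + f x); rewrite sqnD//.
have : sqn mu (iter n P f) <= sqn mu f.
  by rewrite -!L2norm_sq// ler_pXn2r ?nnegrE ?L2norm_ge0//; exact: iter_contraction.
lra.
Qed.

(** For a mean-zero unit vector, [numerical_range] at [n = 1] and contractivity give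
    [kappa * k_1^2 <= 16]; since [e < k_1], the rate is strictly positive. Its arccosine is then a
    genuine acute angle. *)
Lemma rate_bounds e : Mset p mu e -> 0 < rate e < 1.
Proof.
move=> [e0 he]; have k0 := kappa_gt0 proper_ex.
have ek := he 1%N isT isT; have e2 : 0 < e ^+ 2 by rewrite exprn_gt0.
have [f [hf f1]] := unit_ball_nonempty proper_ex; have hf2 := L2zero_L2 hf.
have := numerical_range p_inv 1 proper_ex hf; have := ip_geN 1 hf2.
rewrite -L2norm_sq// f1 expr1n => u1 u2.
have lt2 : kappa R * e ^+ 2 < kappa R * kconst p mu 1 ^+ 2.
  by rewrite ltr_pM2l// ltrXn2r// ltW.
rewrite /rate; apply/andP; split; last by rewrite ltrBlDr ltrDl mulr_gt0// divr_gt0.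
lra.
Qed.

(** The successor in [horizon] makes up for the truncation, so that [horizon e] arcs of angle
    [acos (rate e)] cover the circle. *)
Lemma horizon_spec e : Mset p mu e -> 2 * pi <= (horizon e)%:R * acos (rate e).
Proof.
move=> /rate_bounds/andP[q0 q1].
have a0 : 0 < acos (rate e) by apply: acos_gt0; rewrite q1 andbT; lra.
rewrite -ler_pdivrMr//; apply: ltW; rewrite /horizon.
exact: truncnS_gt.
Qed.

Lemma normcX (z : R[i]) (r : R) : 0 <= r -> nsq z = r ^+ 2 ->
  forall n, ComplexField.Normc.normc (z ^+ n) = r ^+ n.
Proof.
by move=> r0 zr n; rewrite normc_nsq nsqX zr exprAC sqrtr_sqr ger0_norm// exprn_ge0.
Qed.

(** Induction on [z^(n+1) g - P^(n+1) g = P (z^n g - P^n g) + z^n (z g - P g)]. The crude bound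
    [|z| <= 2] makes the constant independent of [z]. *)
Lemma approximate_power (z : R[i]) (r : R) n g : 0 <= r <= 2 -> nsq z = r ^+ 2 ->
  L2 mu g ->
  L2norm mu (fun x => z ^+ n * g x - iter n P g x) <=
  2 ^+ n * L2norm mu (fun x => z * g x - P g x).
Proof.
move=> /andP[r0 r2] zr hg; set D := L2norm mu (fun x => z * g x - P g x).
have hD : 0 <= D := L2norm_ge0 _ _.
(* The constant that the induction propagates is the geometric sum of the [2 ^+ i] for [i < n]. *)
suff : L2norm mu (fun x => z ^+ n * g x - iter n P g x) <= (2 ^+ n - 1) * D.
  by move/le_trans; apply; rewrite ler_wpM2r// gerBl.
elim: n => [|n IH].
  rewrite expr0 subrr mul0r (_ : (fun x => _) = (fun=> 0)) ?L2norm0//.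
  by apply/funext => x; rewrite mul1r subrr.
have hn := iter_L2 p_inv n hg; have hP := markov_L2 p_inv hg.
have h1 := L2B (L2Z (z ^+ n) hg) hn; have h2 := L2B (L2Z z hg) hP.
rewrite (ae_L2norm (g := fun x => P (fun x => z ^+ n * g x - iter n P g x) x +
   z ^+ n * (z * g x - P g x))).
- apply: (le_trans (L2norm_triangle (markov_L2 p_inv h1) (L2Z (z ^+ n) h2))).
  rewrite L2normZ// (normcX r0 zr) -/D.
  have := markov_contraction p_inv h1.
  have rn : r ^+ n <= 2 ^+ n by apply: lerXn2r; rewrite ?nnegrE.
  have := ler_wpM2r hD rn; rewrite [2 ^+ n.+1]exprS; lra.
- by apply: L2B; [exact: L2Z|exact: (iter_L2 p_inv n.+1 hg)].
- by apply: L2D; [exact: markov_L2|exact: L2Z].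
have e1 := markov_sub p_inv (L2Z (z ^+ n) hg) hn.
have e2 := markov_scale p_inv (z ^+ n) hg.
by move: e1 e2; apply: filterS2 => x /= -> ->; rewrite exprS; ring.
Qed.

(* Dirichlet's theorem supplies [n <= N] such that [z ^+ n] is so close to the
   positive half-line that it leaves the numerical range of [P^n]. *)
Lemma resolvent_lower_aux (e q : R) (N : nat) (z : R[i]) (r : R) g :
  0 <= e -> 0 < q < 1 -> kappa R * e ^+ 2 = 16 * (1 - q) -> (0 < N)%N ->
  2 * pi <= N%:R * acos q ->
  (forall n, (1 <= n)%N -> (n <= N)%N -> e < kconst p mu n) ->
  0 < r <= 2 -> nsq z = r ^+ 2 -> q <= r ^+ N -> L2zero mu g ->
  (1 - q) ^+ 2 / 2 ^+ N * L2norm mu g <= L2norm mu (fun x => P g x - z * g x).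
Proof.
move=> e0 /andP[q0 q1] qe N0 hN hk /andP[r0 r2] zr qr hg; have hg2 := L2zero_L2 hg.
have q1' : -1 <= q <= 1 by apply/andP; split; lra.
have [||||n /andP[n0 nN] hn] := dirichlet_arc r0 zr (a := acos q) (N := N).
- by apply: acos_gt0; rewrite q1 andbT; lra.
- exact: acos_lepi.
- exact: N0.
- exact: hN.
rewrite acosK ?in_itv// in hn.
(* For [r >= 1] the power is at least [1 > q]; for [r < 1] it is at least [r ^+ N]. *)
have rnq : q <= r ^+ n.
  have [r1|r1] := leP 1 r; first by apply: le_trans (ltW q1) _; exact: exprn_ege1.
  by apply: (le_trans qr); apply: ler_wiXn2l => //; exact: ltW.
have hP := iter_L2 p_inv n hg2; have hz := L2Z (z ^+ n) hg2.
(* The gap between the two bounds is [q * q - (2 * q - 1) = (1 - q) ^+ 2]. *)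
have key : (1 - q) ^+ 2 * sqn mu g <= ip mu (fun x => z ^+ n * g x - iter n P g x) g.
  have -> : ip mu (fun x => z ^+ n * g x - iter n P g x) g =
      complex.Re (z ^+ n) * sqn mu g - ip mu (iter n P g) g.
    rewrite /ip /sqn -RintZ; last exact: rint_nsq.
    rewrite -RintB; [|exact/rintZ/rint_nsq|exact: rint_dotc].
    by congr Rintegral; apply/funext => x; rewrite dotcBl dotcMl.
  have := numerical_range p_inv n proper_ex hg.
  have ek : e ^+ 2 <= kconst p mu n ^+ 2.
    by apply: lerXn2r; rewrite ?nnegrE ?kconst_ge0//; apply: ltW => //; exact: hk.
  have k0 := kappa_gt0 proper_ex.
  have S0 := sqn_ge0 mu g.
  have ek2 := ler_wpM2r S0 (ler_wpM2l (ltW k0) ek).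
  have rq : q * q <= complex.Re (z ^+ n).
    by apply: le_trans hn; rewrite ler_wpM2r// ltW.
  have := ler_wpM2r S0 rq; rewrite qe in ek2; nra.
have cs := cauchy_schwarz (L2B hz hP) hg2.
have ap := approximate_power n (r := r) _ zr hg2.
have := ap _; rewrite r2 (ltW r0) => /(_ isT) {}ap.
have two : 2 ^+ n <= 2 ^+ N :> R by rewrite ler_eXn2l// ltr1n.
have Dsym : L2norm mu (fun x => z * g x - P g x) = L2norm mu (fun x => P g x - z * g x).
  rewrite (_ : (fun x => z * g x - P g x) = (fun x => -1 * (P g x - z * g x))).
    rewrite L2normZ; last by apply: L2B; [exact: markov_L2|exact: L2Z].
    by rewrite normc_nsq /nsq /= sqrrN expr1n oppr0 expr0n addr0 sqrtr1 mul1r.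
  by apply/funext => x; ring.
rewrite Dsym in ap; set D := L2norm mu (fun x => P g x - z * g x) in ap *.
have D0 : 0 <= D := L2norm_ge0 _ _.
have [g0|g0] := eqVneq (L2norm mu g) 0; first by rewrite g0 mulr0.
have gp : 0 < L2norm mu g by rewrite lt0r g0 L2norm_ge0.
have : (1 - q) ^+ 2 * L2norm mu g <= 2 ^+ N * D.
  apply: (@le_trans _ _ (2 ^+ n * D)); last by rewrite ler_wpM2r.
  rewrite -(ler_pM2r gp) -mulrA -expr2 L2norm_sq//.
  apply: (le_trans key); apply: (le_trans cs).
  by rewrite ler_wpM2r// L2norm_ge0.
have t0 : 0 < 2 ^+ N :> R by rewrite exprn_gt0.
by move=> h; rewrite [leLHS]mulrAC ler_pdivrMr// [D * _]mulrC.
Qed.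

Lemma resolvent_lower e (z : R[i]) (r : R) g : Mset p mu e ->
  0 < r <= 2 -> nsq z = r ^+ 2 -> rate e <= r ^+ horizon e -> L2zero mu g ->
  (1 - rate e) ^+ 2 / 2 ^+ horizon e * L2norm mu g <=
  L2norm mu (fun x => P g x - z * g x).
Proof.
move=> he hr zr qr hg; have [e0 hk] := he.
apply: (@resolvent_lower_aux e _ _ z r) => //.
- exact: ltW.
- exact: rate_bounds.
- by rewrite /rate; field.
- exact: horizon_spec.
Qed.

End resolvent_lower_bound.

(** * Square summability of orbits *)

Lemma prim_root_exists (C : numClosedFieldType) m : (0 < m)%N ->
  exists w : C, m.-primitive_root w.
Proof.
move=> m0; have [r rE] := closed_field_poly_normal ('X^m - 1 : {poly C}).
rewrite (monicP _) ?monicXnsubC// scale1r in rE.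
have r1 : all m.-unity_root r by apply/allP => z; rewrite -root_prod_XsubC -rE.
have ru : uniq r.
  rewrite -separable_prod_XsubC -rE; apply: separable_Xn_sub_1.
  by rewrite pnatr_eq0 -lt0n.
have rs : (m <= size r)%N.
  by rewrite -ltnS -(size_prod_XsubC r id) -rE size_XnsubC.
by have /hasP[w _ hw] := has_prim_root m0 r1 ru rs; exists w.
Qed.

Lemma parseval (C : numClosedFieldType) m (w : C) (u : nat -> C) :
  m.-primitive_root w ->
  \sum_(k < m) `|\sum_(i < m) (w ^+ k) ^+ i * u i| ^+ 2 =
  m%:R * \sum_(i < m) `|u i| ^+ 2.
Proof.
move=> hw; have m0 := prim_order_gt0 hw.
have w0 : w != 0.
  apply/eqP => w0; have := prim_expr_order hw; rewrite w0 expr0n gtn_eqF//.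
  by move=> /eqP; rewrite eq_sym oner_eq0.
have wn : `|w| = 1.
  apply/eqP; rewrite -(pexpr_eq1 m0)// -normrX (prim_expr_order hw) normr1.
  exact: eqxx.
have wc : w^* = w^-1 by rewrite invC_norm wn expr1n invr1 mul1r.
(* Orthogonality of characters: with [x = w ^+ i / w ^+ j], the sum times [x - 1] is
   [x^m - 1 = 0]. *)
have orth (i j : 'I_m) : \sum_(k < m) (w ^+ i / w ^+ j) ^+ k = (if i == j then m%:R else 0).
  have [->|ij] := eqVneq i j.
    rewrite divff ?expf_neq0//.
    by under eq_bigr do rewrite expr1n; rewrite sumr_const card_ord.
  have x1 : w ^+ i / w ^+ j - 1 != 0.
    rewrite subr_eq0; apply/eqP => h.
    have : w ^+ i = w ^+ j by rewrite -[RHS]mul1r -h divfK ?expf_neq0.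
    move/eqP; rewrite (eq_prim_root_expr hw) !modn_small// => /eqP/val_inj e.
    by rewrite e eqxx in ij.
  apply: (mulfI x1); rewrite mulr0 -subrX1 expr_div_n -!exprM ![(_ * m)%N]mulnC !exprM.
  by rewrite (prim_expr_order hw) !expr1n divr1 subrr.
transitivity (\sum_(i < m) \sum_(j < m) (u i * (u j)^*) *
    \sum_(k < m) (w ^+ i / w ^+ j) ^+ k).
  under [RHS]eq_bigr => i _ do under eq_bigr => j _ do rewrite mulr_sumr.
  under [RHS]eq_bigr => i _ do rewrite exchange_big /=.
  rewrite exchange_big /=; apply: eq_bigr => k _.
  rewrite normCK rmorph_sum mulr_suml; apply: eq_bigr => i _.
  rewrite mulr_sumr; apply: eq_bigr => j _.
  rewrite rmorphM !rmorphXn /= wc expr_div_n -!exprM [(k * i)%N]mulnC [(k * j)%N]mulnC.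
  by rewrite -exprVn; ring.
rewrite mulr_sumr; apply: eq_bigr => i _.
rewrite (bigD1 i)//= orth eqxx big1 ?addr0 => [|j ji].
  by rewrite normCK mulrC.
by rewrite orth eq_sym (negbTE ji) mulr0.
Qed.

Lemma Re_sum (R : realType) (I : Type) (s : seq I) (F : I -> R[i]) :
  complex.Re (\sum_(i <- s) F i) = \sum_(i <- s) complex.Re (F i).
Proof. exact: (big_morph _ (@creD R) erefl). Qed.

Lemma complex_nat (R : realType) n : n%:R = Complex n%:R 0 :> R[i].
Proof.
elim: n => [//|n IH]; rewrite -natr1 IH -[in RHS]natr1.
by apply: complex_eq; rewrite ?creD ?cimD /= ?addr0.
Qed.

Lemma parseval_nsq (R : realType) m (w : R[i]) (u : nat -> R[i]) :
  m.-primitive_root w ->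
  \sum_(k < m) nsq (\sum_(i < m) (w ^+ k) ^+ i * u i) =
  m%:R * \sum_(i < m) nsq (u i).
Proof.
move=> hw; have := parseval u hw.
under eq_bigr => k _ do rewrite -nsq_norm.
under [in RHS]eq_bigr => k _ do rewrite -nsq_norm.
move=> /(congr1 (@complex.Re R)).
by rewrite complex_nat creM !Re_sum /= mul0r subr0.
Qed.

Section real_sums.
Context {R : realType} {d : measure_display} {T : measurableType d}.
Variable m : {measure set T -> \bar R}.

Lemma rint_sum (I : Type) (s : seq I) (F : I -> T -> R) :
  rint m (fun=> 0) -> (forall i, rint m (F i)) ->
  rint m (fun x => \sum_(i <- s) F i x) /\
  \int[m]_x \sum_(i <- s) F i x = \sum_(i <- s) \int[m]_x F i x.
Proof.
move=> h0 hF; elim: s => [|i s [IH1 IH2]].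
  rewrite (_ : (fun x => \sum_(i <- [::]) F i x) = fun=> 0).
    by split => //; rewrite big_nil Rintegral_cst// mul0r.
  by apply/funext => x; rewrite big_nil.
rewrite (_ : (fun x => \sum_(j <- i :: s) F j x) =
  (fun x => F i x + \sum_(j <- s) F j x)).
  by split; [exact: rintD|rewrite RintD// big_cons IH2].
by apply/funext => x; rewrite big_cons.
Qed.

End real_sums.

(** * From lower bounds on a circle to decay of the operator norms *)

Section spectral_radius_bound.
Context {R : realType} {d : measure_display} {T : measurableType d}.
Variables (mu : probability T R) (p : R.-pker T ~> T).
Hypothesis p_inv : invariant_probability p mu.
Hypothesis proper_ex : exists A, proper_set mu A.
Implicit Types f g : T -> R[i].

Local Notation P := (markov_op p).

Section lower_bounded.
Variables (r eta : R).
Hypothesis r_gt0 : 0 < r.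
Hypothesis eta_gt0 : 0 < eta.
Hypothesis lower : forall z g, nsq z = r ^+ 2 -> L2zero mu g ->
  eta * L2norm mu g <= L2norm mu (fun x => P g x - z * g x).

(** With [c = z^-1], dividing by [z] gives the truncated Neumann series of the resolvent of [P] at
    [z]. *)
Definition wave (c : R[i]) (m : nat) f : T -> R[i] :=
  fun x => \sum_(i < m) c ^+ i * iter i P f x.

Lemma L2zero_wave c m f : L2zero mu f -> L2zero mu (wave c m f).
Proof.
move=> hf; apply: (@L2zero_sum _ _ _ mu _ (index_enum 'I_m)
  (fun i x => c ^+ i * iter i P f x)) => i.
by apply: L2zeroZ; exact: iter_L2zero.
Qed.

(** [P - z] telescopes on a wave, leaving only the two boundary terms. *)
Lemma wave_defect (c z : R[i]) m f : c * z = 1 -> L2zero mu f ->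
  \forall x \ae mu, P (wave c m f) x - z * wave c m f x =
    z * (c ^+ m * iter m P f x - f x).
Proof.
move=> cz hf; have hf2 := L2zero_L2 hf.
have hF i : L2 mu (fun x => c ^+ i * iter i P f x) by apply: L2Z; exact: iter_L2.
have e1 := markov_sum p_inv m hF.
have e2 : \forall x \ae mu, forall i,
    P (fun x => c ^+ i * iter i P f x) x = c ^+ i * iter i.+1 P f x.
  by apply: ae_foralln => i; exact: (markov_scale p_inv (c ^+ i) (iter_L2 p_inv i hf2)).
move: e1 e2; apply: filterS2 => x e1 e2.
rewrite /wave e1; under eq_bigr => i _ do rewrite e2.
elim: m {e1} => [|m IH]; first by rewrite !big_ord0 expr0 mul1r subrr !mulr0 subr0.
rewrite !big_ord_recr /= mulrDr opprD addrACA IH exprSr.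
have -> : z * (c ^+ m * c * P (iter m P f) x - f x) =
   (c * z) * c ^+ m * P (iter m P f) x - z * f x by ring.
by rewrite cz; ring.
Qed.

(* The waves attached to the [m]-th roots of unity are bounded by [lower] and
   [wave_defect]; by Parseval their average is the weighted square sum. *)
Lemma weighted_sum_le m f : (0 < m)%N -> L2zero mu f ->
  eta ^+ 2 * \sum_(i < m) (r^-1 ^+ i) ^+ 2 * sqn mu (iter i P f) <=
  (r * (r^-1 ^+ m * L2norm mu (iter m P f) + L2norm mu f)) ^+ 2.
Proof.
move=> m0 hf; have hf2 := L2zero_L2 hf.
have [w hw] := @prim_root_exists R[i] m m0.
have wn : nsq w = 1.
  have := congr1 (@nsq R) (prim_expr_order hw); rewrite nsqX.
  rewrite {2}/nsq /= expr1n expr0n addr0 => /eqP.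
  by rewrite pexpr_eq1 ?nsq_ge0// => /eqP.
have w0 : w != 0.
  by apply/eqP => w0; move: wn; rewrite w0 /nsq /= expr0n addr0 => /eqP; rewrite eq_sym oner_eq0.
have rn : r != 0 by rewrite gt_eqF.
have ri : 0 < r^-1 by rewrite invr_gt0.
pose rho : R[i] := Complex r^-1 0.
have rhoX i : nsq (rho ^+ i) = (r^-1 ^+ i) ^+ 2.
  by rewrite nsqX /nsq /= expr0n addr0 exprAC.
(* The inverses [z k] are equally spaced on the circle of radius [r], where [lower] holds with one
   constant [eta]. *)
pose c k := rho * w ^+ k.
pose z k := Complex r 0 * w ^- k.
have rr : rho * Complex r 0 = 1.
  by apply: complex_eq; rewrite ?creM ?cimM /= ?mulVf// ?mulr0 ?mul0r ?subr0 ?addr0.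
have cz k : c k * z k = 1.
  by rewrite /c /z mulrACA rr mul1r mulfV// expf_neq0.
have zr k : nsq (z k) = r ^+ 2.
  by rewrite nsqM nsqV nsqX wn expr1n invr1 mulr1 /nsq /= expr0n addr0.
set B := r * _; have B0 : 0 <= B.
  by rewrite mulr_ge0 ?addr_ge0 ?mulr_ge0 ?L2norm_ge0 ?exprn_ge0// ltW.
have bound k : eta ^+ 2 * sqn mu (wave (c k) m f) <= B ^+ 2.
  have hw0 := L2zero_wave (c k) m hf; have hw2 := L2zero_L2 hw0.
  have := lower (zr k) hw0.
  have hP := iter_L2 p_inv m hf2.
  have h1 := L2Z (c k ^+ m) hP; have h2 := L2B h1 hf2.
  rewrite (ae_L2norm _ _ (wave_defect m (cz k) hf)); last 2 first.
  - by apply: L2B; [exact: markov_L2|exact: L2Z].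
  - exact: L2Z.
  rewrite L2normZ// normc_nsq zr sqrtr_sqr gtr0_norm// => le1.
  have le2 : L2norm mu (fun x => c k ^+ m * iter m P f x - f x) <=
      r^-1 ^+ m * L2norm mu (iter m P f) + L2norm mu f.
    apply: (le_trans (L2norm_triangleB h1 hf2)).
    rewrite L2normZ// normc_nsq nsqX nsqM nsqX wn expr1n mulr1.
    by rewrite /nsq /= expr0n addr0 exprAC sqrtr_sqr ger0_norm// exprn_ge0// ltW.
  have le3 : eta * L2norm mu (wave (c k) m f) <= B.
    by apply: (le_trans le1); rewrite ler_pM2l.
  rewrite -L2norm_sq// -exprMn; apply: lerXn2r; rewrite ?nnegrE//.
  by rewrite mulr_ge0 ?L2norm_ge0// ltW.
(* Parseval is applied pointwise in [x] to the values [rho ^+ i * iter i P f x], then integrated. *)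
have sumE : \sum_(k < m) sqn mu (wave (c k) m f) =
    m%:R * \sum_(i < m) (r^-1 ^+ i) ^+ 2 * sqn mu (iter i P f).
  have [_ <-] := rint_sum (index_enum 'I_m) (rint_cst mu 0)
    (fun k => rint_nsq (L2zero_L2 (L2zero_wave (c k) m hf))).
  have hi (i : 'I_m) : rint mu (fun x => (r^-1 ^+ i) ^+ 2 * nsq (iter i P f x)).
    by apply: rintZ; apply: rint_nsq; exact: iter_L2.
  have [hs hsE] := rint_sum (index_enum 'I_m) (rint_cst mu 0) hi.
  transitivity (m%:R * \int[mu]_x \sum_(i < m) (r^-1 ^+ i) ^+ 2 * nsq (iter i P f x)).
    rewrite -RintZ//; congr Rintegral; apply/funext => x.
    have := parseval_nsq (fun i => rho ^+ i * iter i P f x) hw.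
    under [in RHS]eq_bigr => i _ do rewrite nsqM rhoX.
    move=> <-; apply: eq_bigr => k _; congr nsq; apply: eq_bigr => i _.
    by rewrite exprMn; ring.
  rewrite hsE; congr (_ * _); apply: eq_bigr => i _.
  by rewrite RintZ//; apply: rint_nsq; exact: iter_L2.
have mp : 0 < m%:R :> R by rewrite ltr0n.
rewrite -(ler_pM2l mp) mulrCA -sumE mulr_sumr.
apply: (@le_trans _ _ (\sum_(k < m) B ^+ 2)).
  by apply: ler_sum => k _; exact: bound.
by rewrite sumr_const card_ord mulr_natl.
Qed.

(* Datko's argument: square summability of the weighted orbit, with a bound
   uniform over the unit ball, improves the exponential rate [r] by a factor. *)
Lemma opnorm_improved n : growth_rate (opnorm mu p) < r -> (0 < n)%N ->
  n%:R * opnorm mu p n ^+ 2 <= ((2 * r / eta) ^+ 2) ^+ 2 * (r ^+ n) ^+ 2.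
Proof.
move=> sr n0; set C := (2 * r / eta) ^+ 2.
have C0 : 0 <= C by exact: sqr_ge0.
have ri : 0 < r^-1 by rewrite invr_gt0.
(* Summing up to a larger [m], for which [r^-m |P^m f| <= |f|], keeps the boundary terms below
   [2 * r * |f|]; the extra terms are nonnegative. Hence [C] does not depend on [K]. *)
have orbit f K : (0 < K)%N -> L2zero mu f ->
    \sum_(i < K) (r^-1 ^+ i) ^+ 2 * sqn mu (iter i P f) <= C * sqn mu f.
  move=> K0 hf; have hf2 := L2zero_L2 hf.
  have [m0 hm0] := submult_eventually (opnorm_ge0 p_inv proper_ex)
    (opnorm_le1 p_inv proper_ex) (opnormM p_inv proper_ex) sr.
  pose m := (maxn m0 K); have m_gt0 : (0 < m)%N by rewrite /m leq_max K0 orbT.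
  have := weighted_sum_le m_gt0 hf.
  have am : r^-1 ^+ m * L2norm mu (iter m P f) <= L2norm mu f.
    rewrite exprVn mulrC ler_pdivrMr ?exprn_gt0// mulrC.
    apply: (le_trans (opnorm_le p_inv m hf)).
    by rewrite ler_wpM2r ?L2norm_ge0// hm0// leq_maxl.
  move=> le1.
  have le2 : (r * (r^-1 ^+ m * L2norm mu (iter m P f) + L2norm mu f)) ^+ 2 <=
      (2 * r) ^+ 2 * sqn mu f.
    rewrite -L2norm_sq// -exprMn; apply: lerXn2r; rewrite ?nnegrE.
    - by rewrite mulr_ge0 ?addr_ge0 ?mulr_ge0 ?L2norm_ge0 ?exprn_ge0// ltW.
    - by rewrite !mulr_ge0 ?L2norm_ge0// ltW.
    by rewrite [2 * r]mulrC -mulrA ler_pM2l//; lra.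
  have le3 : \sum_(i < K) (r^-1 ^+ i) ^+ 2 * sqn mu (iter i P f) <=
      \sum_(i < m) (r^-1 ^+ i) ^+ 2 * sqn mu (iter i P f).
    have Km : (K <= m)%N by rewrite leq_maxr.
    rewrite (big_ord_widen m (fun i => (r^-1 ^+ i) ^+ 2 * sqn mu (iter i P f)))//.
    rewrite [leRHS](bigID (fun i : 'I_m => (i < K)%N)) /= lerDl.
    by apply: sumr_ge0 => i _; rewrite mulr_ge0 ?sqr_ge0// sqn_ge0.
  apply: (le_trans le3).
  have e2 : 0 < eta ^+ 2 by rewrite exprn_gt0.
  rewrite /C expr_div_n mulrAC ler_pdivlMr// mulrC.
  exact: le_trans le1 le2.
have pointwise f i : L2zero mu f -> (r^-1 ^+ i) ^+ 2 * sqn mu (iter i P f) <= C * sqn mu f.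
  move=> hf; apply: le_trans (orbit f i.+1 (ltn0Sn i) hf).
  rewrite big_ord_recr /= lerDr; apply: sumr_ge0 => j _.
  by rewrite mulr_ge0 ?sqr_ge0// sqn_ge0.
(* For each [i < n], [pointwise] applied to [P^i f] with [n - i] steps bounds [r^(-2n) |P^n f|^2] by
   [C * r^(-2i) |P^i f|^2]. Adding these [n] inequalities and using [orbit] produces the factor
   [n]. *)
have fin f : L2zero mu f -> n%:R * sqn mu (iter n P f) <=
    C ^+ 2 * (r ^+ n) ^+ 2 * sqn mu f.
  move=> hf; have hf2 := L2zero_L2 hf.
  have rn0 : 0 < (r^-1 ^+ n) ^+ 2 by rewrite !exprn_gt0.
  rewrite -(ler_pM2l rn0).
  have -> : (r^-1 ^+ n) ^+ 2 * (C ^+ 2 * (r ^+ n) ^+ 2 * sqn mu f) = C * (C * sqn mu f).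
    have : (r^-1 ^+ n) ^+ 2 * (r ^+ n) ^+ 2 = 1.
      by rewrite -!exprMn mulVf ?gt_eqF// !expr1n.
    move=> h; rewrite [LHS](_ : _ = ((r^-1 ^+ n) ^+ 2 * (r ^+ n) ^+ 2) * (C * (C * sqn mu f))).
      by rewrite h mul1r.
    by ring.
  rewrite mulrCA mulr_natl -[X in _ *+ X](card_ord n) -sumr_const.
  apply: (@le_trans _ _ (\sum_(i < n) C * ((r^-1 ^+ i) ^+ 2 * sqn mu (iter i P f)))).
    apply: ler_sum => i _.
    have hi := iter_L2zero p_inv i hf.
    have := pointwise _ (n - i)%N hi; rewrite -iterD subnK ?(ltnW (ltn_ord i))// => h.
    have -> : r^-1 ^+ n = r^-1 ^+ (n - i) * r^-1 ^+ i.
      by rewrite -exprD subnK// ltnW.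
    rewrite exprMn [C * _]mulrCA [_ ^+ 2 * _ ^+ 2]mulrC -mulrA.
    by apply: ler_wpM2l h; exact: sqr_ge0.
  by rewrite -mulr_sumr ler_wpM2l//; exact: orbit.
have np : 0 < n%:R :> R by rewrite ltr0n.
have D0 : 0 <= C ^+ 2 * (r ^+ n) ^+ 2 / n%:R.
  by rewrite divr_ge0 ?ler0n// -exprMn sqr_ge0.
have : opnorm mu p n <= Num.sqrt (C ^+ 2 * (r ^+ n) ^+ 2 / n%:R).
  apply: opnorm_ge => // f hf; have hf2 := L2zero_L2 hf.
  have b0 := mulr_ge0 (sqrtr_ge0 (C ^+ 2 * (r ^+ n) ^+ 2 / n%:R)) (L2norm_ge0 mu f).
  rewrite -(@ler_pXn2r _ 2) ?nnegrE ?L2norm_ge0//.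
  rewrite exprMn sqr_sqrtr; last exact: D0.
  rewrite !L2norm_sq//; last exact: iter_L2.
  by rewrite mulrAC ler_pdivlMr// mulrC fin.
move=> h; have : opnorm mu p n ^+ 2 <= Num.sqrt (C ^+ 2 * (r ^+ n) ^+ 2 / n%:R) ^+ 2.
  by apply: lerXn2r; rewrite ?nnegrE ?sqrtr_ge0 ?opnorm_ge0.
rewrite sqr_sqrtr; last exact: D0.
by rewrite ler_pdivlMr// mulrC.
Qed.

End lower_bounded.

End spectral_radius_bound.

Section spectral_radius_Mset.
Context {R : realType} {d : measure_display} {T : measurableType d}.
Variables (mu : probability T R) (p : R.-pker T ~> T).
Hypothesis p_inv : invariant_probability p mu.
Hypothesis proper_ex : exists A, proper_set mu A.

Local Notation s := (growth_rate (opnorm mu p)).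

(* [opnorm n >= s ^+ n], so [opnorm_improved] fails for large [n] once [r] is
   close enough to [s]. *)
Lemma growth_rate_contradiction (eta : R) (N : nat) : 0 < eta -> 0 < s ->
  (forall r, s < r -> r <= 2 -> forall z g, nsq z = r ^+ 2 -> L2zero mu g ->
    eta * L2norm mu g <= L2norm mu (fun x => markov_op p g x - z * g x)) ->
  False.
Proof.
move=> eta0 s0 lower.
have s1 : s <= 1 := growth_rate_le1 (opnorm_ge0 p_inv proper_ex) (opnorm_le1 p_inv proper_ex).
(* [D] dominates the constant of [opnorm_improved] for every [r <= 2], so that [K] can be fixed
   before [r]. *)
pose D := ((4 / eta) ^+ 2) ^+ 2.
pose K := (Num.truncn (9 / 4 * D)).+1.
have KD : 9 / 4 * D < K%:R by exact: truncnS_gt.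
clearbody K.
have K0 : (0 < K)%N.
  rewrite lt0n; apply/negP => /eqP K0; move: KD; rewrite K0 ltNge => /negP; apply.
  by rewrite mulr_ge0 ?divr_ge0 ?sqr_ge0.
(* The radius [r = s * t] satisfies [r ^+ K = 3 / 2 * s ^+ K]; [opnorm_improved] at [n = K] would
   then force [K <= 9 / 4 * D]. *)
pose t : R := (3 / 2) `^ K%:R^-1.
have tK : t ^+ K = 3 / 2 by rewrite rootXn// divr_ge0.
have t1 : 1 < t.
  rewrite ltNge; apply/negP => t1; have : t ^+ K <= 1.
    by rewrite exprn_ile1// powR_ge0.
  by rewrite tK; lra.
have t2 : t <= 3 / 2.
  rewrite root_le ?divr_ge0//; apply: ler_eXnr => //; lra.
have sr : s < s * t by rewrite ltr_pMr.
have r0 : 0 < s * t by rewrite mulr_gt0// (lt_trans ltr01).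
have r2 : s * t <= 3 / 2.
  by rewrite -[leRHS]mul1r; apply: ler_pM => //; rewrite ltW// (lt_trans ltr01).
have r2' : s * t <= 2 by lra.
have := opnorm_improved p_inv proper_ex r0 eta0 (lower _ sr r2') sr K0.
have aK := growth_rateX (opnorm_ge0 p_inv proper_ex) K0.
have stK : (s * t) ^+ K = s ^+ K * (3 / 2) by rewrite exprMn tK.
rewrite stK => le1.
have sK : 0 < s ^+ K by rewrite exprn_gt0.
have le2 : (s ^+ K) ^+ 2 <= opnorm mu p K ^+ 2.
  by apply: lerXn2r; rewrite ?nnegrE ?opnorm_ge0// ltW.
have le3 : ((2 * (s * t) / eta) ^+ 2) ^+ 2 <= D.
  have b0 : 0 <= 2 * (s * t) / eta by apply: divr_ge0; [apply: mulr_ge0|]; rewrite ?ltW.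
  have b1 : 2 * (s * t) / eta <= 4 / eta by rewrite ler_pM2r ?invr_gt0//; lra.
  have b2 : 0 <= 4 / eta := le_trans b0 b1.
  by do 2 (apply: lerXn2r; rewrite ?nnegrE ?sqr_ge0//).
set S := (s ^+ K) ^+ 2 in le2.
have S0 : 0 < S by rewrite exprn_gt0.
have Kp : 0 <= K%:R :> R by exact: ler0n.
have le4 := ler_wpM2l Kp le2.
have le5 : ((2 * (s * t) / eta) ^+ 2) ^+ 2 * (s ^+ K * (3 / 2)) ^+ 2 <= D * (S * (9 / 4)).
  rewrite (_ : (s ^+ K * (3 / 2)) ^+ 2 = S * (9 / 4)); last by rewrite /S; field.
  by apply: ler_wpM2r le3; apply: mulr_ge0; [exact: ltW|exact: divr_ge0].
have : K%:R * S <= 9 / 4 * D * S.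
  apply: (le_trans le4); apply: (le_trans le1); apply: (le_trans le5).
  by rewrite le_eqVlt; apply/orP; left; apply/eqP; ring.
by rewrite ler_pM2r// leNgt KD.
Qed.

(** If [s] were at least the root, every circle of radius in [(s, 2]] would satisfy
    [rate e <= r ^+ horizon e], so [resolvent_lower] would hold on all of them with one constant. *)
Lemma growth_rate_lt_root e : Mset p mu e -> s < rate e `^ (horizon e)%:R^-1.
Proof.
move=> he; have /andP[q0 q1] := rate_bounds p_inv proper_ex he.
have N0 : (0 < horizon e)%N by [].
rewrite ltNge root_le ?growth_rate_ge0 ?(ltW q0)//; apply/negP => qs.
have s0 : 0 < s.
  rewrite lt0r growth_rate_ge0 andbT; apply/eqP => s0.
  by move: qs; rewrite s0 expr0n /= leNgt q0.
have eta0 : 0 < (1 - rate e) ^+ 2 / 2 ^+ horizon e.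
  by rewrite divr_gt0 ?exprn_gt0// subr_gt0.
apply: (growth_rate_contradiction 0 eta0 s0) => r sr r2 z g zr hg.
apply: (resolvent_lower p_inv proper_ex he (r := r)) => //.
  by rewrite (lt_trans s0 sr).
apply: (le_trans qs); apply: lerXn2r; rewrite ?nnegrE ?(ltW s0) ?(ltW sr)//.
by rewrite ltW// (lt_trans s0 sr).
Qed.

Lemma Mset_gap : Mset p mu !=set0 -> L2_spectral_gap mu p.
Proof.
move=> [e he]; rewrite /L2_spectral_gap spectral_radius0E//.
apply: (lt_le_trans (growth_rate_lt_root he)).
have /andP[q0 q1] := rate_bounds p_inv proper_ex he.
by rewrite root_le ?(ltW q0)// expr1n ltW.
Qed.

Lemma growth_rate_lt_r0 (x : R) : Mset p mu !=set0 -> r0 p mu < x -> s < x.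
Proof.
move=> [e0 he0] /inf_lt [|_ [e he <-] ex].
  by exists (rate e0 `^ (horizon e0)%:R^-1), e0.
exact: lt_trans (growth_rate_lt_root he) ex.
Qed.

End spectral_radius_Mset.

(** * Pointwise summation of geometrically decaying series *)

Lemma dominated_series (R : realType) (a : nat -> R) (g t : R) :
  0 <= g -> 0 <= t < 1 -> (forall j, `|a j| <= g * t ^+ j) ->
  exists2 l, (\sum_(j < n) a j @[n --> \oo] --> l) &
    forall n, `|l - \sum_(j < n) a j| <= g * t ^+ n / (1 - t).
Proof.
move=> g0 /andP[t0 t1] ha; have t1' : 0 < 1 - t by rewrite subr_gt0.
have tn : 1 - t != 0 by rewrite gt_eqF.
have hc : cvgn (series a).
  apply: (@normed_cvg R R^o).
  apply: (@series_le_cvg _ (fun n => `|a n|) (geometric g t)) => [n|n|n|].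
  - exact: normr_ge0.
  - by rewrite /geometric /= mulr_ge0// exprn_ge0.
  - exact: ha.
  by apply: is_cvg_geometric_series; rewrite ger0_norm.
have uE : series a = (fun n => \sum_(j < n) a j).
  by apply/funext => n; rewrite /series /= big_mkord.
rewrite uE in hc; set U := fun n => \sum_(j < n) a j in hc *.
exists (limn U) => // n.
(* The geometric tail in telescoped form, suited to induction; dropping the subtracted term leaves a
   bound uniform in [k], which passes to the limit. *)
have step k : `|U (n + k)%N - U n| <= g * t ^+ n / (1 - t) - g * t ^+ (n + k) / (1 - t).
  elim: k => [|k IH]; first by rewrite addn0 !subrr normr0.
  have -> : U (n + k.+1)%N - U n = (U (n + k)%N - U n) + a (n + k)%N.
    by rewrite addnS /U big_ord_recr /=; ring.
  apply: (le_trans (ler_normD _ _)).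
  have e : g * t ^+ (n + k) / (1 - t) - g * t ^+ (n + k.+1) / (1 - t) = g * t ^+ (n + k).
    by rewrite addnS exprS; field.
  have := ha (n + k)%N; lra.
have hcn : `|U m - U n| @[m --> \oo] --> `|limn U - U n|.
  by apply: cvg_norm; apply: cvgB => //; exact: cvg_cst.
apply: (cvgr_to_le hcn); exists n => // m /= nm.
have := step (m - n)%N; rewrite subnKC// => /le_trans; apply.
by rewrite gerBl divr_ge0 ?mulr_ge0 ?exprn_ge0// ltW.
Qed.

Section L2_series.
Context {R : realType} {d : measure_display} {T : measurableType d}.
Variable m : {finite_measure set T -> \bar R}.
Variables (w : nat -> T -> R) (A q : R).
Hypothesis A_ge0 : 0 <= A.
Hypothesis q01 : 0 < q < 1.
Hypothesis w_L2 : forall j, rL2 m (w j).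
Hypothesis w_decay : forall j, \int[m]_x w j x ^+ 2 <= A * (q ^+ j) ^+ 2.

(* Junk where the partial sums have no finite upper limit, a null set here. *)
Definition series_limit (x : T) : R :=
  fine (limn_esup (fun n => (\sum_(j < n) w j x)%:E)).

(* [q ^- j] weights make the square sum integrable while still forcing
   [`|w j x|] to decay geometrically wherever it is finite. *)
Let H x : \bar R := (\sum_(0 <= j <oo) ((q ^- j * w j x ^+ 2)%R)%:E)%E.

Let term_ge0 j x : 0 <= q ^- j * w j x ^+ 2.
Proof.
by case/andP: q01 => q0 _; rewrite mulr_ge0 ?sqr_ge0// invr_ge0 exprn_ge0// ltW.
Qed.

Let term_meas j : measurable_fun setT (fun x => (q ^- j * w j x ^+ 2)%:E).
Proof.
apply/measurable_EFinP; apply: measurable_funM => //.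
by apply: measurable_funX; exact: rL2_meas (w_L2 j).
Qed.

Let H_meas : measurable_fun setT H.
Proof.
apply: (@ge0_emeasurable_sum _ _ _ setT (fun j x => (q ^- j * w j x ^+ 2)%:E) xpredT) => //.
by move=> j x _ _; rewrite lee_fin.
Qed.

Let H_ge0 x : (0 <= H x)%E.
Proof. by apply: nneseries_ge0 => j _ _; rewrite lee_fin. Qed.

Let H_int : (\int[m]_x H x <= (A / (1 - q))%:E)%E.
Proof.
have /andP[q0 q1] := q01.
rewrite integral_nneseries//; last by move=> j x _; rewrite lee_fin.
apply: lime_le.
  by apply: is_cvg_nneseries => j _ _; apply: integral_ge0 => x _; rewrite lee_fin.
apply: nearW => n.
have le j : (\int[m]_x (q ^- j * w j x ^+ 2)%:E <= (A * q ^+ j)%:E)%E.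
  have hj := rL2_sq (w_L2 j).
  rewrite Rint_EFin; last exact: rintZ.
  rewrite lee_fin RintZ// -ler_pdivlMl ?invr_gt0 ?exprn_gt0// invrK.
  by apply: (le_trans (w_decay j)); rewrite expr2 mulrCA.
apply: (@le_trans _ _ (\sum_(0 <= j < n) (A * q ^+ j)%:E)%E).
  by apply: lee_sum => j _; exact: le.
rewrite sumEFin lee_fin -mulr_sumr ler_wpM2l//.
have q1' : 0 < 1 - q by rewrite subr_gt0.
rewrite big_mkord -[leRHS]mul1r ler_pdivlMr// mulrC -opprB mulNr -subrX1 opprB.
by rewrite gerBl exprn_ge0// ltW.
Qed.

Let H_fin : \forall x \ae m, H x \is a fin_num.
Proof.
have iH : m.-integrable setT H.
  apply/integrableP; split => //.
  under eq_integral => x _ do rewrite gee0_abs//.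
  exact: le_lt_trans H_int (ltry _).
by have := integrable_ae measurableT iH; apply: filterS => x /(_ I).
Qed.

Let t := Num.sqrt q.

(** The decay [q^(2 j)] is spent in two halves: one factor [q^j] makes [H] integrable; the other,
    where [H] is finite, gives [|w j x| <= sqrt (H x) * t^j] with [t = sqrt q], hence convergence
    with a tail bound. *)
Lemma series_limit_bound : \forall x \ae m, forall n,
  (((series_limit x - \sum_(j < n) w j x) ^+ 2)%:E <=
   (q ^+ n / (1 - t) ^+ 2)%:E * H x)%E.
Proof.
have /andP[q0 q1] := q01.
have t0 : 0 <= t by exact: sqrtr_ge0.
have tq : t ^+ 2 = q by rewrite sqr_sqrtr// ltW.
have t1 : t < 1 by rewrite -sqrtr1 ltr_sqrt.
apply: filterS H_fin => x hx n.
have [h hE] : exists h, H x = h%:E by exists (fine (H x)); rewrite fineK.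
have h0 : 0 <= h by rewrite -lee_fin -hE.
have wj j : `|w j x| <= Num.sqrt h * t ^+ j.
  have : ((q ^- j * w j x ^+ 2)%:E <= H x)%E.
    rewrite /H (nneseriesD1 (n := j))//; last by move=> k _; rewrite lee_fin.
    by rewrite leeDl//; apply: nneseries_ge0 => k _ _; rewrite lee_fin.
  rewrite hE lee_fin -ler_pdivlMl ?invr_gt0 ?exprn_gt0// invrK => le1.
  rewrite -sqrtr_sqr -(ger0_norm (exprn_ge0 j t0)) -sqrtr_sqr -sqrtrM//.
  by rewrite ler_wsqrtr// exprAC tq mulrC.
have [l hl bl] := dominated_series (sqrtr_ge0 h) (introT andP (conj t0 t1)) wj.
have -> : series_limit x = l.
  have hl' : (\sum_(j < n) w j x)%:E @[n --> \oo] --> l%:E.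
    by apply: cvg_EFin; [exact: nearW|exact: hl].
  rewrite /series_limit is_cvg_limn_esupE; last by apply/cvg_ex; exists l%:E.
  by rewrite (cvg_lim _ hl').
rewrite hE -EFinM lee_fin -real_normK ?num_real//.
have -> : q ^+ n / (1 - t) ^+ 2 * h = (Num.sqrt h * t ^+ n / (1 - t)) ^+ 2.
  by rewrite expr_div_n exprMn sqr_sqrtr// exprAC tq; ring.
apply: lerXn2r; rewrite ?nnegrE//.
by rewrite divr_ge0 ?mulr_ge0 ?sqrtr_ge0 ?exprn_ge0 ?subr_ge0// ltW.
Qed.

Lemma measurable_series_limit : measurable_fun setT series_limit.
Proof.
apply: (measurableT_comp (@fine_measurable R _ measurableT)).
apply: measurable_fun_limn_esup => n; apply/measurable_EFinP.
by apply: measurable_sum => j; exact: rL2_meas (w_L2 j).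
Qed.

Lemma rL2_partial n : rL2 m (fun x => \sum_(j < n) w j x).
Proof.
elim: n => [|n IH].
  by have := rL2_cst m 0; congr rL2; apply/funext => x; rewrite big_ord0.
have := rL2D IH (w_L2 n); congr rL2.
by apply/funext => x; rewrite big_ord_recr.
Qed.

(** Integrate [series_limit_bound] with the help of [H_int]; the case [n = 0] is the square
    integrability of the limit itself. *)
Lemma series_limit_L2 : rL2 m series_limit /\
  forall n, \int[m]_x (series_limit x - \sum_(j < n) w j x) ^+ 2 <=
    A / (1 - q) / (1 - t) ^+ 2 * q ^+ n.
Proof.
have /andP[q0 q1] := q01.
have t1 : t < 1 by rewrite -sqrtr1 ltr_sqrt.
have c0 n : 0 <= q ^+ n / (1 - t) ^+ 2.
  by rewrite divr_ge0 ?sqr_ge0// exprn_ge0// ltW.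
have mn n : measurable_fun setT (fun x => (series_limit x - \sum_(j < n) w j x) ^+ 2).
  apply: measurable_funX; apply: measurable_funB; first exact: measurable_series_limit.
  exact: rL2_meas (rL2_partial n).
have le n : (\int[m]_x ((series_limit x - \sum_(j < n) w j x) ^+ 2)%:E <=
   (A / (1 - q) / (1 - t) ^+ 2 * q ^+ n)%:E)%E.
  apply: (@le_trans _ _ (\int[m]_x ((q ^+ n / (1 - t) ^+ 2)%:E * H x))%E).
    apply: ae_ge0_le_integral => //.
    - by move=> x _; rewrite lee_fin sqr_ge0.
    - exact/measurable_EFinP.
    - by move=> x _; rewrite mule_ge0// lee_fin.
    - exact: measurable_funeM.
    - by have := series_limit_bound; apply: filterS => x /(_ n) h _.
  rewrite ge0_integralZl//; last by rewrite lee_fin.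
  apply: (@le_trans _ _ ((q ^+ n / (1 - t) ^+ 2)%:E * (A / (1 - q))%:E)%E).
    by apply: lee_wpmul2l => //; rewrite lee_fin.
  by rewrite -EFinM lee_fin le_eqVlt; apply/orP; left; apply/eqP; ring.
have fin n : rint m (fun x => (series_limit x - \sum_(j < n) w j x) ^+ 2).
  apply/integrableP; split; first exact/measurable_EFinP.
  under eq_integral => x _ do rewrite gee0_abs ?lee_fin ?sqr_ge0//.
  exact: le_lt_trans (le n) (ltry _).
split.
  split; first exact: measurable_series_limit.
  by have := fin 0%N; congr rint; apply/funext => x; rewrite big_ord0 subr0.
by move=> n; rewrite -lee_fin -Rint_EFin.
Qed.

End L2_series.

(** * The Neumann series *)

Section vanishing.
Context {R : realType}.
Implicit Types u v : nat -> R.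

(** One-sided: the upper limit is at most 0, which for norms is convergence to 0. *)
Definition vanishing u := forall e, 0 < e ->
  exists n0, forall n, (n0 <= n)%N -> u n <= e.

Lemma vanishing_le u v : (forall n, u n <= v n) -> vanishing v -> vanishing u.
Proof.
move=> uv hv e e0; have [n0 h] := hv e e0; exists n0 => n /h.
exact: le_trans.
Qed.

Lemma vanishingD u v : vanishing u -> vanishing v -> vanishing (fun n => u n + v n).
Proof.
move=> hu hv e e0; have e2 : 0 < e / 2 by rewrite divr_gt0.
have [n0 h0] := hu _ e2; have [n1 h1] := hv _ e2.
exists (maxn n0 n1) => n; rewrite geq_max => /andP[/h0 u0 /h1 u1].
by rewrite [leRHS]splitr lerD.
Qed.

Lemma vanishingZ c u : 0 <= c -> vanishing u -> vanishing (fun n => c * u n).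
Proof.
move=> c0 hu e e0; have c1 : 0 < c + 1 by rewrite ltr_wpDl.
have [n0 h] := hu _ (divr_gt0 e0 c1); exists n0 => n /h h1.
have := ler_wpM2l c0 h1; move/le_trans; apply.
by rewrite mulrCA ger_pMr// ler_pdivrMr// mul1r lerDl.
Qed.

Lemma vanishing_geo q : 0 <= q -> q < 1 -> vanishing (fun n => q ^+ n).
Proof. by move=> q0 q1 e e0; exact: geo_small. Qed.

Lemma vanishing_cst c : vanishing (fun=> c) -> c <= 0.
Proof.
move=> h; rewrite leNgt; apply/negP => c0.
have [n0 /(_ n0 (leqnn _))] := h (c / 2) (divr_gt0 c0 (ltr0Sn _ 1)).
lra.
Qed.

End vanishing.

Section neumann.
Context {R : realType} {d : measure_display} {T : measurableType d}.
Variables (mu : probability T R) (p : R.-pker T ~> T).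
Hypothesis p_inv : invariant_probability p mu.
Hypothesis proper_ex : exists A, proper_set mu A.
Implicit Types f g : T -> R[i].

Local Notation P := (markov_op p).
Local Notation mean f := (cintegral mu f).

Lemma mean_linear (a : R[i]) f g : L2 mu f -> L2 mu g ->
  mean (fun x => a * f x + g x) = a * mean f + mean g.
Proof.
move=> /L2P[f1 f2] /L2P[g1 g2].
have i1 := rL2_int f1; have i2 := rL2_int f2.
have i3 := rL2_int g1; have i4 := rL2_int g2.
set b := complex.Re a; set c := complex.Im a.
apply: complex_eq.
  rewrite creD creM /cintegral /= -/b -/c.
  rewrite (_ : (fun x => complex.Re _) = (fun x => b * complex.Re (f x) -
    c * complex.Im (f x) + complex.Re (g x))); last first.
    by apply/funext => x; rewrite creD creM.
  rewrite RintD//; last by apply: rintB; exact: rintZ.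
  by rewrite RintB; [rewrite !RintZ|exact: rintZ|exact: rintZ].
rewrite cimD cimM /cintegral /= -/b -/c.
rewrite (_ : (fun x => complex.Im _) = (fun x => b * complex.Im (f x) +
  c * complex.Re (f x) + complex.Im (g x))); last first.
  by apply/funext => x; rewrite cimD cimM.
rewrite RintD//; last by apply: rintD; exact: rintZ.
by rewrite RintD; [rewrite !RintZ|exact: rintZ|exact: rintZ].
Qed.

Lemma mean_cst (c : R[i]) : mean (fun=> c) = c.
Proof.
have h (a : R) : \int[mu]_x a = a.
  rewrite Rintegral_cst// [X in _ * fine X](_ : _ = 1%E) /= ?mulr1//.
  exact: probability_setT.
by rewrite /cintegral !h; case: c.
Qed.

Lemma markov_cst (c : R[i]) x : P (fun=> c) x = c.
Proof.
have h (a : R) : \int[p x]_y a = a.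
  by rewrite Rintegral_cst// prob_kernel /= mulr1.
by rewrite /markov_op /cintegral !h; case: c.
Qed.

Lemma mean_markov f : L2 mu f -> mean (P f) = mean f.
Proof.
move=> /L2P[f1 f2]; rewrite /cintegral; congr Complex.
- exact: (Rint_kop p_inv (rL2_int f1)).
- exact: (Rint_kop p_inv (rL2_int f2)).
Qed.

Lemma mean_sub f g : L2 mu f -> L2 mu g ->
  mean (fun x => f x - g x) = mean f - mean g.
Proof.
move=> hf hg; rewrite (_ : (fun x => _) = (fun x => -1 * g x + f x)).
  by rewrite mean_linear// mulN1r addrC.
by apply/funext => x; rewrite mulN1r addrC.
Qed.

Lemma mean_add f g : L2 mu f -> L2 mu g ->
  mean (fun x => f x + g x) = mean f + mean g.
Proof.
move=> hf hg; rewrite (_ : (fun x => _) = (fun x => 1 * f x + g x)).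
  by rewrite mean_linear// mul1r.
by apply/funext => x; rewrite mul1r.
Qed.

Definition centered f : T -> R[i] := fun x => f x - mean f.

Lemma L2zero_centered f : L2 mu f -> L2zero mu (centered f).
Proof.
move=> hf; split; first by apply: L2B => //; exact: L2_cst.
by rewrite mean_sub ?mean_cst ?subrr//; exact: L2_cst.
Qed.

Lemma sqn_centered f : L2 mu f -> sqn mu f = sqn mu (centered f) + nsq (mean f).
Proof.
move=> hf; have h0 := L2zero_centered hf; have hc := L2_cst mu (mean f).
have -> : sqn mu f = sqn mu (fun x => centered f x + mean f).
  by congr sqn; apply/funext => x; rewrite subrK.
have h0' := L2zero_L2 h0; rewrite sqnD//.
have -> : ip mu (centered f) (fun=> mean f) = 0.
  move/L2zeroP: h0 => [/L2P[h1 h2] h3 h4].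
  rewrite /ip /dotc (RintD (rL2M h1 (rL2_cst mu _)) (rL2M h2 (rL2_cst mu _))).
  by rewrite !RintegralZr ?h3 ?h4 ?mul0r ?addr0//; exact: rL2_int.
have -> : sqn mu (fun=> mean f) = nsq (mean f).
  rewrite /sqn Rintegral_cst// [X in _ * fine X](_ : _ = 1%E) /= ?mulr1//.
  exact: probability_setT.
by rewrite mulr0 addr0.
Qed.

Lemma centered_le f : L2 mu f -> L2norm mu (centered f) <= L2norm mu f.
Proof.
move=> hf; rewrite !L2normE//; last exact: L2zero_L2 (L2zero_centered hf).
by rewrite ler_wsqrtr// (sqn_centered hf) lerDl nsq_ge0.
Qed.

Lemma L2norm_cst (c : R[i]) : L2norm mu (fun=> c) = ComplexField.Normc.normc c.
Proof.
rewrite L2normE; last exact: L2_cst.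
rewrite /sqn Rintegral_cst// [X in _ * fine X](_ : _ = 1%E) /= ?mulr1 -?normc_nsq//.
exact: probability_setT.
Qed.

Lemma mean_le f : L2 mu f -> ComplexField.Normc.normc (mean f) <= L2norm mu f.
Proof.
move=> hf; rewrite normc_nsq L2normE// ler_wsqrtr// (sqn_centered hf) lerDr.
exact: sqn_ge0.
Qed.

Local Notation B := (fun (f : T -> R[i]) (x : T) => markov_op p f x - mean_op mu f x).

Lemma B_L2 f : L2 mu f -> L2 mu (B f).
Proof. by move=> hf; apply: L2B; [exact: markov_L2|exact: L2_cst]. Qed.

Lemma B_le f : L2 mu f -> L2norm mu (B f) <= 2 * L2norm mu f.
Proof.
move=> hf; apply: (le_trans (L2norm_triangleB (markov_L2 p_inv hf) (L2_cst mu _))).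
rewrite L2norm_cst; have := mean_le hf; have := markov_contraction p_inv hf; lra.
Qed.

Lemma B_sub f g : L2 mu f -> L2 mu g ->
  \forall x \ae mu, B (fun x => f x - g x) x = B f x - B g x.
Proof.
move=> hf hg; have := markov_sub p_inv hf hg; apply: filterS => x ->.
by rewrite /mean_op mean_sub//; ring.
Qed.

Variable z : R[i].
Let r := ComplexField.Normc.normc z.
Hypothesis r_gt : growth_rate (opnorm mu p) < r.

Let r_gt0 : 0 < r.
Proof. exact: le_lt_trans (growth_rate_ge0 _) r_gt. Qed.

Let z_neq0 : z != 0.
Proof.
apply/eqP => z0; move: r_gt0; rewrite /r z0 normc_nsq /nsq /= expr0n addr0.
by rewrite sqrtr0 ltxx.
Qed.

Let normzX n : ComplexField.Normc.normc (z ^- n) = r ^- n.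
Proof.
rewrite normc_nsq nsqV nsqX -exprVn -normc_sq -/r -exprVn -exprVn exprAC.
by rewrite sqrtr_sqr ger0_norm// exprn_ge0// invr_ge0 ltW.
Qed.

Lemma orbit_decay : exists2 C, 0 < C & exists2 q, 0 < q < 1 &
  forall f n, L2 mu f ->
    L2norm mu (fun x => z ^- n * iter n P (centered f) x) <= C * q ^+ n * L2norm mu f.
Proof.
have [C C0 [q0 /andP[q00 q01] h]] := submult_decay (opnorm_ge0 p_inv proper_ex)
  (opnorm_le1 p_inv proper_ex) (opnormM p_inv proper_ex) r_gt.
(* Enlarged from [q0], which may be 0, since [series_limit_L2] wants a positive ratio. *)
exists C => //; exists ((1 + q0) / 2); first by apply/andP; split; lra.
move=> f n hf; have h0 := L2zero_centered hf.
rewrite L2normZ ?normzX; last by apply: iter_L2 => //; exact: L2zero_L2.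
have le1 := opnorm_le p_inv n h0.
have q2 : q0 ^+ n <= ((1 + q0) / 2) ^+ n.
  by apply: lerXn2r; rewrite ?nnegrE//; lra.
have N0 := L2norm_ge0 mu (centered f).
have N1 := centered_le hf.
rewrite mulrC ler_pdivrMr ?exprn_gt0//; apply: (le_trans le1).
apply: (@le_trans _ _ (C * (q0 * r) ^+ n * L2norm mu (centered f))).
  by rewrite ler_wpM2r.
have rn : 0 <= r ^+ n by rewrite exprn_ge0// ltW.
have qn : 0 <= ((1 + q0) / 2) ^+ n by rewrite exprn_ge0//; lra.
apply: (@le_trans _ _ (C * ((1 + q0) / 2) ^+ n * r ^+ n * L2norm mu (centered f))).
  rewrite exprMn mulrA; apply: ler_wpM2r => //; apply: ler_wpM2r => //.
  by apply: ler_wpM2l => //; exact: ltW.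
rewrite [leRHS]mulrAC; apply: ler_wpM2l => //.
by apply: mulr_ge0 => //; apply: mulr_ge0 => //; exact: ltW.
Qed.

Definition neumann_term f j : T -> R[i] :=
  fun x => z^-1 * (z ^- j * iter j P (centered f) x).

Definition neumann_sum f n : T -> R[i] :=
  fun x => z^-1 * mean f + \sum_(j < n) neumann_term f j x.

(** [B] kills constants and agrees with [P] on mean-zero functions, so the inverse of [z - B] is
    [z^-1] on constants and the Neumann series of [P] on the centred part. As [series_limit] is
    real, the two components are summed separately. *)
Definition neumann f : T -> R[i] := fun x => z^-1 * mean f +
  Complex (series_limit (fun j x => complex.Re (neumann_term f j x)) x)
          (series_limit (fun j x => complex.Im (neumann_term f j x)) x).

Lemma L2zero_term f j : L2 mu f -> L2zero mu (neumann_term f j).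
Proof.
by move=> hf; do 2 apply: L2zeroZ; apply: iter_L2zero => //; exact: L2zero_centered.
Qed.

Lemma L2zero_term_sum f n : L2 mu f ->
  L2zero mu (fun x => \sum_(j < n) neumann_term f j x).
Proof.
move=> hf; apply: (@L2zero_sum _ _ _ mu _ (index_enum 'I_n)
  (fun j => neumann_term f j)) => j; exact: L2zero_term.
Qed.

Lemma L2_neumann_sum f n : L2 mu f -> L2 mu (neumann_sum f n).
Proof.
by move=> hf; apply: L2D; [exact: L2_cst|exact: L2zero_L2 (L2zero_term_sum n hf)].
Qed.

Lemma neumann_approx f : L2 mu f -> L2 mu (neumann f) /\
  vanishing (fun n => L2norm mu (fun x => neumann f x - neumann_sum f n x)).
Proof.
move=> hf; have [C C0 [q q01 hC]] := orbit_decay; have /andP[q0 q1] := q01.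
pose A := (r^-1 * C * L2norm mu f) ^+ 2.
have A0 : 0 <= A by exact: sqr_ge0.
have ht j := L2zero_L2 (L2zero_term j hf).
have sq j : sqn mu (neumann_term f j) <= A * (q ^+ j) ^+ 2.
  rewrite -L2norm_sq// -exprMn; apply: lerXn2r; rewrite ?nnegrE ?L2norm_ge0//.
    by rewrite !mulr_ge0 ?L2norm_ge0 ?exprn_ge0 ?invr_ge0// ltW.
  rewrite L2normZ; last first.
    by apply: L2Z; apply: iter_L2 => //; exact: L2zero_L2 (L2zero_centered hf).
  have -> : ComplexField.Normc.normc z^-1 = r^-1 by exact: (normzX 1).
  rewrite -!mulrA ler_pM2l ?invr_gt0//; apply: (le_trans (hC f j hf)).
  by rewrite -mulrA [L2norm mu f * _]mulrC.
have [hre him] : (forall j, rL2 mu (fun x => complex.Re (neumann_term f j x))) /\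
    (forall j, rL2 mu (fun x => complex.Im (neumann_term f j x))).
  by split=> j; have /L2P[] := ht j.
have dre j : \int[mu]_x complex.Re (neumann_term f j x) ^+ 2 <= A * (q ^+ j) ^+ 2.
  apply: le_trans (sq j); apply: Rint_le; [exact: rL2_sq|exact: rint_nsq|].
  by move=> x; rewrite lerDl sqr_ge0.
have dim j : \int[mu]_x complex.Im (neumann_term f j x) ^+ 2 <= A * (q ^+ j) ^+ 2.
  apply: le_trans (sq j); apply: Rint_le; [exact: rL2_sq|exact: rint_nsq|].
  by move=> x; rewrite lerDr sqr_ge0.
have [lre bre] := series_limit_L2 A0 q01 hre dre.
have [lim bim] := series_limit_L2 A0 q01 him dim.
have hN : L2 mu (neumann f).
  by apply: L2D; [exact: L2_cst|apply/L2P; split].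
split => // e e0; set K := A / (1 - q) / (1 - Num.sqrt q) ^+ 2 in bre bim.
have K0 : 0 <= 2 * K.
  by rewrite mulr_ge0// divr_ge0 ?sqr_ge0// divr_ge0// subr_ge0 ltW.
have [n0 hn] := vanishingZ K0 (vanishing_geo (ltW q0) q1) (exprn_gt0 2 e0).
exists n0 => n /hn small; have hS := L2_neumann_sum n hf.
have hD := L2B hN hS.
rewrite -(@ler_pXn2r _ 2) ?nnegrE ?L2norm_ge0 ?(ltW e0)// L2norm_sq//.
apply: le_trans small.
have partre := rL2_partial hre n; have partim := rL2_partial him n.
have -> : sqn mu (fun x => neumann f x - neumann_sum f n x) =
    \int[mu]_x (series_limit (fun j x => complex.Re (neumann_term f j x)) x -
       \sum_(j < n) complex.Re (neumann_term f j x)) ^+ 2 +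
    \int[mu]_x (series_limit (fun j x => complex.Im (neumann_term f j x)) x -
       \sum_(j < n) complex.Im (neumann_term f j x)) ^+ 2.
  rewrite -RintD; [|exact: rL2_sq (rL2B lre partre)|exact: rL2_sq (rL2B lim partim)].
  congr Rintegral; apply/funext => x; rewrite /neumann /neumann_sum.
  rewrite opprD addrACA subrr add0r /nsq creB cimB Re_sum.
  by rewrite (big_morph _ (@cimD R) erefl).
by have := bre n; have := bim n; lra.
Qed.

Lemma neumann_sum_le : exists M : R, forall f n, L2 mu f ->
  L2norm mu (neumann_sum f n) <= M * L2norm mu f.
Proof.
have [C C0 [q /andP[q0 q1] hC]] := orbit_decay.
have q1' : 0 < 1 - q by rewrite subr_gt0.
have nzV : ComplexField.Normc.normc z^-1 = r^-1 by exact: (normzX 1).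
have ri : 0 < r^-1 by rewrite invr_gt0.
exists (r^-1 + r^-1 * C / (1 - q)) => f n hf; have N0 := L2norm_ge0 mu f.
have bound k : L2norm mu (fun x => \sum_(j < k) neumann_term f j x) <=
    r^-1 * C * (\sum_(j < k) q ^+ j) * L2norm mu f.
  elim: k => [|k IH].
    rewrite big_ord0 mulr0 mul0r (_ : (fun x => _) = fun=> 0) ?L2norm0//.
    by apply/funext => x; rewrite big_ord0.
  rewrite (_ : (fun x => _) = (fun x => \sum_(j < k) neumann_term f j x +
    neumann_term f k x)); last by apply/funext => x; rewrite big_ord_recr.
  apply: (le_trans (L2norm_triangle (L2zero_L2 (L2zero_term_sum k hf))
    (L2zero_L2 (L2zero_term k hf)))).
  rewrite big_ord_recr /= mulrDr mulrDl; apply: lerD => //.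
  rewrite L2normZ; last first.
    by apply: L2Z; apply: iter_L2 => //; exact: L2zero_L2 (L2zero_centered hf).
  by rewrite nzV -!mulrA ler_pM2l// !mulrA; exact: hC.
apply: (le_trans (L2norm_triangle (L2_cst mu _) (L2zero_L2 (L2zero_term_sum n hf)))).
rewrite L2norm_cst ComplexField.Normc.normcM nzV mulrDl; apply: lerD.
  by rewrite ler_pM2l//; exact: mean_le.
apply: (le_trans (bound n)); apply: ler_wpM2r => //.
apply: ler_wpM2l; first by rewrite mulr_ge0 ?ltW.
rewrite -[leRHS]mul1r ler_pdivlMr// mulrC -opprB mulNr -subrX1 opprB.
by rewrite gerBl exprn_ge0// ltW.
Qed.

Lemma ae0_of_vanishing f u : L2 mu f -> (forall n, L2norm mu f <= u n) ->
  vanishing u -> \forall x \ae mu, f x = 0.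
Proof.
move=> hf fu hu; apply: L2norm_eq0 => //; apply/eqP.
rewrite eq_le L2norm_ge0 andbT; apply: vanishing_cst.
exact: vanishing_le fu hu.
Qed.

Lemma orbit_vanishing f : L2 mu f ->
  vanishing (fun n => L2norm mu (fun x => z ^- n * iter n P (centered f) x)).
Proof.
move=> hf; have [C C0 [q /andP[q0 q1] hC]] := orbit_decay.
apply: (@vanishing_le _ _ (fun n => (C * L2norm mu f) * q ^+ n)).
  by move=> n; rewrite mulrAC; exact: hC.
apply: vanishingZ; first by rewrite mulr_ge0 ?L2norm_ge0// ltW.
exact: vanishing_geo (ltW q0) q1.
Qed.

Lemma neumann_sum_telescope f n x :
  z * neumann_sum f n x - mean f -
    \sum_(j < n) z^-1 * (z ^- j * iter j.+1 P (centered f) x) =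
  centered f x - z ^- n * iter n P (centered f) x.
Proof.
rewrite /neumann_sum mulrDr mulVKf// [_ + _ - mean f]addrAC subrr add0r.
elim: n => [|n IH]; first by rewrite !big_ord0 mulr0 expr0 invr1 mul1r !subrr.
rewrite !big_ord_recr /= mulrDr opprD addrACA IH /neumann_term mulVKf//.
by rewrite exprSr invfM; ring.
Qed.

(** The truncated series solves the resolvent equation up to a single iterate, which
    [orbit_vanishing] sends to 0. *)
Lemma B_neumann_sum f n : L2 mu f -> \forall x \ae mu,
  z * neumann_sum f n x - B (neumann_sum f n) x - f x =
  - (z ^- n * iter n P (centered f) x).
Proof.
move=> hf; have h0 := L2zero_L2 (L2zero_centered hf).
have ht j := L2zero_L2 (L2zero_term j hf).
have e1 := markov_sum p_inv n ht.
have hS := L2zero_term_sum n hf; have hS2 := L2zero_L2 hS.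
have e2 := markov_linear p_inv 1 hS2 (L2_cst mu (z^-1 * mean f)).
have e3 : \forall x \ae mu, forall j,
    P (neumann_term f j) x = z^-1 * (z ^- j * iter j.+1 P (centered f) x).
  apply: ae_foralln => j.
  have hi := iter_L2 p_inv j h0.
  have e4 := markov_scale p_inv z^-1 (L2Z (z ^- j) hi).
  have e5 := markov_scale p_inv (z ^- j) hi.
  by move: e4 e5; apply: filterS2 => x -> ->.
near=> x.
have mS : mean (neumann_sum f n) = z^-1 * mean f.
  rewrite mean_add//; last exact: L2_cst.
  by case: hS => _ ->; rewrite addr0 mean_cst.
have PS : P (neumann_sum f n) x = z^-1 * mean f +
    \sum_(j < n) z^-1 * (z ^- j * iter j.+1 P (centered f) x).
  rewrite (_ : neumann_sum f n = (fun x => 1 * \sum_(j < n) neumann_term f j x +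
    z^-1 * mean f)); last by apply/funext => y; rewrite mul1r addrC.
  rewrite (near e2 x)// mul1r markov_cst (near e1 x)// addrC; congr (_ + _).
  by apply: eq_bigr => j _; rewrite (near e3 x).
rewrite /mean_op mS PS [_ + _ - _ * _]addrAC subrr add0r.
have := neumann_sum_telescope f n x; rewrite /centered => e.
rewrite [X in _ - f x = X](_ : _ = (f x - mean f - z ^- n * iter n P (centered f) x) + mean f - f x).
  by rewrite -e; ring.
by rewrite /centered; ring.
Unshelve. all: by end_near. Qed.

(** Replacing [neumann f] by a partial sum costs at most [r + 2] times their distance, by [B_le];
    the equation for the partial sum has a vanishing error. *)
Lemma neumann_right f : L2 mu f ->
  \forall x \ae mu, z * neumann f x - B (neumann f) x = f x.
Proof.
move=> hf; have [hN van] := neumann_approx hf.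
have hX : L2 mu (fun x => z * neumann f x - B (neumann f) x - f x).
  by apply: L2B => //; apply: L2B; [exact: L2Z|exact: B_L2].
suff h0 : \forall x \ae mu, z * neumann f x - B (neumann f) x - f x = 0.
  by apply: filterS h0 => x /eqP; rewrite subr_eq0 => /eqP.
apply: (ae0_of_vanishing hX (u := fun n => (r + 2) *
  L2norm mu (fun x => neumann f x - neumann_sum f n x) +
  L2norm mu (fun x => z ^- n * iter n P (centered f) x))); last first.
  apply: vanishingD (orbit_vanishing hf); apply: vanishingZ van.
  by rewrite addr_ge0// ltW.
move=> n; have hS := L2_neumann_sum n hf; have hD := L2B hN hS.
have hz := L2Z z hD; have hB := B_L2 hD.
have hi : L2 mu (fun x => z ^- n * iter n P (centered f) x).
  by apply: L2Z; apply: iter_L2 => //; exact: L2zero_L2 (L2zero_centered hf).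
rewrite (@ae_L2norm _ _ _ mu _ (fun x => (z * (neumann f x - neumann_sum f n x) -
    B (fun x => neumann f x - neumann_sum f n x) x) -
    z ^- n * iter n P (centered f) x)) //; last 2 first.
- by apply: L2B => //; exact: L2B.
- have e1 := B_sub hN hS; have e2 := B_neumann_sum n hf.
  move: e1 e2; apply: filterS2 => x -> e2.
  rewrite -[- (z ^- n * _)]e2; ring.
apply: (le_trans (L2norm_triangleB (L2B hz hB) hi)); apply: lerD => //.
apply: (le_trans (L2norm_triangleB hz hB)).
by rewrite L2normZ// mulrDl; apply: lerD => //; exact: B_le.
Qed.

(** Prepares the left inverse. Since [B f] has mean zero, centring [z f - B f] gives [z - P] applied
    to the centred [f], and the series telescopes. *)
Lemma neumann_sum_shift f n : L2 mu f -> \forall x \ae mu,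
  neumann_sum (fun x => z * f x - B f x) n x - f x =
  - (z ^- n * iter n P (centered f) x).
Proof.
move=> hf; have hB := B_L2 hf; have hz := L2Z z hf.
have h0 := L2zero_L2 (L2zero_centered hf).
have mz : mean (fun x => z * f x) = z * mean f.
  rewrite (_ : (fun x => _) = (fun x => z * f x + 0)).
    by rewrite mean_linear ?mean_cst ?addr0//; exact: L2_cst.
  by apply/funext => x; rewrite addr0.
have mB : mean (B f) = 0.
  by rewrite mean_sub ?mean_markov ?mean_cst ?subrr//; [exact: markov_L2|exact: L2_cst].
have mg : mean (fun x => z * f x - B f x) = z * mean f.
  by rewrite mean_sub// mz mB subr0.
have hP := markov_L2 p_inv h0.
have e0 : \forall x \ae mu, centered (fun x => z * f x - B f x) x =
    z * centered f x + -1 * P (centered f) x.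
  have := markov_sub p_inv hf (L2_cst mu (mean f)); apply: filterS => x.
  rewrite -/(centered f) markov_cst => ->.
  by rewrite {1}/centered mg /centered /mean_op; ring.
have hm : L2 mu (fun x => -1 * P (centered f) x) by exact: L2Z.
have hL := L2D (L2Z z h0) hm.
have hg0 := L2zero_L2 (L2zero_centered (L2B hz hB)).
have e1 : \forall x \ae mu, forall j,
   iter j P (centered (fun x => z * f x - B f x)) x =
   z * iter j P (centered f) x - iter j.+1 P (centered f) x.
  apply: ae_foralln => j.
  have i1 := iter_ae p_inv j hg0 hL e0.
  have i2 := iter_linear p_inv j z h0 hm.
  have i3 := iter_scale p_inv j (-1) hP.
  near=> x; rewrite (near i1 x)// (near i2 x)// (near i3 x)// mulN1r.
  by rewrite -iterSr.
move: e1; apply: filterS => x e1.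
rewrite /neumann_sum mg mulKf//.
have -> : \sum_(j < n) neumann_term (fun x => z * f x - B f x) j x =
    z * (\sum_(j < n) neumann_term f j x) -
    \sum_(j < n) z^-1 * (z ^- j * iter j.+1 P (centered f) x).
  rewrite mulr_sumr -sumrB; apply: eq_bigr => j _.
  by rewrite /neumann_term e1; ring.
have := neumann_sum_telescope f n x; rewrite /neumann_sum mulrDr mulVKf// => e.
rewrite [RHS](_ : _ = (centered f x - z ^- n * iter n P (centered f) x) - centered f x); last by ring.
by rewrite -e /centered; ring.
Unshelve. all: by end_near. Qed.

Lemma neumann_left f : L2 mu f ->
  \forall x \ae mu, neumann (fun x => z * f x - B f x) x = f x.
Proof.
move=> hf; set g := fun x => z * f x - B f x.
have hg : L2 mu g by apply: L2B; [exact: L2Z|exact: B_L2].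
have [hN van] := neumann_approx hg; have hX := L2B hN hf.
suff h0 : \forall x \ae mu, neumann g x - f x = 0.
  by apply: filterS h0 => x /eqP; rewrite subr_eq0 => /eqP.
apply: (ae0_of_vanishing hX (u := fun n =>
  L2norm mu (fun x => neumann g x - neumann_sum g n x) +
  L2norm mu (fun x => z ^- n * iter n P (centered f) x))); last first.
  exact: vanishingD van (orbit_vanishing hf).
move=> n; have hS := L2_neumann_sum n hg; have hD := L2B hN hS.
have hi : L2 mu (fun x => z ^- n * iter n P (centered f) x).
  by apply: L2Z; apply: iter_L2 => //; exact: L2zero_L2 (L2zero_centered hf).
rewrite (@ae_L2norm _ _ _ mu _ (fun x => (neumann g x - neumann_sum g n x) -
    z ^- n * iter n P (centered f) x)) //; last 2 first.
- exact: L2B hD hi.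
- have := neumann_sum_shift n hf; apply: filterS => x e2.
  by rewrite -[- (z ^- n * _)]e2 -/g; ring.
exact: L2norm_triangleB.
Qed.

Lemma neumann_sum_linear (a : R[i]) f g n : L2 mu f -> L2 mu g ->
  \forall x \ae mu, neumann_sum (fun x => a * f x + g x) n x =
    a * neumann_sum f n x + neumann_sum g n x.
Proof.
move=> hf hg; have f0 := L2zero_L2 (L2zero_centered hf).
have g0 := L2zero_L2 (L2zero_centered hg).
have cE : centered (fun x => a * f x + g x) = (fun x => a * centered f x + centered g x).
  by apply/funext => x; rewrite /centered mean_linear//; ring.
have e1 : \forall x \ae mu, forall j, iter j P (centered (fun x => a * f x + g x)) x =
    a * iter j P (centered f) x + iter j P (centered g) x.
  by apply: ae_foralln => j; rewrite cE; exact: (iter_linear p_inv j a f0 g0).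
apply: filterS e1 => x e1; rewrite /neumann_sum mean_linear//.
have -> : \sum_(j < n) neumann_term (fun x => a * f x + g x) j x =
    a * (\sum_(j < n) neumann_term f j x) + \sum_(j < n) neumann_term g j x.
  rewrite mulr_sumr -big_split; apply: eq_bigr => j _.
  by rewrite /neumann_term e1 /=; ring.
by ring.
Qed.

(** [series_limit] takes default values on a null set, so linearity is not read off pointwise but
    obtained by comparing partial sums in norm. *)
Lemma neumann_linear (a : R[i]) f g : L2 mu f -> L2 mu g ->
  \forall x \ae mu, neumann (fun x => a * f x + g x) x =
    a * neumann f x + neumann g x.
Proof.
move=> hf hg; have hfg := L2D (L2Z a hf) hg.
have [hN0 v0] := neumann_approx hfg.
have [hNf vf] := neumann_approx hf; have [hNg vg] := neumann_approx hg.
have hX := L2B hN0 (L2D (L2Z a hNf) hNg).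
suff h0 : \forall x \ae mu, neumann (fun x => a * f x + g x) x -
    (a * neumann f x + neumann g x) = 0.
  by apply: filterS h0 => x /eqP; rewrite subr_eq0 => /eqP.
apply: (ae0_of_vanishing hX (u := fun n =>
  L2norm mu (fun x => neumann (fun x => a * f x + g x) x -
     neumann_sum (fun x => a * f x + g x) n x) +
  (ComplexField.Normc.normc a * L2norm mu (fun x => neumann f x - neumann_sum f n x) +
  L2norm mu (fun x => neumann g x - neumann_sum g n x)))); last first.
  apply: vanishingD v0 _; apply: vanishingD vg; apply: vanishingZ vf.
  by rewrite normc_nsq sqrtr_ge0.
move=> n.
have h1 := L2B hN0 (L2_neumann_sum n hfg).
have h2 := L2B hNf (L2_neumann_sum n hf).
have h3 := L2B hNg (L2_neumann_sum n hg).
have h4 := L2D (L2Z a h2) h3.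
rewrite (@ae_L2norm _ _ _ mu _ (fun x =>
  (neumann (fun x => a * f x + g x) x - neumann_sum (fun x => a * f x + g x) n x) -
  (a * (neumann f x - neumann_sum f n x) + (neumann g x - neumann_sum g n x)))) //;
  last 2 first.
- exact: L2B h1 h4.
- have := neumann_sum_linear a n hf hg; apply: filterS => x ->.
  move: (neumann _ x) (neumann f x) (neumann g x) (neumann_sum f n x)
    (neumann_sum g n x) => u1 u2 u3 u4 u5; ring.
apply: (le_trans (L2norm_triangleB h1 h4)); apply: lerD => //.
by apply: (le_trans (L2norm_triangle (L2Z a h2) h3)); rewrite L2normZ.
Qed.

(** The bound on the partial sums is uniform in [n] and so survives the limit. *)
Lemma neumann_bounded : exists M : R, forall f, L2 mu f ->
  L2norm mu (neumann f) <= M * L2norm mu f.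
Proof.
have [M hM] := neumann_sum_le; exists M => f hf.
have [hN van] := neumann_approx hf.
rewrite -subr_le0; apply: vanishing_cst; apply: vanishing_le van => n.
have hS := L2_neumann_sum n hf; rewrite lerBlDr.
apply: (@le_trans _ _ (L2norm mu (fun x => neumann f x - neumann_sum f n x) +
  L2norm mu (neumann_sum f n))); last by rewrite lerD2l; exact: hM.
apply: le_trans (L2norm_triangle (L2B hN hS) hS).
by rewrite le_eqVlt; apply/orP; left; apply/eqP; congr L2norm; apply/funext => x; rewrite subrK.
Qed.

Lemma mem_resolvent_set : resolvent_set mu B z.
Proof.
exists neumann; first split.
- by move=> f hf; have [] := neumann_approx hf.
- by move=> a f g hf hg; apply/aeqP; exact: neumann_linear.
- exact: neumann_bounded.
move=> f hf; split; apply/aeqP; [exact: neumann_left|exact: neumann_right].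
Qed.

End neumann.

Theorem theorem2 (R : realType)
  (d : measure_display) (T : measurableType d)
  (dW : measure_display) (W : measurableType dW) (Pr : probability W R)
  (xi : nat -> {RV Pr >-> T}) (p : R.-pker T ~> T) (mu : probability T R)
  (T_countably_generated : countably_generated T)
  (xi_markov : markov_chain xi p)
  (mu_invariant : invariant_probability p mu)
  (mu_unique : forall nu : probability T R, invariant_probability p nu ->
    forall A, measurable A -> nu A = mu A)
  (p_irreducible : irreducible_chain p mu)
  (p_recurrent : recurrent_chain p mu)
  (proper_sets_exist : exists A, proper_set mu A) :
  (L2_spectral_gap mu p <-> Mset p mu !=set0) /\
  (Mset p mu !=set0 ->
    spectrum mu (fun f x => markov_op p f x - mean_op mu f x)
      `<=` [set z : R[i] | `|z| <= Complex (r0 p mu) 0]).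
Proof.
split; first by split; [exact: gap_Mset|exact: Mset_gap].
move=> M0 z hz; apply: contrapT => /negP.
(* The order of [R[i]] compares real parts only when imaginary parts agree; both are 0 here, so
   failure of the bound means [r0] is below the modulus. *)
rewrite norm_complexE lecE /= eqxx /= -ltNge => rz; apply: hz.
by apply: mem_resolvent_set => //; exact: growth_rate_lt_r0.
Qed.
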